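(* Consider any $L$-layer Transformer $\mathcal T$ with embedding dimension $m$, attention dimension $m_a$, and projection functions $g^{(l)}$, $l\in[L]$, that are 2-layer ReLU MLPs with width $w$. For any $\delta\in(0,1)$ and $N\in\mathbb N^+$ (and approximation accuracy $\epsilon>0$), consider a $4L$-layer random Transformer $\mathcal T_{\mathrm{large}}$ with embedding dimension $m_{\mathrm{large}}=O(m\log(Lm/\delta))$, attention dimension $m_{\mathrm{large},a}=O\big(m_aL\log\frac{m_amLN}{\epsilon\delta}\big)$, and projection functions $g_{\mathrm{large}}$ that are 4-layer ReLU MLPs with width $w_{\mathrm{large}}=O\big(\max\{m,w\}L\log\frac{wmLN}{\epsilon\delta}\big)$. Assume that $\|W\|_2\le1$ for every weight matrix $W$ in $\mathcal T$, and suppose the weights of $\mathcal T_{\mathrm{large}}$ are randomly sampled as $W_{i,j}\sim U(-1,1)$ for every $W$ in $\mathcal T_{\mathrm{large}}$. Then, with probability $1-\delta$ over the randomness of $\mathcal T_{\mathrm{large}}$, there exists a nonstructural pruning of $\mathcal T_{\mathrm{large}}$, denoted $\tilde{\mathcal T}_{\mathrm{large}}$, which $\epsilon$-approximates $\mathcal T$ with respect to $\|\cdot\|_{1,2}$ for any input $X\in\mathbb R^{m\times N}$ satisfying $\|X\|_{1,2}\le1$; that is, for every such $X$, $$\big\|\tilde{\mathcal T}_{\mathrm{large}}(\bar X)-\overline{\mathcal T(X)}\big\|_{1,2}\le\epsilon\,\|X\|_{1,2},$$ where, since the input and output dimension of $\tilde{\mathcal T}_{\mathrm{large}}$ is $m_{\mathrm{large}}$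 rather than $m$, $\bar Y$ denotes $Y$ with the additional dimensions padded with zeros.
   Context: **Transformer.** An $L$-layer Transformer with embedding dimension $m$ and attention dimension $m_a$ acts on feature matrices $X\in\mathbb R^{m\times N}$ by $\mathcal T=f_L\circ\cdots\circ f_1$ (the linear decoding head is taken to be the identity), with layers $$f_l(X)=g^{(l)}\Big(\mathrm{LN}\big(W_V^{(l)}X\,\sigma(\mathcal C+(W_K^{(l)}X)^\top(W_Q^{(l)}X))\big)+X\Big),$$ where $W_K^{(l)},W_Q^{(l)}\in\mathbb R^{m_a\times m}$, $W_V^{(l)}\in\mathbb R^{m\times m}$; $\sigma$ is the column-wise softmax; $\mathcal C$ is the causal mask, $\mathcal C_{i,j}=-\infty$ if $i>j$ and $0$ otherwise; and $g^{(l)}$ is the (feed-forward) projection function, applied column-wise. All layers are assumed to share the same dimensions and form of projection function. **Extended LayerNorm.** To consider pruning, the LayerNorm is parameterized, on each column $a$, as $$\mathrm{LN}_{C_{LN}}[b](a)=b\,\frac{\mathcal P_\bot a}{\max\{\|\mathcal P_\bot a\|_2,C_{LN}\}}+(1-b)\,a,\qquad \mathcal P_\bot=I-\tfrac1n\mathbf 1\mathbf 1^\top$$ ($n$ the dimension of the column), with $C_{LN}$ the normalizing constant. The original LayerNorm corresponds to $b=1$. $\hat\theta$ denotes the set of parameters of this extended parameterization. **Nonstructural pruning.** Under the extended parameterization, a nonstructural pruning of a Transformer with parameters $\hat\theta$ is a Transformer with the same architecture and parameters $\hat\theta'$ such that for any weight matrix $W$ in $\hat\theta$ the corresponding matrix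 $W'$ in $\hat\theta'$ satisfies $W'_{i,j}\in\{W_{i,j},0\}$ for all $i,j$. **Approximation and norm.** $f:A\to B$ is an $\epsilon$-approximation of $g$ with respect to a norm $\|\cdot\|$ iff $\|f(x)-g(x)\|\le\epsilon\|x\|$ for all $x\in A$. $\|A\|_{1,2}=\max_i\|A_{:,i}\|_2$ is the maximum Euclidean norm of a column, and $\|W\|_2$ is the spectral norm.
   Formalization: In the size bounds each factor log x is read as max(1, log x) and ε as min(ε, 1), since the logarithms can otherwise be near zero or negative (e.g. L = m = 1 with δ near 1, or εδ > m_a m L N); the hidden constant may depend on C_LN. *)

(* Defs.v *)
From HB Require Import structures.
From mathcomp Require Export all_boot all_order all_algebra.
From mathcomp Require Export all_classical all_reals all_analysis.

Set Implicit Arguments.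
Unset Strict Implicit.
Unset Printing Implicit Defensive.

Import Order.TTheory GRing.Theory Num.Theory.
Import numFieldNormedType.Exports.

Local Open Scope classical_set_scope.
Local Open Scope ring_scope.

Section norms.
Context {R : realType}.

Definition l2norm n (v : 'cV[R]_n) : R := Num.sqrt (\sum_i v i 0 ^+ 2).

Definition norm12 m N (A : 'M[R]_(m, N)) : R :=
  \big[Num.max/0]_j l2norm (col j A).

(* The operator norm induced by [l2norm]; the set is nonempty (it contains 0)
   and bounded, so [sup] is a genuine supremum. *)
Definition spectral_norm p q (W : 'M[R]_(p, q)) : R :=
  sup [set l2norm (W *m x) | x in [set x : 'cV[R]_q | l2norm x <= 1]].

End norms.

Section transformer.
Context {R : realType}.

Definition relu p q (A : 'M[R]_(p, q)) : 'M[R]_(p, q) :=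
  map_mx (Num.max 0) A.

Definition softmax p q (A : 'M[\bar R]_(p, q)) : 'M[R]_(p, q) :=
  \matrix_(i, j) (fine (expeR (A i j)) / \sum_k fine (expeR (A k j))).

Definition causal_mask N : 'M[\bar R]_N :=
  \matrix_(i, j) (if (j < i)%N then -oo%E else 0%E).

Definition masked_scores N (S : 'M[R]_N) : 'M[\bar R]_N :=
  \matrix_(i, j) (causal_mask N i j + (S i j)%:E)%E.

Definition proj_perp n : 'M[R]_n := 1%:M - n%:R^-1 *: const_mx 1.

Definition layer_norm_col (C_LN b : R) n (a : 'cV[R]_n) : 'cV[R]_n :=
  (b / Num.max (l2norm (proj_perp n *m a)) C_LN) *: (proj_perp n *m a)
  + (1 - b) *: a.

Definition layer_norm (C_LN b : R) n N (A : 'M[R]_(n, N)) : 'M[R]_(n, N) :=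
  \matrix_(i, j) layer_norm_col C_LN b (col j A) i 0.

(* The projection function is a bias-free ReLU MLP of width [w] with [h]
   hidden-to-hidden matrices, i.e. with h + 2 linear layers.
   [ln_b] is the parameter b of the extended LayerNorm. *)
Record layer_params (m ma w h : nat) := LayerParams {
  W_K : 'M[R]_(ma, m);
  W_Q : 'M[R]_(ma, m);
  W_V : 'M[R]_m;
  W_in : 'M[R]_(w, m);
  W_hid : 'I_h -> 'M[R]_w;
  W_out : 'M[R]_(m, w);
  ln_b : R }.

Definition params (L m ma w h : nat) := 'I_L -> layer_params m ma w h.

Section forward.
Variables (C_LN : R) (m ma w h N : nat).

Definition mlp (p : layer_params m ma w h) (X : 'M[R]_(m, N)) : 'M[R]_(m, N) :=
  W_out p *m foldl (fun Y k => relu (W_hid p k *m Y))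
                   (relu (W_in p *m X)) (enum 'I_h).

Definition attention (p : layer_params m ma w h) (X : 'M[R]_(m, N)) :
    'M[R]_(m, N) :=
  W_V p *m X *m softmax (masked_scores ((W_K p *m X)^T *m (W_Q p *m X))).

Definition layer (p : layer_params m ma w h) (X : 'M[R]_(m, N)) :
    'M[R]_(m, N) :=
  mlp p (layer_norm C_LN (ln_b p) (attention p X) + X).

Definition transformer L (T : params L m ma w h) (X : 'M[R]_(m, N)) :
    'M[R]_(m, N) :=
  foldl (fun Y l => layer (T l) Y) X (enum 'I_L).

End forward.

Definition original_LN L m ma w h (T : params L m ma w h) : Prop :=
  forall l, ln_b (T l) = 1.

Definition weights_le1 L m ma w h (T : params L m ma w h) : Prop :=
  forall l,
    [/\ spectral_norm (W_K (T l)) <= 1,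
        spectral_norm (W_Q (T l)) <= 1 &
        spectral_norm (W_V (T l)) <= 1] /\
    [/\ spectral_norm (W_in (T l)) <= 1,
        (forall k, spectral_norm (W_hid (T l) k) <= 1) &
        spectral_norm (W_out (T l)) <= 1].

Definition mx_pruning p q (W W' : 'M[R]_(p, q)) : Prop :=
  forall i j, W' i j = W i j \/ W' i j = 0.

(* The LayerNorm parameter b is pruned like a 1 x 1 weight matrix; C_LN is part
   of the architecture and is not changed. *)
Definition pruning L m ma w h (T T' : params L m ma w h) : Prop :=
  forall l,
    [/\ mx_pruning (W_K (T l)) (W_K (T' l)),
        mx_pruning (W_Q (T l)) (W_Q (T' l)) &
        mx_pruning (W_V (T l)) (W_V (T' l))] /\
    [/\ mx_pruning (W_in (T l)) (W_in (T' l)),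
        (forall k, mx_pruning (W_hid (T l) k) (W_hid (T' l) k)),
        mx_pruning (W_out (T l)) (W_out (T' l)) &
        ln_b (T' l) = ln_b (T l) \/ ln_b (T' l) = 0].

(* Zero padding of the feature dimension; meant for m <= m'. *)
Definition pad m m' N (X : 'M[R]_(m, N)) : 'M[R]_(m', N) :=
  \matrix_(i, j) (if insub (val i) is Some k then X k j else 0).

End transformer.

Arguments layer_params R m ma w h : clear implicits.
Arguments params R L m ma w h : clear implicits.

Inductive weight_index (L m ma w h : nat) : Type :=
| IdxK of 'I_L & 'I_ma & 'I_m
| IdxQ of 'I_L & 'I_ma & 'I_m
| IdxV of 'I_L & 'I_m & 'I_m
| IdxIn of 'I_L & 'I_w & 'I_m
| IdxHid of 'I_L & 'I_h & 'I_w & 'I_w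
| IdxOut of 'I_L & 'I_m & 'I_w.

Arguments IdxK {L m ma w h}.
Arguments IdxQ {L m ma w h}.
Arguments IdxV {L m ma w h}.
Arguments IdxIn {L m ma w h}.
Arguments IdxHid {L m ma w h}.
Arguments IdxOut {L m ma w h}.

Definition params_of_entries (R : realType) (L m ma w h : nat)
    (x : weight_index L m ma w h -> R) : params R L m ma w h :=
  fun l => {|
    W_K := \matrix_(i, j) x (IdxK l i j);
    W_Q := \matrix_(i, j) x (IdxQ l i j);
    W_V := \matrix_(i, j) x (IdxV l i j);
    W_in := \matrix_(i, j) x (IdxIn l i j);
    W_hid := fun k => \matrix_(i, j) x (IdxHid l k i j);
    W_out := \matrix_(i, j) x (IdxOut l i j);
    ln_b := 1 |}.

Section randomness.
Context {R : realType} {d : measure_display} {Omega : measurableType d}.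
Variable P : probability Omega R.

Definition independent_RVs (I : Type) (xi : I -> {RV P >-> R}) : Prop :=
  forall (n : nat) (f : 'I_n -> I) (B : 'I_n -> set R),
    injective f -> (forall k, measurable (B k)) ->
    P (\bigcap_k (xi (f k) @^-1` B k)) = (\prod_k P (xi (f k) @^-1` B k))%E.

Definition uniform_RV (X : {RV P >-> R}) : Prop :=
  forall A : set R, measurable A ->
    distribution P X A = uniform_prob (gtrN (@ltr01 R)) A.

(* "With probability at least p": E need not be known to be measurable. *)
Definition with_prob_ge (E : set Omega) (p : R) : Prop :=
  exists A : set Omega, [/\ measurable A, A `<=` E & (p%:E <= P A)%E].

End randomness.

(* The factor log x of an O-bound. The O-notation presupposes a logarithm
   bounded away from 0, but its argument can be arbitrarily close to 1, as for
   L m / delta with L = m = 1. *)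
Definition Olog {R : realType} (x : R) : R := Num.max 1 (ln x).

(* Main.v *)
(* A pruned random four-layer MLP approximates every map x |-> B relu (A x): its
   first and third matrices are pruned so that each input (resp. hidden unit) is
   fanned out to many neurons with random weights a_k, and its second and fourth
   matrices keep a subset of their random weights b_k for which the sum of
   max(+-a_k, 0) b_k is close to the prescribed entry.  By the random subset sum
   theorem O(log(1/eta)) neurons per entry give accuracy eta.

   The attention matrices need no approximation.  They are pruned to partial
   permutations whose entries lie in [1/2, 1], and the preceding MLP writes the
   values (centered by the projection of the LayerNorm), keys and queries to the
   selected coordinates, divided by these entries.  A layer of the target thus
   takes two large layers, one whose attention is pruned away and one that
   performs the attention and the MLP; the other two approximate the identity.

   The output of a LayerNorm has norm at most 1, so the activations of the target
   grow only linearly with the depth and its layers are O(L^2)-Lipschitz.  An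
   error is amplified at most exp(O(L log L)) times, which the factor L log of the
   widths absorbs. *)
Require Import Defs.
From mathcomp Require Import zify ring lra.

Set Implicit Arguments.
Unset Strict Implicit.
Unset Printing Implicit Defensive.

Import Order.TTheory GRing.Theory Num.Theory.
Import numFieldNormedType.Exports.

Local Open Scope ring_scope.

(** * Random subset sums *)

(** Subset sums are counted on a grid of mesh 1/(4q). The number [q] occurs in the analysis only,
    not in the network, so it may be exponential in the number of neurons per entry, and the loss
    n/q becomes negligible. The embedding dimension depends neither on the accuracy nor on the width
    of the MLP, which leaves no room for subset sums in the attention: single weights have to do.
    The row of a value entry is fixed by the residual stream, so its [jv] candidates are columns and
    use up embedding dimension; the column of a key or query is fixed, so its [jk] candidates are
    rows and use up attention dimension. Events for different matrix entries share weights. They are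
    combined by union bounds only; independence is used within a single event. The choice of sizes
    is circular: the number [b] of neurons per entry must beat the fineness of the grid, which must
    beat [b]. The second dependence is only logarithmic, which resolves the circle. *)

Section finite_subset_sum.
Variables (R : realFieldType) (Om : finType) (phi : Om -> int).
Variables (M : nat) (i0 : 'I_M) (kappa : R).
Hypothesis kappa_ge0 : 0 <= kappa.
Hypothesis fibre : forall i j : 'I_M,
  kappa * #|Om|%:R <= #|[set w | phi w == i%:Z - j%:Z]|%:R.

(** A target is an integer [i - i0]: [i0] marks the sum 0, and sums of both signs are indexed by
    ['I_M]. *)
Definition reach n (t : {ffun 'I_n -> Om}) : {set 'I_M} :=
  [set i : 'I_M | [exists S : {set 'I_n},
     \sum_(k in S) phi (t k) == i%:Z - i0%:Z]].

Let shift (w : Om) (A : {set 'I_M}) : {set 'I_M} :=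
  A :|: [set i : 'I_M | [exists j in A, phi w == i%:Z - j%:Z]].

Let potential (A : {set 'I_M}) : R := (M%:R - #|A|%:R) / #|A|%:R.

Let cons_ffun n (w : Om) (t : {ffun 'I_n -> Om}) : {ffun 'I_n.+1 -> Om} :=
  [ffun i => if unlift ord0 i is Some j then t j else w].

Let sum_ffunS n (F : {ffun 'I_n.+1 -> Om} -> R) :
  \sum_t F t = \sum_(t : {ffun 'I_n -> Om}) \sum_w F (cons_ffun w t).
Proof.
rewrite exchange_big /= pair_big /=.
rewrite (reindex (fun p : Om * {ffun 'I_n -> Om} => cons_ffun p.1 p.2)) //=.
exists (fun t : {ffun 'I_n.+1 -> Om} => (t ord0, [ffun i => t (lift ord0 i)])).
  move=> [w t] _ /=; congr pair; first by rewrite ffunE unlift_none.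
  by apply/ffunP => i; rewrite !ffunE liftK.
move=> t _; apply/ffunP => i; rewrite !ffunE /=.
by case: unliftP => [j ->|->]; rewrite ?ffunE.
Qed.

(** Only an inclusion: a sum may leave the window ['I_M] and return to it, and [shift] does not
    follow such sums. *)
Let reach_cons n w (t : {ffun 'I_n -> Om}) :
  shift w (reach t) \subset reach (cons_ffun w t).
Proof.
have sumS (S : {set 'I_n}) :
    \sum_(k in (lift ord0) @: S) phi (cons_ffun w t k) =
    \sum_(k in S) phi (t k).
  rewrite big_imset /=; last by move=> ? ? _ _; exact: lift_inj.
  by apply: eq_bigr => k _; rewrite ffunE liftK.
apply/fintype.subsetP => i; rewrite !inE => /orP[/existsP[S /eqP HS]|].
  by apply/existsP; exists ((lift ord0) @: S); rewrite sumS HS.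
move=> /existsP[j]; rewrite inE => /andP[/existsP[S /eqP HS] /eqP Hw].
apply/existsP; exists (ord0 |: (lift ord0) @: S).
rewrite big_setU1; last first.
  by apply/imsetP => -[k _] /eqP; rewrite (negbTE (neq_lift _ _)).
by rewrite /= sumS HS ffunE unlift_none Hw; apply/eqP; lia.
Qed.

Let card_shift w (A : {set 'I_M}) : (#|shift w A| <= 2 * #|A|)%N.
Proof.
rewrite mul2n -addnn (leq_trans (leq_card_setU _ _)) // leq_add2l.
set B := [set i | _].
have /fin_all_exists[g Hg] : forall i : 'I_M, exists j : 'I_M,
    i \in B -> (j \in A) /\ (phi w = i%:Z - j%:Z).
  move=> i; have [|_] := boolP (i \in B); last by exists i.
  by rewrite inE => /existsP[j /andP[jA /eqP wE]]; exists j.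
rewrite -(@card_in_imset _ _ g B); last first.
  move=> i j /Hg[_ H1] /Hg[_ H2] gij; apply: val_inj.
  by move: H1 H2; rewrite gij => -> /= H; lia.
by apply/subset_leq_card/fintype.subsetP => _ /imsetP[i /Hg[H _] ->].
Qed.

(** Double counting: a missed [i] and a reached [j] are linked by at least [kappa * #|Om|] samples,
    and one sample leads to a given [i] from at most one [j]. *)
Let sum_shift (A : {set 'I_M}) :
  (\sum_w #|shift w A|%:R : R) >=
  #|Om|%:R * #|A|%:R + (M%:R - #|A|%:R) * #|A|%:R * (kappa * #|Om|%:R).
Proof.
have cardE w : #|shift w A|%:R = #|A|%:R +
    \sum_(i in ~: A) \sum_(j in A) (phi w == i%:Z - j%:Z)%:R :> R.
  have -> : shift w A = A :|: [set i in ~: A |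
      [exists j in A, phi w == i%:Z - j%:Z]].
    by apply/setP => i; rewrite !inE; case: (i \in A).
  rewrite cardsU (_ : _ :&: _ = finset.set0) ?cards0 ?subn0; last first.
    by apply/setP => i; rewrite !inE; case: (i \in A).
  rewrite natrD; congr (_ + _).
  rewrite -sum1_card natr_sum big_mkcond [RHS]big_mkcond /=.
  apply: eq_bigr => i _; rewrite !inE; case: ifP => [/andP[-> ]|].
    move=> /existsP[j /andP[jA wj]].
    rewrite (bigD1 j) //= wj big1 ?addr0 // => k /andP[_ kj].
    suff /negbTE -> : phi w != i%:Z - k%:Z by [].
    apply: contra kj => wk; apply/eqP/val_inj.
    by move: wj wk => /eqP -> /= /eqP H; lia.
  case: (i \in A) => //= /negbT H; rewrite big1 // => j jA.
  suff /negbTE -> : phi w != i%:Z - j%:Z by [].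
  by apply: contra H => H; apply/existsP; exists j; rewrite jA.
under eq_bigr do rewrite cardE.
rewrite big_split /= sumr_const mulr_natl lerD2l //.
rewrite exchange_big /=; under eq_bigr do rewrite exchange_big /=.
apply: (@le_trans _ _ (\sum_(i in ~: A) \sum_(j in A) (kappa * #|Om|%:R))).
  have -> : M%:R - #|A|%:R = #|~: A|%:R :> R.
    by apply/eqP; rewrite subr_eq -natrD addnC cardsC card_ord.
  by rewrite !sumr_const -mulrnA -natrM mulnC mulr_natl.
apply: ler_sum => i _; apply: ler_sum => j _.
apply: (le_trans (fibre i j)).
rewrite -sum1_card natr_sum big_mkcond /=.
by apply: ler_sum => w _; rewrite inE; case: ifP.
Qed.

(** With x and y the cardinalities before and after one sample, y <= 2x gives 1/(xy) >= 1/(2x^2).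
    The new potential is thus at most an affine function of y, to which [sum_shift] applies. *)
Let potential_shift (A : {set 'I_M}) : (0 < #|A|)%N ->
  \sum_w potential (shift w A) <=
  #|Om|%:R * (1 - kappa * M%:R / 2) * potential A.
Proof.
move=> A0; set x : R := #|A|%:R.
have x0 : 0 < x by rewrite ltr0n.
have step w : potential (shift w A) <=
    potential A - M%:R / (2 * x ^+ 2) * (#|shift w A|%:R - x).
  rewrite /potential -/x; set y : R := #|_|%:R.
  have xy : x <= y by rewrite ler_nat subset_leq_card // finset.subsetUl.
  have y2x : y <= 2 * x by rewrite -natrM ler_nat card_shift.
  have y0 : 0 < y by exact: lt_le_trans xy.
  have -> : (M%:R - y) / y = (M%:R - x) / x - M%:R * ((y - x) / (x * y)).
    by field; rewrite !gt_eqF.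
  rewrite lerD2l lerN2 -mulrA ler_wpM2l // mulrC ler_wpM2l ?subr_ge0 //.
  rewrite lef_pV2 ?posrE ?(mulr_gt0, exprn_gt0) //.
  by rewrite expr2 mulrCA ler_pM2l.
apply: (le_trans (ler_sum _ (fun w _ => step w))).
have sumc (y : R) : \sum_(w : Om) y = #|Om|%:R * y by rewrite sumr_const mulr_natl.
rewrite big_split /= sumc sumrN -mulr_sumr sumrB sumc.
have := sum_shift A; rewrite -/x.
set s := \sum_w _; set N : R := #|Om|%:R => Hs.
apply: (@le_trans _ _ (N * potential A - M%:R / (2 * x ^+ 2) *
   ((M%:R - x) * x * (kappa * N)))).
  rewrite lerD2l lerN2 ler_wpM2l //; last by rewrite lerBrDl.
  by rewrite divr_ge0 // mulr_ge0 // exprn_ge0 // ltW.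
rewrite le_eqVlt; apply/orP; left; apply/eqP.
by rewrite /potential -/x; field; rewrite gt_eqF.
Qed.

Let reach_i0 n (t : {ffun 'I_n -> Om}) : i0 \in reach t.
Proof. by rewrite inE; apply/existsP; exists finset.set0; rewrite big_set0 subrr. Qed.

(** The hypothesis keeps the contraction factor nonnegative; [M] bounds the initial potential
    because [i0] is always reached. *)
Let sum_potential n : kappa * M%:R <= 2 ->
  \sum_(t : {ffun 'I_n -> Om}) potential (reach t) <=
  (#|Om|%:R * (1 - kappa * M%:R / 2)) ^+ n * M%:R.
Proof.
move=> kM; elim: n => [|n IHn].
  rewrite expr0 mul1r (eq_bigl (pred1 [ffun i : 'I_0 => False_rect Om (notF (ltn_ord
      i))])); last first.
    by move=> t; apply/esym/eqP/ffunP => -[].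
  rewrite big_pred1_eq /potential; set x := #|_|.
  have x0 : (0 < x)%N by apply/card_gt0P; exists i0; exact: reach_i0.
  rewrite ler_pdivrMr ?ltr0n //; apply: (@le_trans _ _ M%:R);
      first by rewrite lerBlDr lerDl.
  by rewrite ler_peMr // ler1n.
rewrite sum_ffunS exprS -mulrA.
apply: (le_trans _ (ler_wpM2l _ IHn)); last first.
  by rewrite mulr_ge0 // subr_ge0 ler_pdivrMr // mul1r.
rewrite mulr_sumr; apply: ler_sum => t _.
have rt0 : (0 < #|reach t|)%N by apply/card_gt0P; exists i0; exact: reach_i0.
apply: (le_trans _ (potential_shift rt0)); apply: ler_sum => w _.
have le_shift := subset_leq_card (reach_cons w t).
have s0 : (0 < #|shift w (reach t)|)%N.
  by rewrite (leq_trans rt0) // subset_leq_card // finset.subsetUl.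
have p0 : (0 < #|reach (cons_ffun w t)|)%N by exact: leq_trans le_shift.
rewrite /potential !mulrBl !divff ?lt0r_neq0 ?ltr0n // lerD2r.
by rewrite ler_wpM2l // lef_pV2 ?posrE ?ltr0n // ler_nat.
Qed.

(* The potential (M - #A) / #A of the set A of reached targets contracts in
   mean, and it is at least 1/M as long as a target is missed. *)
Lemma card_subset_sum_miss n : kappa * M%:R <= 2 ->
  #|[set t : {ffun 'I_n -> Om} | reach t != [set: 'I_M]]|%:R <=
  #|Om|%:R ^+ n * ((1 - kappa * M%:R / 2) ^+ n * M%:R ^+ 2).
Proof.
move=> kM; have M0 : (0 < M)%N by exact: leq_ltn_trans (ltn_ord i0).
have HM : 0 < M%:R^-1 :> R by rewrite invr_gt0 ltr0n.
rewrite expr2 mulrCA !mulrA -exprMn_comm; last exact: mulrC.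
rewrite -ler_pdivrMr ?ltr0n // [_ * #|Om|%:R]mulrC.
apply: (le_trans _ (sum_potential n kM)).
rewrite -sum1_card natr_sum mulr_suml big_mkcond /=.
apply: ler_sum => t _; rewrite inE.
have rt0 : (0 < #|reach t|)%N by apply/card_gt0P; exists i0; exact: reach_i0.
have rM : (#|reach t| <= M)%N by rewrite -[X in (_ <= X)%N](card_ord M) max_card.
case: ifP => [miss|_]; last first.
  by rewrite /potential divr_ge0 // subr_ge0 ler_nat.
have {}miss : (#|reach t| < M)%N.
  rewrite ltn_neqAle rM andbT; apply: contraNneq (negbT (negbF miss)) => H.
  by rewrite eqEcard finset.subsetT cardsT card_ord H leqnn.
rewrite /potential mul1r -[M%:R^-1]mul1r ler_pM ?invr_ge0 //.
  by rewrite -natrB // ler1n subn_gt0.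
by rewrite lef_pV2 ?posrE ?ltr0n // ler_nat.
Qed.

End finite_subset_sum.

(** In units of the mesh 1/mu, [al] and [be] are corners of the cells of [a] and [b], and [d] is
    their rounded product. Moving b to its corner, moving a to its corner and rounding cost mu each,
    on the scale mu^2. *)
Lemma product_close (R : realFieldType) (mu a b al be d : R) :
  0 < mu -> 0 <= a -> a <= 1 -> al - 1 <= mu * a <= al + 1 ->
  be <= mu * b <= be + 1 -> `|be| <= mu -> d * mu <= al * be <= d * mu + mu ->
  `|a * b - d / mu| <= 3 / mu.
Proof.
move=> mu0 a0 a1 /andP[h1 h2] /andP[h3 h4];
    rewrite ler_norml => /andP[h5 h6] /andP[h7 h8].
have -> : a * b - d / mu = (mu * a * (mu * b) - d * mu) / mu / mu.
  by field; rewrite gt_eqF.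
rewrite normrM normrV ?unitfE ?gt_eqF // [`|mu|]gtr0_norm // ler_pM2r ?invr_gt0 //.
rewrite normrM normrV ?unitfE ?gt_eqF // [`|mu|]gtr0_norm // ler_pdivrMr //.
have -> : mu * a * (mu * b) - d * mu =
  mu * a * (mu * b - be) + be * (mu * a - al) + (al * be - d * mu) by ring.
have e1 : `|mu * a * (mu * b - be)| <= mu.
  rewrite -[X in _ <= X]mulr1 normrM ler_pM //.
    by rewrite ger0_norm ?(mulr_ge0 (ltW mu0)) // ler_piMr // ltW.
  by rewrite ler_norml; lra.
have e2 : `|be * (mu * a - al)| <= mu.
  by rewrite -[X in _ <= X]mulr1 normrM ler_pM // ler_norml; lra.
have e3 : `|al * be - d * mu| <= mu by rewrite ler_norml; lra.
have := ler_normD (mu * a * (mu * b - be) + be * (mu * a - al)) (al * be - d * mu).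
have := ler_normD (mu * a * (mu * b - be)) (be * (mu * a - al)).
lra.
Qed.

Lemma divz_bounds (R : realFieldType) (p : int) (m : nat) : (0 < m)%N ->
  (p %/ m%:Z)%Z%:~R * m%:R <= (p%:~R : R) <= (p %/ m%:Z)%Z%:~R * m%:R + m%:R.
Proof.
move=> m0; have m1 : 0 < m%:Z by lia.
have r0 := modz_ge0 p (lt0r_neq0 m1); have r1 := ltz_pmod p m1.
have -> : p%:~R = (p %/ m%:Z)%Z%:~R * m%:R + (p %% m%:Z)%Z%:~R :> R.
  by rewrite [in LHS](divz_eq p m%:Z) intrD intrM.
rewrite lerDl lerD2l.
by rewrite ler0z r0 /= (pmulrn 1 m) ler_int ltW.
Qed.

(** * Discretized products of two weights *)

Section grid_products.
Variables (R : realType) (q : nat).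
Hypothesis q_gt0 : (0 < q)%N.

(* The grid has the 8q cells [(g - 4q) / 4q, (g + 1 - 4q) / 4q] of [-1, 1]. *)
Definition in_cell (g : 'I_(8 * q)) (x : R) : bool :=
  (g%:R - (4 * q)%:R <= (4 * q)%:R * x <= g.+1%:R - (4 * q)%:R).

(** [alpha] and [beta] are the lower corners of the cells of a (of -a if [s] is false) and of b. The
    condition on [alpha] means a weight of at least 1/2; the default 0 marks a discarded pair. *)
Definition grid_product (s : bool) (t : {ffun bool -> 'I_(8 * q)}) : int :=
  let alpha := if s then (t false)%:Z - (4 * q)%:Z
               else (4 * q)%:Z - (t false).+1%:Z in
  let beta := (t true)%:Z - (4 * q)%:Z in
  if (2 * q)%:Z <= alpha then (alpha * beta %/ (4 * q)%:Z)%Z else 0.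

Let grid_mid_proof : (q < 2 * q)%N. Proof. by lia. Qed.
Definition grid_mid : 'I_(2 * q) := Ordinal grid_mid_proof.

(** Each of the 2q values of [alpha] in [2q, 4q) has a [beta] with rounded product y: consecutive
    multiples of [alpha] are less than 4q apart, and |y| < 2q <= alpha keeps [beta] on the grid. So
    2q of the 64 q^2 pairs, a fraction 1/(32q), yield y. *)
Let grid_product_fibre s (i j : 'I_(2 * q)) :
  (32 * q)%:R^-1 * #|{ffun bool -> 'I_(8 * q)}|%:R <=
  #|[set t | grid_product s t == i%:Z - j%:Z]|%:R :> R.
Proof.
have -> : (32 * q)%:R^-1 * #|{ffun bool -> 'I_(8 * q)}|%:R = (2 * q)%:R :> R.
  rewrite card_ffun card_bool card_ord.
  have -> : ((8 * q) ^ 2 = 32 * q * (2 * q))%N by rewrite expnS expn1; lia.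
  by rewrite [X in _ * X]natrM mulrA mulVf ?mul1r // pnatr_eq0; lia.
rewrite ler_nat; pose y := i%:Z - j%:Z.
have [y1 y2] : (- (2 * q)%:Z < y /\ y < (2 * q)%:Z).
  by rewrite /y; have := ltn_ord i; have := ltn_ord j; lia.
pose al (e : 'I_(2 * q)) : int := (2 * q + e)%:Z.
(* The quotient 4qy / al rounded up; as al < 4q, the product al * be then has quotient exactly y by
   4q. *)
pose be e : int := - ((- (y * (4 * q)%:Z)) %/ al e)%Z.
have beP e : y * (4 * q)%:Z <= al e * be e < y * (4 * q)%:Z + al e.
  rewrite /be; have al0 : 0 < al e by rewrite /al; lia.
  have := divz_eq (- (y * (4 * q)%:Z)) (al e).
  have := ltz_pmod (- (y * (4 * q)%:Z)) al0.
  have := modz_ge0 (- (y * (4 * q)%:Z)) (lt0r_neq0 al0).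
  set d := (_ %/ _)%Z; set r := (_ %% _)%Z; lia.
have al1 e : (2 * q)%:Z <= al e < (4 * q)%:Z.
  by rewrite /al; have := ltn_ord e; lia.
have be1 e : - (4 * q)%:Z <= be e < (4 * q)%:Z.
  have := beP e; have := al1 e; move: (al e) (be e) => a b /andP[a1 a2] /andP[b1 b2].
  by apply/andP; split; nia.
pose na e : nat := absz (if s then al e + (4 * q)%:Z else (4 * q)%:Z - al e - 1)%R.
pose nb e : nat := absz (be e + (4 * q)%:Z)%R.
have ga e : (na e < 8 * q)%N by have := al1 e; rewrite /na; case: (s); lia.
have gb e : (nb e < 8 * q)%N by have := be1 e; rewrite /nb; lia.
pose F e : {ffun bool -> 'I_(8 * q)} :=
  [ffun x => if x then Ordinal (gb e) else Ordinal (ga e)].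
rewrite -[X in (X <= _)%N]card_ord -(@card_imset _ _ F); last first.
  move=> e1 e2 /ffunP/(_ false); rewrite !ffunE => -[H]; apply: val_inj.
  move: H; have := al1 e1; have := al1 e2; rewrite /na /al /=.
  by case: (s); lia.
apply/subset_leq_card/fintype.subsetP => _ /imsetP[e _ ->].
rewrite inE /grid_product !ffunE /=.
have -> : (nb e)%:Z - (4 * q)%:Z = be e by have := be1 e; rewrite /nb; lia.
have -> : (if s then (na e)%:Z - (4 * q)%:Z else (4 * q)%:Z - (na e).+1%:Z) = al e.
  by have := al1 e; rewrite /na; case: (s); lia.
have /andP[-> al2] := al1 e; apply/eqP; rewrite -/y.
have := beP e; set p := al e * be e => Hp.
have q0 : 0 < (4 * q)%:Z by lia.
have := divz_eq p (4 * q)%:Z; have := ltz_pmod p q0.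
have := modz_ge0 p (lt0r_neq0 q0); set d := (_ %/ _)%Z; set r := (_ %% _)%Z.
move=> r0 r1 pE; have H1 : (d - y) * (4 * q)%:Z < (4 * q)%:Z by lia.
have H2 : - (4 * q)%:Z < (d - y) * (4 * q)%:Z by lia.
by move: H1 H2; nia.
Qed.

(** 31/32 is 1 - kappa M / 2 for kappa = 1/(32q) and M = 2q: the rate does not depend on [q]. *)
Lemma card_grid_miss s n :
  #|[set t : {ffun 'I_n -> {ffun bool -> 'I_(8 * q)}} |
       reach (grid_product s) grid_mid t != [set: 'I_(2 * q)]]|%:R <=
  #|{ffun bool -> 'I_(8 * q)}|%:R ^+ n *
    ((31 / 32) ^+ n * (2 * q)%:R ^+ 2) :> R.
Proof.
have q0 : q%:R != 0 :> R by rewrite pnatr_eq0 -lt0n.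
have kM : (32 * q)%:R^-1 * (2 * q)%:R = 1 / 16 :> R.
  by rewrite !natrM; field.
have -> : 31 / 32 = 1 - (32 * q)%:R^-1 * (2 * q)%:R / 2 :> R by rewrite kM; field.
apply: card_subset_sum_miss.
- by rewrite invr_ge0.
- exact: grid_product_fibre.
- by rewrite kM; lra.
Qed.

Lemma in_cell_le1 g x : in_cell g x -> `|x| <= 1.
Proof.
have q0 : 0 < (4 * q)%:R :> R by rewrite ltr0n muln_gt0.
move=> /andP[h1 h2]; rewrite ler_norml; apply/andP; split; rewrite -(ler_pM2l q0).
  by apply: le_trans h1; rewrite mulrN mulr1 lerBrDl subrr.
apply: (le_trans h2); rewrite mulr1 lerBlDr -natrD ler_nat.
by have := ltn_ord g; lia.
Qed.

Let grid_product_close s (t : {ffun bool -> 'I_(8 * q)}) (a b : R) :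
  in_cell (t false) a -> in_cell (t true) b ->
  `|(if grid_product s t == 0 then 0 else
     Num.max (if s then a else - a) 0 * b) - (grid_product s t)%:~R / (4 * q)%:R|
   <= 3 / (4 * q)%:R.
Proof.
have q0 : 0 < (4 * q)%:R :> R by rewrite ltr0n muln_gt0.
move=> Ha Hb; have a1 := in_cell_le1 Ha; have b1 := in_cell_le1 Hb.
case: eqP => [->|]; first by rewrite mul0r subr0 normr0 divr_ge0.
rewrite /grid_product; set al : int := if s then _ else _; set be : int := _ - _.
set a' := if s then a else - a.
case: ifP => // Hal _.
set mu : R := (4 * q)%:R in q0 *.
have al1 : al%:~R - 1 <= mu * a' <= al%:~R + 1.
  move: Ha; rewrite /in_cell /al /a' -/mu.
  by case: (s); rewrite ?intrD ?rmorphB /= -?pmulrn -/mu -?[in X in X -> _]natr1 -?[in X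
      in _ -> X]natr1; lra.
have be1 : be%:~R <= mu * b <= be%:~R + 1.
  by move: Hb; rewrite /in_cell /be -/mu rmorphB /= -!pmulrn -/mu -natr1; lra.
have be2 : `|be%:~R : R| <= mu.
  rewrite /be rmorphB /= -!pmulrn -/mu ler_norml; have := ltn_ord (t true).
  rewrite -(ltr_nat R) => H; rewrite lerBrDl subrr ler0n /= lerBlDr -natrD.
  by rewrite ler_nat; move: (ltn_ord (t true)); clear; lia.
have a'0 : 0 <= a'.
  rewrite -(pmulr_rge0 _ q0); case/andP: al1 => + _; apply: le_trans.
  by rewrite subr_ge0 -[1]/(1%:~R) ler_int; lia.
have a'1 : a' <= 1 by rewrite /a'; case: (s); move: a1; rewrite ler_norml; lra.
have -> : Num.max a' 0 = a' by exact/max_idPl.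
set p := al * be.
have pE : p%:~R = al%:~R * be%:~R :> R by rewrite /p intrM.
have Hd : (p %/ (4 * q)%:Z)%Z%:~R * mu <= al%:~R * be%:~R <= (p %/ (4 * q)%:Z)%Z%:~R * mu
    + mu.
  by rewrite -pE; apply: divz_bounds; rewrite muln_gt0.
exact: (product_close q0 a'0 a'1 al1 be1 be2 Hd).
Qed.

(** Each of at most n products is off by 3/(4q), and rounding the target down costs 1/(4q) more. The
    bound 1/8 puts the rounded target into the window [-q, q). *)
Lemma grid_subset_sum s n (t : {ffun 'I_n -> {ffun bool -> 'I_(8 * q)}})
    (a b : 'I_n -> R) :
  (forall k, in_cell (t k false) (a k)) -> (forall k, in_cell (t k true) (b k)) ->
  reach (grid_product s) grid_mid t = [set: 'I_(2 * q)] ->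
  forall z, `|z| <= 1 / 8 ->
  exists S : {set 'I_n},
    `|\sum_(k in S) Num.max (if s then a k else - a k) 0 * b k - z|
      <= (3 * n + 1)%:R / (4 * q)%:R.
Proof.
move=> Ha Hb full z z1.
have q0 : 0 < q%:R :> R by rewrite ltr0n.
set mu : R := (4 * q)%:R; have muE : mu = 4 * q%:R by rewrite /mu natrM.
have mu0 : 0 < mu by rewrite /mu ltr0n muln_gt0.
have := floor_itv (mu * z); set fl := Num.floor (mu * z).
rewrite -[fl + 1]/(fl + 1) intrD => /andP[fl1 fl2].
have zmu : - (q%:R / 2) <= mu * z <= q%:R / 2.
  by move: z1; rewrite ler_norml muE => /andP[z1 z2]; apply/andP; split; nra.
have f1 : - q%:Z <= fl.
  have : (- q%:Z - 1)%:~R < fl%:~R :> R.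
    rewrite rmorphB rmorphN /= -pmulrn; lra.
  by rewrite ltr_int; lia.
have f2 : fl < q%:Z by rewrite -(ltr_int R) -pmulrn; lra.
have i_lt : (absz (fl + q%:Z)%R < 2 * q)%N by lia.
have : Ordinal i_lt \in reach (grid_product s) grid_mid t by rewrite full inE.
rewrite inE => /existsP[S /eqP /= HS].
have {}HS : \sum_(k in S) grid_product s (t k) = fl by rewrite HS; lia.
(* Pairs of product 0 do not change the integer sum. They are dropped because those discarded for a
   weight below 1/2 may have a real product far from 0. *)
exists [set k in S | grid_product s (t k) != 0].
have -> : \sum_(k in [set k in S | grid_product s (t k) != 0])
      Num.max (if s then a k else - a k) 0 * b k =
    \sum_(k in S) if grid_product s (t k) == 0 then 0 else
      Num.max (if s then a k else - a k) 0 * b k.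
  rewrite big_mkcond [RHS]big_mkcond /=; apply: eq_bigr => k _.
  by rewrite inE; case: (k \in S) => //=; case: eqP.
set F := (X in \sum_(k in S) X k).
have H1 : `|\sum_(k in S) F k - fl%:~R / mu| <= (3 * n)%:R / mu.
  rewrite -HS rmorph_sum mulr_suml -sumrB.
  apply: (le_trans (ler_norm_sum _ _ _)).
  apply: (@le_trans _ _ (\sum_(k in S) 3 / mu)).
    by apply: ler_sum => k _; exact: grid_product_close.
  rewrite sumr_const -mulrnAl ler_pM2r ?invr_gt0 // -mulrnA.
  by rewrite ler_nat leq_mul2l -[X in (_ <= X)%N]card_ord max_card orbT.
have H2 : `|fl%:~R / mu - z| <= 1 / mu.
  have -> : z = mu * z / mu by field; rewrite gt_eqF.
  rewrite -mulrBl normrM [`|mu^-1|]ger0_norm ?invr_ge0 ?(ltW mu0) // ler_pM2r ?invr_gt0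
      //.
  by rewrite ler_norml; lra.
rewrite natrD mulrDl -(subrK (fl%:~R / mu) (\sum_(k in S) _)) -addrA.
by apply: (le_trans (ler_normD _ _)); exact: lerD.
Qed.

End grid_products.

(** [Num.max (a k) 0 * b k] is the effect on a unit input of a ReLU neuron with weights [a k] and
    [b k]. The range 2 is that of the coefficients to be realized: entries at most 1 divided by
    selected weights at least 1/2. *)
Definition subset_sum_dense (R : realType) (K : finType) (eta : R) (a b : K -> R) :=
  forall z, `|z| <= 2 -> exists S : {set K},
    `|\sum_(k in S) Num.max (a k) 0 * b k - z| <= eta.

(* The range is widened 16 times by letting each of 16 families approximate
   z / 16. *)
Lemma subset_sum_dense_16 (R : realType) n (eta : R) (a b : 'I_16 * 'I_n -> R) :
  (forall u z, `|z| <= 1 / 8 -> exists S : {set 'I_n},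
    `|\sum_(k in S) Num.max (a (u, k)) 0 * b (u, k) - z| <= eta / 16) ->
  subset_sum_dense eta a b.
Proof.
move=> H z z2; have z16 : `|z / 16| <= 1 / 8.
  by rewrite normrM [X in _ * X]gtr0_norm ?invr_gt0 //; lra.
have /fin_all_exists[S HS] := fun u => H u _ z16.
exists [set p | p.2 \in S p.1].
have -> : \sum_(k in [set p | p.2 \in S p.1]) Num.max (a k) 0 * b k - z =
    \sum_u (\sum_(k in S u) Num.max (a (u, k)) 0 * b (u, k) - z / 16).
  rewrite sumrB sumr_const card_ord -[z / 16 *+ _]mulr_natr mulfVK ?pnatr_eq0 //.
  congr (_ - _); rewrite pair_big_dep /=.
  by apply: eq_big => [[u k]|[u k]] //=; rewrite inE.
apply: (le_trans (ler_norm_sum _ _ _)).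
apply: (@le_trans _ _ (\sum_(u < 16) eta / 16)); first exact: ler_sum.
by rewrite sumr_const card_ord -[eta / 16 *+ _]mulr_natr mulfVK ?pnatr_eq0.
Qed.

(** * Events of the random weights *)

Lemma uniform_prob_itv (R : realType) (x y : R) : -1 <= x -> x <= y -> y <= 1 ->
  uniform_prob (gtrN (@ltr01 R)) `[x, y]%classic = ((y - x) / 2)%:E.
Proof.
move=> x1 xy y1; rewrite /uniform_prob (eq_integral (fun=> (2^-1)%:E)); last first.
  move=> z; rewrite inE /= in_itv /= => /andP[xz zy]; rewrite /uniform_pdf.
  by rewrite opprK (le_trans x1 xz) (le_trans zy y1).
rewrite integral_cst //= lebesgue_measure_itv /= lte_fin.
have [xy'|yx] := ltP x y; first by rewrite -EFinD -EFinM mulrC.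
by have -> : y = x by [apply/le_anti; rewrite yx xy]; rewrite subrr mul0r mule0.
Qed.

Lemma in_cell_itv (R : realType) (q : nat) (g : 'I_(8 * q)) : (0 < q)%N ->
  [set x : R | in_cell g x]%classic =
    `[(g%:R - (4 * q)%:R) / (4 * q)%:R, (g.+1%:R - (4 * q)%:R) / (4 * q)%:R]%classic.
Proof.
move=> q_gt0; set mu : R := (4 * q)%:R.
have mu0 : 0 < mu by rewrite /mu ltr0n muln_gt0.
apply/seteqP; split => x /=; rewrite in_itv /= /in_cell -/mu.
  by rewrite ler_pdivrMr // ler_pdivlMr // [x * _]mulrC.
by rewrite ler_pdivrMr // ler_pdivlMr // [x * _]mulrC.
Qed.

Section high_probability.
Local Open Scope classical_set_scope.
Context {R : realType} {d : measure_display} {Omega : measurableType d}.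
Variable P : probability Omega R.

(** The complement of [E] need only be covered by a measurable set of small probability. This
    matches [with_prob_ge], spares the measurability of [E], and makes union bounds immediate. *)
Definition fails_at_most (E : set Omega) (p : R) :=
  exists B : set Omega, [/\ measurable B, (P B <= p%:E)%E & ~` B `<=` E].

Lemma fails_at_mostW (E F : set Omega) (p r : R) :
  E `<=` F -> p <= r -> fails_at_most E p -> fails_at_most F r.
Proof.
move=> EF pr [B [mB PB BE]]; exists B; split => //.
  by apply: (le_trans PB); rewrite lee_fin.
exact: subset_trans EF.
Qed.

Lemma measure_bigsetU_le (T : finType) (Q : pred T) (B : T -> set Omega) :
  (forall t, measurable (B t)) ->
  (P (\big[setU/set0]_(t | Q t) B t) <= \sum_(t | Q t) P (B t))%E.
Proof.
move=> mB; suff: measurable (\big[setU/set0]_(t | Q t) B t) /\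
    (P (\big[setU/set0]_(t | Q t) B t) <= \sum_(t | Q t) P (B t))%E by case.
elim/big_rec2: _ => [|t x A _ [mA PA]]; first by rewrite measure0.
split; first exact: measurableU.
by apply: (le_trans (measureU2 _ _ _)) => //; exact: leeD2l.
Qed.

Lemma mem_bigsetU (T : finType) (Q : pred T) (B : T -> set Omega) t w :
  Q t -> B t w -> (\big[setU/set0]_(t | Q t) B t) w.
Proof. by move=> Qt Bt; rewrite (bigD1 t) //=; left. Qed.

Lemma fails_at_most_forall (T : finType) (E : T -> set Omega) (p : T -> R) :
  (forall t, fails_at_most (E t) (p t)) ->
  fails_at_most [set w | forall t, E t w] (\sum_t p t).
Proof.
move=> /choice[B HB]; have mB t : measurable (B t) by have [] := HB t.
exists (\big[setU/set0]_t B t); split.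
- exact: bigsetU_measurable.
- apply: (le_trans (measure_bigsetU_le _ mB)); rewrite -sumEFin.
  by apply: lee_sum => t _; have [] := HB t.
- move=> w nB t; have [_ _] := HB t; apply => Bt; apply: nB.
  exact: mem_bigsetU Bt.
Qed.

Lemma fails_at_mostI (E F : set Omega) (p r : R) :
  fails_at_most E p -> fails_at_most F r -> fails_at_most (E `&` F) (p + r).
Proof.
move=> [B [mB PB BE]] [C [mC PC CF]]; exists (B `|` C); split.
- exact: measurableU.
- by apply: (le_trans (measureU2 _ _ _)) => //; rewrite EFinD leeD.
- by move=> w; rewrite setCU => -[/BE ? /CF ?]; split.
Qed.

Lemma fails_at_most_with_prob_ge (E : set Omega) (p : R) :
  fails_at_most E p -> with_prob_ge P E (1 - p).
Proof.
move=> [B [mB PB BE]]; exists (~` B); split => //; first exact: measurableC.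
by rewrite probability_setC // EFinB leeB.
Qed.

Variables (I : Type) (xi : I -> {RV P >-> R}) (q : nat).
Hypotheses (q_gt0 : (0 < q)%N).
Hypotheses (xi_uniform : forall k, uniform_RV (xi k)) (xi_indep : independent_RVs xi).

Let measurable_preimage i (A : set R) : measurable A -> measurable (xi i @^-1` A).
Proof. by move=> mA; rewrite -[X in measurable X]setTI; exact: measurable_funP. Qed.

Let measurable_in_cell (g : 'I_(8 * q)) : measurable [set x : R | in_cell g x].
Proof. by rewrite in_cell_itv. Qed.

Lemma prob_in_cell i (g : 'I_(8 * q)) :
  P (xi i @^-1` [set x | in_cell g x]) = ((8 * q)%:R^-1)%:E.
Proof.
set mu : R := (4 * q)%:R; have mu0 : 0 < mu by rewrite /mu ltr0n muln_gt0.
rewrite in_cell_itv // -/mu.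
have := @xi_uniform i; rewrite /uniform_RV /distribution /= /pushforward => -> //.
have g8 : g.+1%:R <= mu + mu :> R by rewrite -natrD ler_nat; have := ltn_ord g; lia.
have g0 : 0 <= g%:R :> R by [].
rewrite uniform_prob_itv.
- congr EFin; rewrite -natr1 !natrM /mu !natrM; field.
  by rewrite pnatr_eq0 -lt0n.
- by rewrite ler_pdivlMr //; lra.
- by rewrite ler_pM2r ?invr_gt0 // lerD2r ler_nat.
- by rewrite ler_pdivrMr // mul1r; lra.
Qed.

Lemma in_cell_exists (x : R) : `|x| <= 1 -> exists g : 'I_(8 * q), in_cell g x.
Proof.
set mu : R := (4 * q)%:R; have mu0 : 0 < mu by rewrite /mu ltr0n muln_gt0.
rewrite ler_norml => /andP[x1 x2].
have y0 : 0 <= mu * x + mu by nra.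
have [h1 h2] := andP (truncn_itv y0).
set g := Num.truncn _ in h1 h2.
have [g8|g8] := ltnP g (8 * q).
  by exists (Ordinal g8); rewrite /in_cell /= -/mu; apply/andP; split; lra.
(* What remains is x = 1, where truncation yields 8q; this point belongs to the last cell. *)
have gq : ((8 * q).-1 < 8 * q)%N by rewrite prednK // muln_gt0.
exists (Ordinal gq); rewrite /in_cell /= -/mu prednK ?muln_gt0 //.
have m2 : (8 * q)%:R = mu + mu :> R by rewrite /mu -natrD; congr _%:R; lia.
have xE : mu * x + mu = mu + mu.
  apply/le_anti/andP; split; first by nra.
  by rewrite -m2; apply: le_trans h1; rewrite ler_nat.
have : ((8 * q).-1)%:R <= (8 * q)%:R :> R by rewrite ler_nat leq_pred.
by rewrite m2 => ?; apply/andP; split; lra.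
Qed.

Lemma prob_outside i : P (xi i @^-1` ~` `[-1, 1]) = 0.
Proof.
have m1 : measurable (xi i @^-1` `[-1, 1]) by apply: measurable_preimage.
have -> : xi i @^-1` (~` `[-1, 1]%classic) = ~` (xi i @^-1` `[-1, 1]%classic) by [].
rewrite probability_setC //.
have := @xi_uniform i; rewrite /uniform_RV /distribution /= /pushforward => -> //.
rewrite uniform_prob_itv //.
have -> : (1 - -1) / 2 = 1 :> R by field.
by rewrite subee.
Qed.

Lemma prob_cells (T : finType) (f : T -> I) (g : T -> 'I_(8 * q)) : injective f ->
  P (\bigcap_t xi (f t) @^-1` [set x | in_cell (g t) x]) =
  ((8 * q)%:R^-1 ^+ #|T|)%:E.
Proof.
move=> f_inj; have -> : \bigcap_t xi (f t) @^-1` [set x | in_cell (g t) x] =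
    \bigcap_(k : 'I_#|T|) xi (f (enum_val k)) @^-1`
      [set x | in_cell (g (enum_val k)) x].
  apply/seteqP; split => w H t _; first exact: H.
  by rewrite -(enum_rankK t); exact: H.
rewrite (@xi_indep _ (f \o enum_val) (fun k => [set x | in_cell (g (enum_val k)) x])).
- under eq_bigr do rewrite prob_in_cell.
  by rewrite prodEFin prodr_const card_ord.
- by move=> j k /f_inj /enum_val_inj.
- by move=> k; exact: measurable_in_cell.
Qed.

(** Probability becomes counting, since all assignments of cells to weights are equally likely. The
    closed cells overlap in their endpoints, which is harmless: failure is covered by the union of
    the bad assignments and the null event that a weight lies outside [-1, 1]. *)
Lemma grid_fails_at_most (K J : finType) (f : K * J -> I)
    (bad : {set {ffun K -> {ffun J -> 'I_(8 * q)}}}) : injective f ->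
  fails_at_most
    [set w | exists2 t, t \notin bad &
       forall k j, in_cell (t k j) (xi (f (k, j)) w)]
    (#|bad|%:R / #|{ffun J -> 'I_(8 * q)}|%:R ^+ #|K|).
Proof.
move=> f_inj.
pose cells (t : {ffun K -> {ffun J -> 'I_(8 * q)}}) :=
  \bigcap_p xi (f p) @^-1` [set x | in_cell (t p.1 p.2) x].
pose out p := xi (f p) @^-1` ~` `[-1, 1].
have mcell t : measurable (cells t).
  apply: fin_bigcap_measurable => [|p _]; first exact: finite_finset.
  by apply: measurable_preimage; exact: measurable_in_cell.
have mout p : measurable (out p).
  by apply: measurable_preimage; exact: measurableC.
have mU1 : measurable (\big[setU/set0]_(t in bad) cells t).
  exact: bigsetU_measurable.
have mU2 : measurable (\big[setU/set0]_p out p) by exact: bigsetU_measurable.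
exists ((\big[setU/set0]_(t in bad) cells t) `|` (\big[setU/set0]_p out p)).
split; first exact: measurableU.
  apply: (le_trans (measureU2 _ _ _)) => //.
  rewrite -[X in (_ <= X)%E]adde0; apply: leeD.
    apply: (le_trans (measure_bigsetU_le _ mcell)).
    rewrite (eq_bigr (fun=> ((8 * q)%:R^-1 ^+ #|{: K * J}|)%:E)); last first.
      by move=> t _; rewrite (prob_cells (fun p => t p.1 p.2) f_inj).
    rewrite sumEFin sumr_const lee_fin card_prod card_ffun card_ord natrX -exprM.
    by rewrite [(#|J| * _)%N]mulnC exprVn -[_ *+ _]mulr_natl.
  apply: (le_trans (measure_bigsetU_le _ mout)).
  by rewrite big1 // => p _; exact: prob_outside.
move=> w; rewrite setCU => -[nbad nout].
have xi1 p : `|xi (f p) w| <= 1.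
  rewrite leNgt; apply/negP => H; apply: nout; apply: (@mem_bigsetU _ _ _ p) => //;
      rewrite /out /=.
  by rewrite in_itv /= -ler_norml; apply/negP; rewrite -ltNge.
have /choice[g Hg] := fun p => in_cell_exists (xi1 p).
exists [ffun k => [ffun j => g (k, j)]]; last by move=> k j; rewrite !ffunE.
apply/negP => tbad; apply: nbad; apply: mem_bigsetU tbad _ => -[k j] _ /=.
by rewrite !ffunE.
Qed.

Lemma subset_sum_fails_at_most n (f : 'I_16 * 'I_n * bool -> I) s (eta : R) :
  injective f -> 16 * ((3 * n + 1)%:R / (4 * q)%:R) <= eta ->
  fails_at_most
    [set w | subset_sum_dense eta
       (fun k => if s then xi (f (k, false)) w else - xi (f (k, false)) w)
       (fun k => xi (f (k, true)) w)]
    (16 * ((31 / 32) ^+ n * (2 * q)%:R ^+ 2)).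
Proof.
move=> f_inj eta_ge.
have Hu (u : 'I_16) : fails_at_most
    [set w | forall z, `|z| <= 1 / 8 -> exists S : {set 'I_n},
      `|\sum_(k in S) Num.max (if s then xi (f (u, k, false)) w
                                else - xi (f (u, k, false)) w) 0 *
          xi (f (u, k, true)) w - z| <= eta / 16]
    ((31 / 32) ^+ n * (2 * q)%:R ^+ 2).
  pose fu (p : 'I_n * bool) := f (u, p.1, p.2).
  have fu_inj : injective fu by move=> [k j] [k' j'] /f_inj[-> ->].
  apply: fails_at_mostW (grid_fails_at_most
    [set t | reach (grid_product s) (grid_mid q_gt0) t != [set: 'I_(2 * q)]]%SET fu_inj).
    move=> w [t]; rewrite inE negbK => /eqP full tP z z1.
    have [S HS] := grid_subset_sum (fun k => tP k false) (fun k => tP k true) full z1.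
    by exists S; apply: (le_trans HS); rewrite ler_pdivlMr // mulrC.
  have om_gt0 : 0 < #|{ffun bool -> 'I_(8 * q)}|%:R :> R.
    by rewrite ltr0n card_ffun card_ord expn_gt0 muln_gt0 q_gt0.
  rewrite card_ord ler_pdivrMr ?exprn_gt0 // mulrC.
  exact: card_grid_miss.
have := fails_at_most_forall Hu; rewrite sumr_const card_ord.
apply: fails_at_mostW => [w Hw|]; last by rewrite [16 * _]mulr_natl.
exact: subset_sum_dense_16.
Qed.

(** A uniform weight lies in [1/2, 1] with probability 1/4, and a candidate [k] succeeds if all its
    weights, one for each element of [J], do. *)
Lemma selection_fails_at_most (K J : finType) (f : K * J -> I) : injective f ->
  fails_at_most
    [set w | exists k, forall j, 1 / 2 <= xi (f (k, j)) w <= 1]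
    ((1 - (1 / 4) ^+ #|J|) ^+ #|K|).
Proof.
move=> f_inj.
(* Cell 6q starts at (6q - 4q) / 4q = 1/2, so a quarter of the cells qualifies. *)
pose large := [set g : {ffun J -> 'I_(8 * q)} | g \in ffun_on [pred i : 'I_(8 * q) | (6 *
    q <= i)%N]]%SET.
have card_large : #|large| = ((2 * q) ^ #|J|)%N.
  rewrite /large cardsE card_ffun_on; congr expn.
  rewrite -[RHS]card_ord.
  have addP (i : 'I_(2 * q)) : (6 * q + i < 8 * q)%N by have := ltn_ord i; lia.
  rewrite -(@card_imset _ _ (fun i => Ordinal (addP i))); last first.
    by move=> i j [/addnI H]; exact: val_inj.
  apply: eq_card => i; rewrite !inE; apply/idP/imsetP => [i6|[j _ -> /=]]; last by lia.
  have subP : (i - 6 * q < 2 * q)%N by have := ltn_ord i; lia.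
  by exists (Ordinal subP) => //; apply: val_inj => /=; lia.
apply: fails_at_mostW (grid_fails_at_most
  [set t | t \in ffun_on [pred g | g \notin large]]%SET f_inj).
  move=> w [t]; rewrite inE => tbad tP.
  have [k tk] : exists k, t k \in large.
    apply: contrapT => H; move/negP: tbad; apply; apply/ffun_onP => k.
    by rewrite inE; apply/negP => tk; apply: H; exists k.
  exists k => j; move: tk; rewrite inE => /ffun_onP/(_ j); rewrite inE => kj.
  have := tP k j => kjP; have := in_cell_le1 q_gt0 kjP.
  rewrite ler_norml => /andP[_ ->]; rewrite andbT.
  have q0 : 0 < q%:R :> R by rewrite ltr0n.
  move: kjP => /andP[+ _]; rewrite natrM.
  have : (6 * q)%:R <= (t k j)%:R :> R by rewrite ler_nat.
  by rewrite natrM => h1 h2; rewrite -(ler_pM2l q0); lra.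
rewrite cardsE card_ffun_on.
have om_gt0 : 0 < #|{ffun J -> 'I_(8 * q)}|%:R :> R.
  by rewrite ltr0n card_ffun card_ord expn_gt0 muln_gt0 q_gt0.
rewrite natrX -expr_div_n le_eqVlt; apply/orP; left; apply/eqP; congr (_ ^+ _).
have -> : #|[pred g | g \notin large]|%:R = #|{ffun J -> 'I_(8 * q)}|%:R - #|large|%:R :>
    R.
  by apply/eqP; rewrite eq_sym subr_eq -natrD addnC cardC.
rewrite mulrBl divff ?gt_eqF // card_large card_ffun card_ord !natrX -expr_div_n.
congr (_ - _ ^+ _); rewrite !natrM; field.
by rewrite pnatr_eq0 -lt0n.
Qed.

End high_probability.

(** * Pruned multilayer perceptrons *)

Section pruned_matrices.
Context {R : realType}.

(** [a] and [b] place abstract row and column labels in the matrix; an entry survives iff its labels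
    are related by [r]. The existential form avoids partial inverses of [a] and [b]. *)
Definition select_mx p q (S T : finType) (a : S -> 'I_p) (b : T -> 'I_q)
    (r : S -> pred T) (W : 'M[R]_(p, q)) : 'M[R]_(p, q) :=
  \matrix_(i, j) if [exists s, [exists t, [&& i == a s, j == b t & r s t]]]
                 then W i j else 0.

Lemma select_mx_pruning p q (S T : finType) (a : S -> 'I_p) (b : T -> 'I_q) r
  (W : 'M[R]_(p, q)) : mx_pruning W (select_mx a b r W).
Proof. by move=> i j; rewrite mxE; case: ifP; [left|right]. Qed.

Lemma mx_pruning0 p q (W : 'M[R]_(p, q)) : mx_pruning W 0.
Proof. by move=> i j; right; rewrite mxE. Qed.

Lemma sum_codom n (T : finType) (f : T -> 'I_n) (F : 'I_n -> R) : injective f ->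
  (forall i, i \notin codom f -> F i = 0) -> \sum_i F i = \sum_t F (f t).
Proof.
move=> f_inj F0; rewrite (bigID (mem (f @: T))) /= [X in _ + X]big1 ?addr0.
  by rewrite big_imset //= => ? ? _ _; exact: f_inj.
move=> i ni; apply: F0; apply: contra ni => /codomP[t ->]; exact: imset_f.
Qed.

Lemma sum_pair (I J : finType) (Q : pred (I * J)) (F : I * J -> R) :
  \sum_(p | Q p) F p = \sum_i \sum_(j | Q (i, j)) F (i, j).
Proof. by rewrite pair_big_dep /=; apply: eq_big => [[]|[]]. Qed.

Lemma select_mulmx p q N (S T : finType) (a : S -> 'I_p) (b : T -> 'I_q) r
    (W : 'M[R]_(p, q)) (X : 'M[R]_(q, N)) s j : injective a -> injective b ->
  (select_mx a b r W *m X) (a s) j = \sum_(t | r s t) W (a s) (b t) * X (b t) j.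
Proof.
move=> a_inj b_inj; rewrite mxE (sum_codom b_inj) => [|i ni]; last first.
  rewrite mxE; case: existsP => [[s' /existsP[t /and3P[_ /eqP it _]]]|_].
    by rewrite it codom_f in ni.
  by rewrite mul0r.
rewrite [RHS]big_mkcond; apply: eq_bigr => t _; rewrite mxE.
case: existsP => [[s' /existsP[t' /and3P[/eqP/a_inj <- /eqP/b_inj <- ->]]]//|H].
case: ifP => [rst|_]; last by rewrite mul0r.
by case: H; exists s; apply/existsP; exists t; rewrite !eqxx.
Qed.

Lemma select_mulmx_out p q N (S T : finType) (a : S -> 'I_p) (b : T -> 'I_q) r
    (W : 'M[R]_(p, q)) (X : 'M[R]_(q, N)) i j : i \notin codom a ->
  (select_mx a b r W *m X) i j = 0.
Proof.
move=> ni; rewrite mxE big1 // => k _; rewrite mxE.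
case: existsP => [[s /existsP[t /and3P[/eqP it _ _]]]|_]; last by rewrite mul0r.
by rewrite it codom_f in ni.
Qed.

End pruned_matrices.

Section mlp_approximation.
Context {R : realType}.
Variables (n w m : nat) (K H O : finType).
Variables (Win : 'M[R]_(w, n)) (Whid0 Whid1 : 'M[R]_w) (Wout : 'M[R]_(n, w)).
Variables (x : 'I_m -> 'I_n) (e : 'I_m * K -> 'I_w) (h : H -> 'I_w)
  (f : H * K -> 'I_w) (o : O -> 'I_n).
Hypotheses (x_inj : injective x) (e_inj : injective e) (h_inj : injective h)
  (f_inj : injective f) (o_inj : injective o).
Variable eta : R.
Hypothesis eta_le1 : eta <= 1.

(** In the first half the same weights serve every [i] and both signs [s]. The second half needs no
    sign, because its inputs are outputs of a ReLU and hence nonnegative. *)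
Definition mlp_dense :=
  (forall s i j, subset_sum_dense eta
     (fun k => if s then Win (e (j, k)) (x j) else - Win (e (j, k)) (x j))
     (fun k => Whid0 (h i) (e (j, k)))) /\
  (forall l i, subset_sum_dense eta
     (fun k => Whid1 (f (i, k)) (h i)) (fun k => Wout (o l) (f (i, k)))).

(** A positive weight transmits the positive part of y, a negative one its negative part. Each
    coefficient therefore has to be realized twice, through the positive and through the negative
    first weights. *)
Lemma relu_scale (a y : R) :
  Num.max 0 (a * y) = Num.max a 0 * Num.max 0 y + Num.max (- a) 0 * Num.max 0 (- y).
Proof.
have /orP[a0|a0] := le_total 0 a; have /orP[y0|y0] := le_total 0 y.
- rewrite (max_r (mulr_ge0 a0 y0)) (max_l a0) (max_r y0).
  by rewrite (max_r (x := - a)) ?oppr_le0 // mul0r addr0.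
- rewrite (max_l (mulr_ge0_le0 a0 y0)) (max_l a0) (max_l y0).
  by rewrite (max_r (x := - a)) ?oppr_le0 // mul0r mulr0 addr0.
- rewrite (max_l (mulr_le0_ge0 a0 y0)) (max_r a0).
  by rewrite (max_l (y := - y)) ?oppr_le0 // mul0r mulr0 addr0.
- rewrite (max_r (mulr_le0 a0 y0)) (max_r a0) mul0r add0r.
  by rewrite (max_l (y := 0)) ?oppr_ge0 // (max_r (y := - y)) ?oppr_ge0 // mulrNN.
Qed.

(** The factor 5 is 1 + 2 + 2: with b the realized coefficient of B, and hid the realized hidden
    value of t, the products (b - B)(hid - t), (b - B) t and B (hid - t) are at most eta s, 2 eta s
    and 2 eta s, where s is the sum of the absolute inputs. *)
Lemma mlp_dense_approx (A : H -> 'I_m -> R) (B : O -> H -> R) : mlp_dense ->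
  (forall i j, `|A i j| <= 2) -> (forall l i, `|B l i| <= 2) ->
  exists Win' Whid0' Whid1' Wout',
    [/\ mx_pruning Win Win', mx_pruning Whid0 Whid0', mx_pruning Whid1 Whid1' &
        mx_pruning Wout Wout'] /\
    forall N (X : 'M[R]_(n, N)) c,
    let Y := Wout' *m relu (Whid1' *m relu (Whid0' *m relu (Win' *m X))) in
    (forall l, `|Y (o l) c - \sum_i B l i * Num.max 0 (\sum_j A i j * X (x j) c)|
       <= #|H|%:R * (5 * eta * \sum_j `|X (x j) c|)) /\
    (forall r, r \notin codom o -> Y r c = 0).
Proof.
move=> [dense1 dense2] A2 B2.
have /choice[S HS] : forall p : bool * H * 'I_m, exists S : {set K},
    `|\sum_(k in S) Num.max (if p.1.1 then Win (e (p.2, k)) (x p.2)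
       else - Win (e (p.2, k)) (x p.2)) 0 * Whid0 (h p.1.2) (e (p.2, k))
     - (if p.1.1 then A p.1.2 p.2 else - A p.1.2 p.2)| <= eta.
  by move=> [[s i] j]; apply: dense1; case: s => //=; rewrite normrN.
have /choice[S' HS'] : forall p : O * H, exists S : {set K},
    `|\sum_(k in S) Num.max (Whid1 (f (p.2, k)) (h p.2)) 0 *
        Wout (o p.1) (f (p.2, k)) - B p.1 p.2| <= eta.
  by move=> [l i]; exact: dense2.
(* The two subsets merge into one pruning: a neuron with positive first weight follows the subset
   for [true], any other the one for [false], and the ignored choices would only contribute a
   positive part 0. *)
pose r1 i (p : 'I_m * K) := if 0 < Win (e p) (x p.1) then p.2 \in S (true, i, p.1)
   else p.2 \in S (false, i, p.1).
exists (select_mx e x (fun p => pred1 p.1) Win),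
  (select_mx h e r1 Whid0), (select_mx f h (fun p => pred1 p.1) Whid1),
  (select_mx o f (fun l p => p.2 \in S' (l, p.1)) Wout).
split; first by split; exact: select_mx_pruning.
move=> N X c Y; split; last by move=> r nr; exact: select_mulmx_out.
set s := \sum_j `|X (x j) c|.
have s_ge0 : 0 <= s by exact: sumr_ge0.
pose Ap i j := \sum_(k in S (true, i, j)) Num.max (Win (e (j, k)) (x j)) 0 * Whid0 (h i)
    (e (j, k)).
pose An i j := \sum_(k in S (false, i, j)) Num.max (- Win (e (j, k)) (x j)) 0 * Whid0 (h
    i) (e (j, k)).
pose hid i := Num.max 0 (\sum_j (Ap i j * Num.max 0 (X (x j) c) + An i j * Num.max 0 (- X
    (x j) c))).
have hidE i : (relu (select_mx h e r1 Whid0 *m relu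
    (select_mx e x (fun p => pred1 p.1) Win *m X))) (h i) c = hid i.
  rewrite mxE; congr Num.max; rewrite select_mulmx //.
  under eq_bigr => p _ do rewrite mxE select_mulmx // big_pred1_eq relu_scale.
  rewrite sum_pair /=; apply: eq_bigr => j _; rewrite /Ap /An !mulr_suml.
  rewrite [in LHS]big_mkcond [X in _ = X + _]big_mkcond [X in _ = _ + X]big_mkcond.
  rewrite -big_split /=; apply: eq_bigr => k _.
  rewrite /r1 /=; case: (boolP (0 < Win (e (j, k)) (x j))) => [W0|];
      last rewrite -leNgt => W0.
    rewrite (max_l (ltW W0)) (max_r (x := - _)) ?oppr_le0 ?(ltW W0) //.
    by rewrite !mul0r addr0 if_same addr0; case: ifP => // _; ring.
  by rewrite (max_r W0) !mul0r add0r if_same add0r; case: ifP => // _; ring.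
have YE l : Y (o l) c = \sum_i
   (\sum_(k in S' (l, i)) Num.max (Whid1 (f (i, k)) (h i)) 0 * Wout (o l) (f (i, k))) *
       hid i.
  rewrite select_mulmx //.
  under eq_bigr => p _ do rewrite mxE select_mulmx // big_pred1_eq hidE relu_scale.
  rewrite sum_pair /=; apply: eq_bigr => i _; rewrite mulr_suml.
  apply: eq_bigr => k _.
  have hid0 : 0 <= hid i by rewrite le_max lexx.
  by rewrite (max_r hid0) (max_l (x := 0)) ?oppr_le0 // mulr0 addr0; ring.
have hid_close i : `|hid i - Num.max 0 (\sum_j A i j * X (x j) c)| <= eta * s.
  apply: (@le_trans _ _ `|\sum_j (Ap i j * Num.max 0 (X (x j) c) +
     An i j * Num.max 0 (- X (x j) c)) - \sum_j A i j * X (x j) c|).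
    rewrite /hid; set u := \sum_j _; set v := \sum_j _.
    rewrite ler_norml; have := ler_norm (u - v); have := ler_norm (v - u).
    rewrite distrC; move: (`|u - v|) => d.
    by rewrite /Num.max; case: ifP => [|/negbT]; case: ifP => [|/negbT]; rewrite -?leNgt;
        lra.
  rewrite -sumrB /s mulr_sumr; apply: (le_trans (ler_norm_sum _ _ _)).
  apply: ler_sum => j _; set y := X (x j) c.
  have h1 := HS (true, i, j); have h2 := HS (false, i, j); rewrite /= in h1 h2.
  rewrite -/(Ap i j) in h1; rewrite -/(An i j) opprK in h2.
  have /orP[y0|y0] := le_total 0 y.
    rewrite (max_r y0) (max_l (x := 0)) ?oppr_le0 // mulr0 addr0 -mulrBl normrM.
    exact: ler_wpM2r.
  rewrite (max_l y0) (max_r (x := 0)) ?oppr_ge0 // mulr0 add0r.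
  have -> : An i j * - y - A i j * y = - ((An i j + A i j) * y) by ring.
  by rewrite normrN normrM; apply: ler_wpM2r.
have tgt_bound i : `|Num.max 0 (\sum_j A i j * X (x j) c)| <= 2 * s.
  apply: (@le_trans _ _ `|\sum_j A i j * X (x j) c|).
    by rewrite /Num.max; case: ifP => // _; rewrite normr0.
  rewrite mulr_sumr; apply: (le_trans (ler_norm_sum _ _ _)).
  by apply: ler_sum => j _; rewrite normrM; apply: ler_wpM2r.
move=> l; rewrite YE -sumrB; apply: (le_trans (ler_norm_sum _ _ _)).
rewrite -sum1_card natr_sum mulr_suml; apply: ler_sum => i _; rewrite mul1r.
set b := \sum_(k in _) _; set t := Num.max 0 _.
have hb : `|b - B l i| <= eta := HS' (l, i).
have -> : b * hid i - B l i * t = (b - B l i) * (hid i - t) + (b - B l i) * t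
  + B l i * (hid i - t) by ring.
have ht := tgt_bound i; have hh := hid_close i; rewrite -/t in ht hh.
have e1 : `|(b - B l i) * (hid i - t)| <= eta * s.
  by rewrite normrM -[X in _ <= X]mul1r ler_pM // (le_trans hb).
have e2 : `|(b - B l i) * t| <= eta * (2 * s) by rewrite normrM ler_pM.
have e3 : `|B l i * (hid i - t)| <= 2 * (eta * s) by rewrite normrM ler_pM.
apply: (le_trans (ler_normD _ _));
    have := ler_normD ((b - B l i) * (hid i - t)) ((b - B l i) * t).
lra.
Qed.

End mlp_approximation.

(** * Norms and LayerNorm *)

Section euclidean_norm.
Context {R : realType}.

Lemma l2norm_ge0 n (v : 'cV[R]_n) : 0 <= l2norm v.
Proof. exact: sqrtr_ge0. Qed.

Lemma l2norm_sqr n (v : 'cV[R]_n) : l2norm v ^+ 2 = \sum_i v i 0 ^+ 2.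
Proof. by rewrite sqr_sqrtr // sumr_ge0 // => i _; exact: sqr_ge0. Qed.

Lemma l2norm_le n (v : 'cV[R]_n) (c : R) :
  0 <= c -> \sum_i v i 0 ^+ 2 <= c ^+ 2 -> l2norm v <= c.
Proof. by move=> c0 H;
    rewrite -(ler_pXn2r (n := 2)) ?nnegrE ?l2norm_ge0 // l2norm_sqr. Qed.

Lemma l2norm0 n : l2norm (0 : 'cV[R]_n) = 0.
Proof. by rewrite /l2norm big1 ?sqrtr0 // => i _; rewrite mxE expr0n. Qed.

Lemma l2norm_eq0 n (v : 'cV[R]_n) : l2norm v = 0 -> v = 0.
Proof.
move=> v0; have := l2norm_sqr v; rewrite v0 expr0n /= => /esym/eqP.
rewrite psumr_eq0 => [/allP H|i _]; last exact: sqr_ge0.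
apply/matrixP => i j; rewrite ord1 mxE; have := H i (mem_index_enum _).
by rewrite sqrf_eq0 => /eqP.
Qed.

Lemma l2normZ n (a : R) (v : 'cV[R]_n) : l2norm (a *: v) = `|a| * l2norm v.
Proof.
rewrite /l2norm; under eq_bigr do rewrite mxE exprMn.
by rewrite -mulr_sumr sqrtrM ?sqr_ge0 // sqrtr_sqr.
Qed.

Lemma l2normN n (v : 'cV[R]_n) : l2norm (- v) = l2norm v.
Proof. by rewrite -scaleN1r l2normZ normrN1 mul1r. Qed.

(** Cauchy-Schwarz, by expanding the squared norm of |u|^2 v - c u, where c is the inner product. *)
Lemma dot_le_l2norm n (u v : 'cV[R]_n) :
  `|\sum_i u i 0 * v i 0| <= l2norm u * l2norm v.
Proof.
have [u0|u0] := eqVneq (l2norm u) 0.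
  by rewrite (l2norm_eq0 u0) big1 ?normr0 ?l2norm0 ?mul0r // => i _; rewrite mxE mul0r.
have A0 : 0 < l2norm u ^+ 2 by rewrite exprn_gt0 // lt0r u0 l2norm_ge0.
rewrite -(ler_pXn2r (n := 2)) ?nnegrE ?mulr_ge0 ?l2norm_ge0 //.
rewrite exprMn real_normK ?num_real //; set c := \sum_i _.
rewrite -(ler_pM2l A0).
have : 0 <= \sum_i (l2norm u ^+ 2 * v i 0 - c * u i 0) ^+ 2.
  by apply: sumr_ge0 => i _; exact: sqr_ge0.
have -> : \sum_i (l2norm u ^+ 2 * v i 0 - c * u i 0) ^+ 2 =
    \sum_i (l2norm u ^+ 4 * v i 0 ^+ 2 - 2 * l2norm u ^+ 2 * c * (u i 0 * v i 0)
      + c ^+ 2 * u i 0 ^+ 2) by apply: eq_bigr => i _; ring.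
rewrite big_split sumrB /= -!mulr_sumr -!l2norm_sqr -/c.
set A := l2norm u; set B := l2norm v; set z := (X in 0 <= X -> _).
have -> : z = A ^+ 2 * (A ^+ 2 * B ^+ 2) - A ^+ 2 * c ^+ 2 by rewrite /z; ring.
by rewrite subr_ge0.
Qed.

Lemma ler_l2normD n (u v : 'cV[R]_n) : l2norm (u + v) <= l2norm u + l2norm v.
Proof.
apply: l2norm_le; first by rewrite addr_ge0 ?l2norm_ge0.
have -> : \sum_i (u + v) i 0 ^+ 2 =
    \sum_i (u i 0 ^+ 2 + 2 * (u i 0 * v i 0) + v i 0 ^+ 2).
  by apply: eq_bigr => i _; rewrite mxE; ring.
rewrite 2!big_split /= -mulr_sumr -!l2norm_sqr.
have := le_trans (ler_norm _) (dot_le_l2norm u v).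
set c := \sum_i _; set A := l2norm u; set B := l2norm v => H.
have -> : (A + B) ^+ 2 = A ^+ 2 + 2 * (A * B) + B ^+ 2 by ring.
by rewrite lerD2r lerD2l ler_pM2l.
Qed.

Lemma ler_l2normB n (u v : 'cV[R]_n) : l2norm (u - v) <= l2norm u + l2norm v.
Proof. by rewrite -(l2normN v) ler_l2normD. Qed.

Lemma l2norm_distC n (u v : 'cV[R]_n) : l2norm (u - v) = l2norm (v - u).
Proof. by rewrite -l2normN opprB. Qed.

Lemma l2norm_triangle n (u v : 'cV[R]_n) : l2norm u <= l2norm v + l2norm (u - v).
Proof. by have := ler_l2normD v (u - v); rewrite [v + _]addrC subrK. Qed.

Lemma ler_l2norm_sum n (I : finType) (F : I -> 'cV[R]_n) :
  l2norm (\sum_i F i) <= \sum_i l2norm (F i).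
Proof.
elim/big_rec2: _ => [|i y x _ H]; first by rewrite l2norm0.
by apply: (le_trans (ler_l2normD _ _)); rewrite lerD2l.
Qed.

Lemma le_l2norm n (u v : 'cV[R]_n) :
  (forall i, `|u i 0| <= `|v i 0|) -> l2norm u <= l2norm v.
Proof.
move=> H; apply: l2norm_le; first exact: l2norm_ge0.
rewrite l2norm_sqr; apply: ler_sum => i _.
by rewrite -real_normK ?num_real // -[X in _ <= X]real_normK ?num_real // ler_pXn2r
    ?nnegrE.
Qed.

Lemma entry_le_l2norm n (v : 'cV[R]_n) i : `|v i 0| <= l2norm v.
Proof.
rewrite -(ler_pXn2r (n := 2)) ?nnegrE ?l2norm_ge0 // real_normK ?num_real //.
rewrite l2norm_sqr (bigD1 i) //= lerDl sumr_ge0 // => k _; exact: sqr_ge0.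
Qed.

Lemma l2norm_le_sum n (v : 'cV[R]_n) : l2norm v <= \sum_i `|v i 0|.
Proof.
apply: l2norm_le; first exact: sumr_ge0.
rewrite expr2 mulr_suml; apply: ler_sum => i _.
rewrite -real_normK ?num_real // expr2 ler_wpM2l // (bigD1 i) //= lerDl.
exact: sumr_ge0.
Qed.

Lemma sum_le_l2norm n (v : 'cV[R]_n) : \sum_i `|v i 0| <= n%:R * l2norm v.
Proof.
apply: (@le_trans _ _ (\sum_(i < n) l2norm v)).
  by apply: ler_sum => i _; exact: entry_le_l2norm.
by rewrite sumr_const card_ord mulr_natl.
Qed.

Definition contractive p q (W : 'M[R]_(p, q)) :=
  forall v : 'cV[R]_q, l2norm (W *m v) <= l2norm v.

Lemma spectral_norm_contractive p q (W : 'M[R]_(p, q)) :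
  spectral_norm W <= 1 -> contractive W.
Proof.
move=> W1 v; have [v0|v0] := eqVneq (l2norm v) 0.
  by rewrite (l2norm_eq0 v0) mulmx0 !l2norm0.
have v_gt0 : 0 < l2norm v by rewrite lt0r v0 l2norm_ge0.
(* Without boundedness [sup] would only be a default value. *)
have bnd : has_ubound [set l2norm (W *m x) | x in [set x : 'cV[R]_q | l2norm x <=
    1]]%classic.
  exists (\sum_i \sum_j `|W i j|) => _ [x /= x1 <-].
  apply: (le_trans (l2norm_le_sum _)); apply: ler_sum => i _; rewrite mxE.
  apply: (le_trans (ler_norm_sum _ _ _)); apply: ler_sum => j _.
  by rewrite normrM ler_piMr // (le_trans (entry_le_l2norm x j)).
rewrite -[X in _ <= X]mulr1 -ler_pdivrMl //.
apply: le_trans W1; apply: (ub_le_sup bnd).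
exists ((l2norm v)^-1 *: v); last first.
  by rewrite -scalemxAr l2normZ ger0_norm ?invr_ge0 ?l2norm_ge0.
by rewrite /= l2normZ ger0_norm ?invr_ge0 ?l2norm_ge0 // mulVf.
Qed.

Lemma contractive_entry p q (W : 'M[R]_(p, q)) i j : contractive W -> `|W i j| <= 1.
Proof.
move=> /(_ (delta_mx j 0)) H.
have -> : W i j = (W *m delta_mx j (0 : 'I_1)) i 0 by rewrite -colE mxE.
apply: (le_trans (entry_le_l2norm _ _)); apply: (le_trans H).
apply: (le_trans (l2norm_le_sum _)); rewrite (bigD1 j) //= big1 => [|k kj].
  by rewrite mxE !eqxx normr1 addr0.
by rewrite mxE (negbTE kj) normr0.
Qed.

Lemma contractiveM p q r (V : 'M[R]_(p, q)) (W : 'M[R]_(q, r)) :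
  contractive V -> contractive W -> contractive (V *m W).
Proof. by move=> cV cW v; rewrite -mulmxA (le_trans (cV _)). Qed.

Lemma contractive1 n : contractive (1%:M : 'M[R]_n).
Proof. by move=> v; rewrite mul1mx. Qed.

(** For u = W^T v, |u|^2 is the inner product of v and W u, hence at most |v| |u|. *)
Lemma contractive_tr p q (W : 'M[R]_(p, q)) : contractive W -> contractive W^T.
Proof.
move=> cW v; set u := W^T *m v.
have [u0|u0] := eqVneq (l2norm u) 0; first by rewrite u0 l2norm_ge0.
have u_gt0 : 0 < l2norm u by rewrite lt0r u0 l2norm_ge0.
rewrite -(ler_pM2l u_gt0) -expr2 l2norm_sqr.
have -> : \sum_i u i 0 ^+ 2 = \sum_k v k 0 * (W *m u) k 0.
  under [RHS]eq_bigr do rewrite mxE mulr_sumr.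
  rewrite exchange_big; apply: eq_bigr => i _.
  rewrite expr2 {2}/u mxE mulr_sumr; apply: eq_bigr => k _; rewrite mxE; ring.
apply: (le_trans (ler_norm _)); apply: (le_trans (dot_le_l2norm _ _)).
by rewrite mulrC ler_wpM2r ?l2norm_ge0.
Qed.

Lemma proj_perpE n (v : 'cV[R]_n) i :
  (proj_perp n *m v) i 0 = v i 0 - n%:R^-1 * \sum_k v k 0.
Proof.
rewrite /proj_perp mulmxBl mul1mx -scalemxAl !mxE; congr (_ - _ * _).
by apply: eq_bigr => k _; rewrite mxE mul1r.
Qed.

Lemma proj_perp_contractive n : contractive (proj_perp n : 'M[R]_n).
Proof.
move=> v; apply: l2norm_le; first exact: l2norm_ge0.
case: n v => [|n] v; first by rewrite big_ord0 sqr_ge0.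
set s := \sum_k v k 0; set c := n.+1%:R^-1 * s.
have cs : n.+1%:R * c = s by rewrite /c mulrA divff ?mul1r // pnatr_eq0.
have -> : \sum_i (proj_perp n.+1 *m v) i 0 ^+ 2 =
    \sum_i (v i 0 ^+ 2 - 2 * c * v i 0 + c ^+ 2).
  by apply: eq_bigr => i _; rewrite proj_perpE -/s -/c; ring.
rewrite big_split sumrB /= -mulr_sumr -l2norm_sqr -/s sumr_const card_ord.
rewrite -[c ^+ 2 *+ _]mulr_natl -cs.
have : 0 <= n.+1%:R * c ^+ 2 by rewrite mulr_ge0 // sqr_ge0.
by move=> H; nra.
Qed.

Lemma sum_proj_perp n (v : 'cV[R]_n) : \sum_i (proj_perp n *m v) i 0 = 0.
Proof.
under eq_bigr do rewrite proj_perpE.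
rewrite sumrB sumr_const card_ord -[_ *+ n]mulr_natl mulrA.
case: n v => [|n] v; first by rewrite !big_ord0 mulr0 subrr.
by rewrite divff ?pnatr_eq0 // mul1r subrr.
Qed.

Lemma proj_perp_id n (v : 'cV[R]_n) : \sum_i v i 0 = 0 -> proj_perp n *m v = v.
Proof.
by move=> v0; apply/matrixP => i j; rewrite ord1 proj_perpE v0 mulr0 subr0.
Qed.

Lemma relu_dist n (u v : 'cV[R]_n) : l2norm (relu u - relu v) <= l2norm (u - v).
Proof.
apply: le_l2norm => i; rewrite !mxE; move: (u i 0) (v i 0) => a b.
have /orP[a0|a0] := le_total 0 a; have /orP[b0|b0] := le_total 0 b.
- by rewrite (max_r a0) (max_r b0).
- by rewrite (max_r a0) (max_l b0) subr0 !ger0_norm ?subr_ge0 //; lra.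
- rewrite (max_l a0) (max_r b0) sub0r normrN distrC !ger0_norm ?subr_ge0 //; lra.
- by rewrite (max_l a0) (max_l b0) subrr normr0.
Qed.

Lemma relu0 p q : relu (0 : 'M[R]_(p, q)) = 0.
Proof. by apply/matrixP => i j; rewrite !mxE maxxx. Qed.

Lemma col_relu p q (A : 'M[R]_(p, q)) j : col j (relu A) = relu (col j A).
Proof. by apply/matrixP => i k; rewrite !mxE. Qed.

(** What a LayerNorm with b = 1 does after centering. *)
Definition clip n (C : R) (v : 'cV[R]_n) : 'cV[R]_n := (Num.max (l2norm v) C)^-1 *: v.

Variable C : R.
Hypothesis C_gt0 : 0 < C.

Let max_gt0 n (v : 'cV[R]_n) : 0 < Num.max (l2norm v) C.
Proof. by rewrite lt_max C_gt0 orbT. Qed.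

Lemma clip_le1 n (v : 'cV[R]_n) : l2norm (clip C v) <= 1.
Proof.
rewrite l2normZ gtr0_norm ?invr_gt0 // mulrC ler_pdivrMr // mul1r.
by rewrite le_max lexx.
Qed.

(** Changing the vector and changing the normalizer cost a factor 1/C each: the normalizers are at
    least C and 1-Lipschitz, and [v] is no longer than its own normalizer. *)
Lemma clip_dist n (u v : 'cV[R]_n) : l2norm (clip C u - clip C v) <= 2 / C * l2norm (u -
    v).
Proof.
have -> : clip C u - clip C v = (Num.max (l2norm u) C)^-1 *: (u - v) +
    ((Num.max (l2norm u) C)^-1 - (Num.max (l2norm v) C)^-1) *: v.
  by rewrite /clip scalerBr scalerBl addrA subrK.
apply: (le_trans (ler_l2normD _ _)); rewrite !l2normZ.
have Mu := max_gt0 u; have Mv := max_gt0 v.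
set d := l2norm (u - v); have d0 : 0 <= d := l2norm_ge0 _.
have -> : 2 / C * d = C^-1 * d + C^-1 * d by ring.
have CMu : (Num.max (l2norm u) C)^-1 <= C^-1.
  by rewrite lef_pV2 ?posrE // le_max lexx orbT.
apply: lerD; first by rewrite gtr0_norm ?invr_gt0 // ler_wpM2r.
have duv : `|l2norm u - l2norm v| <= d.
  rewrite ler_norml /d; have := l2norm_triangle u v.
  by have := l2norm_triangle v u; rewrite l2norm_distC; lra.
have dM : `|Num.max (l2norm u) C - Num.max (l2norm v) C| <= d.
  apply: le_trans duv; move: (l2norm u) (l2norm v) => a b.
  have /orP[aC|aC] := le_total a C; have /orP[bC|bC] := le_total b C.
  - by rewrite (max_r aC) (max_r bC) subrr normr0.
  - rewrite (max_r aC) (max_l bC) ler0_norm ?subr_le0 //.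
    by rewrite ler0_norm ?subr_le0 //; lra.
  - rewrite (max_l aC) (max_r bC) ger0_norm ?subr_ge0 // ger0_norm ?subr_ge0 //; lra.
  - by rewrite (max_l aC) (max_l bC).
set a := Num.max (l2norm u) C in Mu CMu dM *; set b := Num.max (l2norm v) C in Mv dM *.
have -> : a^-1 - b^-1 = (b - a) * a^-1 * b^-1 by field; rewrite !gt_eqF.
rewrite !normrM -mulrA -mulrA distrC (gtr0_norm (x := a^-1)) ?invr_gt0 //.
rewrite (gtr0_norm (x := b^-1)) ?invr_gt0 //.
have vb : b^-1 * l2norm v <= 1 by rewrite mulrC ler_pdivrMr // mul1r le_max lexx.
have vb0 : 0 <= b^-1 * l2norm v by rewrite mulr_ge0 ?invr_ge0 ?l2norm_ge0 // ltW.
rewrite [C^-1 * d]mulrC -[a^-1 / b * _]mulrA; apply: ler_pM => //;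
    first by rewrite mulr_ge0 // invr_ge0 ltW.
by rewrite -[X in _ <= X]mulr1 ler_pM // invr_ge0 ltW.
Qed.

Lemma clip0 n : clip C (0 : 'cV[R]_n) = 0.
Proof. by rewrite /clip scaler0. Qed.

Lemma layer_norm_colE n (v : 'cV[R]_n) :
  layer_norm_col C 1 v = clip C (proj_perp n *m v).
Proof. by rewrite /layer_norm_col subrr scale0r addr0 mul1r. Qed.

End euclidean_norm.

Section column_norm.
Context {R : realType}.

Lemma col_le_norm12 m N (A : 'M[R]_(m, N)) j : l2norm (col j A) <= norm12 A.
Proof. exact: (le_bigmax _ (fun j => l2norm (col j A))). Qed.

Lemma norm12_le m N (A : 'M[R]_(m, N)) (c : R) :
  0 <= c -> (forall j, l2norm (col j A) <= c) -> norm12 A <= c.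
Proof. by move=> c0 H; apply: bigmax_le. Qed.

Lemma norm12_ge0 m N (A : 'M[R]_(m, N)) : 0 <= norm12 A.
Proof. exact: bigmax_ge_id. Qed.

End column_norm.

(** * Attention *)

Section masked_softmax.
Context {R : realType}.

Let weight N (S : 'M[R]_N) (k j : 'I_N) : R :=
  if (k <= j)%N then expR (S k j) else 0.

Let masked_softmaxE N (S : 'M[R]_N) k j :
  softmax (masked_scores S) k j = weight S k j / \sum_i weight S i j.
Proof.
have H i : fine (expeR (masked_scores S i j)) = weight S i j.
  by rewrite !mxE /weight; case: (leqP i j) => /= _; rewrite ?add0r.
by rewrite mxE H; congr (_ / _); apply: eq_bigr.
Qed.

Let weight_ge0 N (S : 'M[R]_N) k j : 0 <= weight S k j.
Proof. by rewrite /weight; case: ifP => // _; exact: expR_ge0. Qed.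

Let sum_weight_gt0 N (S : 'M[R]_N) j : 0 < \sum_i weight S i j.
Proof.
rewrite (bigD1 j) //= ltr_pwDl ?sumr_ge0 //.
by rewrite /weight leqnn expR_gt0.
Qed.

Lemma masked_softmax_ge0 N (S : 'M[R]_N) k j : 0 <= softmax (masked_scores S) k j.
Proof. by rewrite masked_softmaxE divr_ge0 // ltW. Qed.

Lemma sum_masked_softmax N (S : 'M[R]_N) j : \sum_k softmax (masked_scores S) k j = 1.
Proof.
under eq_bigr do rewrite masked_softmaxE.
by rewrite -mulr_suml divff // gt_eqF.
Qed.

(** An unnormalized weight and the sum of the weights each change by a factor at most exp tau, and
    exp (-2 tau) >= 1 - 2 tau. Masked entries are 0 on both sides. A one-sided bound suffices for
    the l1 distance because the columns sum to 1. *)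
Lemma masked_softmax_ratio N (S S' : 'M[R]_N) (tau : R) k j :
  (forall i, `|S i j - S' i j| <= tau) ->
  (1 - 2 * tau) * softmax (masked_scores S) k j <= softmax (masked_scores S') k j.
Proof.
move=> H; rewrite !masked_softmaxE.
have up i : weight S' i j <= expR tau * weight S i j.
  rewrite /weight; case: ifP => _; last by rewrite mulr0.
  by rewrite -expRD ler_expR; have := H i; rewrite ler_norml; lra.
have dn i : expR (- tau) * weight S i j <= weight S' i j.
  rewrite /weight; case: ifP => _; last by rewrite mulr0.
  by rewrite -expRD ler_expR; have := H i; rewrite ler_norml; lra.
have s0 := sum_weight_gt0 S j; have s0' := sum_weight_gt0 S' j.
have sS : \sum_i weight S' i j <= expR tau * \sum_i weight S i j.
  by rewrite mulr_sumr; apply: ler_sum.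
apply: (@le_trans _ _ (expR (- (2 * tau)) * (weight S k j / \sum_i weight S i j))).
  apply: ler_wpM2r; first by rewrite divr_ge0 // ltW.
  by have := expR_ge1Dx (- (2 * tau)).
have -> : - (2 * tau) = - tau + - tau by ring.
rewrite expRD mulrA ler_pdivlMr // mulrAC.
apply: (@le_trans _ _ (expR (- tau) * weight S k j)); last exact: dn.
rewrite [X in X <= _](_ : _ = expR (- tau) * weight S k j *
    ((expR (- tau) * \sum_i weight S' i j) / \sum_i weight S i j)); last by ring.
rewrite ler_piMr ?mulr_ge0 ?expR_ge0 // ler_pdivrMr // mul1r.
by rewrite -(ler_pM2l (expR_gt0 tau)) mulrA -expRD subrr expR0 mul1r.
Qed.

Lemma masked_softmax_dist N (S S' : 'M[R]_N) (tau : R) j :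
  (forall i, `|S i j - S' i j| <= tau) ->
  \sum_k `|softmax (masked_scores S) k j - softmax (masked_scores S') k j| <= 4 * tau.
Proof.
move=> H; set p := softmax _; set p' := softmax _.
have tau0 : 0 <= tau by apply: le_trans (H j).
have ratio k := masked_softmax_ratio k H.
(* |x| = 2 max(x, 0) - x, and the differences sum to 0 *)
apply: (@le_trans _ _ (\sum_k (4 * tau * p k j - (p k j - p' k j)))).
  apply: ler_sum => k _; have := ratio k; rewrite -/p -/p'.
  have : 0 <= tau * p k j by rewrite mulr_ge0 // masked_softmax_ge0.
  by rewrite ler_norml => ? ?; apply/andP; split; lra.
by rewrite !sumrB -mulr_sumr !sum_masked_softmax mulr1 !subrr subr0.
Qed.

Lemma col_mulmx_sum m N q (U : 'M[R]_(m, N)) (P : 'M[R]_(N, q)) j :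
  col j (U *m P) = \sum_k P k j *: col k U.
Proof.
apply/matrixP => i c; rewrite !mxE summxE; apply: eq_bigr => k _.
by rewrite !mxE mulrC.
Qed.

Lemma l2norm_mulmx_le m N q (U : 'M[R]_(m, N)) (P : 'M[R]_(N, q)) j :
  l2norm (col j (U *m P)) <= norm12 U * \sum_k `|P k j|.
Proof.
rewrite col_mulmx_sum mulr_sumr; apply: (le_trans (ler_l2norm_sum _)).
apply: ler_sum => k _; rewrite l2normZ mulrC.
by rewrite ler_wpM2r // col_le_norm12.
Qed.

Lemma attention_dist m N (U U' : 'M[R]_(m, N)) (S S' : 'M[R]_N) (tau : R) j :
  (forall i, `|S i j - S' i j| <= tau) ->
  l2norm (col j (U' *m softmax (masked_scores S') - U *m softmax (masked_scores S)))
    <= norm12 (U' - U) + 4 * tau * norm12 U.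
Proof.
move=> H; have -> : U' *m softmax (masked_scores S') - U *m softmax (masked_scores S) =
    (U' - U) *m softmax (masked_scores S') -
    U *m (softmax (masked_scores S) - softmax (masked_scores S')).
  by rewrite mulmxBl mulmxBr opprB addrA subrK.
rewrite raddfB /=; apply: (le_trans (ler_l2normB _ _)); apply: lerD.
  apply: (le_trans (l2norm_mulmx_le _ _ _)).
  under eq_bigr do rewrite ger0_norm ?masked_softmax_ge0 //.
  by rewrite sum_masked_softmax mulr1.
apply: (le_trans (l2norm_mulmx_le _ _ _)); rewrite mulrC ler_wpM2r ?norm12_ge0 //.
have subE (A B : 'M[R]_N) i k : (A - B) i k = A i k - B i k by rewrite !mxE.
by under eq_bigr do rewrite subE; exact: masked_softmax_dist.
Qed.

Lemma l2norm_attention_le m N (U : 'M[R]_(m, N)) (S : 'M[R]_N) j :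
  l2norm (col j (U *m softmax (masked_scores S))) <= norm12 U.
Proof.
apply: (le_trans (l2norm_mulmx_le _ _ _)).
under eq_bigr do rewrite ger0_norm ?masked_softmax_ge0 //.
by rewrite sum_masked_softmax mulr1.
Qed.

End masked_softmax.

(** * Zero padding and its left inverse *)

Section padding.
Context {R : realType}.
Variables (m n : nat).
Hypothesis m_le_n : (m <= n)%N.

Definition take_rows N (X : 'M[R]_(n, N)) : 'M[R]_(m, N) :=
  \matrix_(i, j) X (widen_ord m_le_n i) j.

Lemma pad_widen N (X : 'M[R]_(m, N)) i j : pad n X (widen_ord m_le_n i) j = X i j.
Proof. by rewrite mxE /=; case: insubP => [k _ /val_inj ->|] //=; rewrite ltn_ord. Qed.

Lemma pad_out N (X : 'M[R]_(m, N)) (i : 'I_n) j : (m <= i)%N -> pad n X i j = 0.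
Proof. by move=> mi; rewrite mxE insubF // ltnNge mi. Qed.

Lemma ord_widenP (i : 'I_n) : (exists k, i = widen_ord m_le_n k) \/ (m <= i)%N.
Proof.
by have [im|] := ltnP i m; [left; exists (Ordinal im); exact: val_inj | right].
Qed.

Lemma padK N : cancel (@pad R m n N) (@take_rows N).
Proof. by move=> X; apply/matrixP => i j; rewrite mxE pad_widen. Qed.

Lemma padB N (X Y : 'M[R]_(m, N)) : pad n (X - Y) = pad n X - pad n Y.
Proof.
apply/matrixP => i j; have [[k ->]|mi] := ord_widenP i.
  by rewrite [LHS]pad_widen [RHS]mxE [(- pad n Y) _ _]mxE !pad_widen !mxE.
by rewrite [RHS]mxE [(- pad n Y) _ _]mxE !pad_out // subrr.
Qed.

Lemma padZ N a (X : 'M[R]_(m, N)) : pad n (a *: X) = a *: pad n X.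
Proof.
apply/matrixP => i j; have [[k ->]|mi] := ord_widenP i.
  by rewrite pad_widen [RHS]mxE pad_widen mxE.
by rewrite [RHS]mxE !pad_out // mulr0.
Qed.

Lemma pad_mulmx N q (X : 'M[R]_(m, N)) (P : 'M[R]_(N, q)) :
  pad n X *m P = pad n (X *m P).
Proof.
apply/matrixP => i j; have [[k ->]|mi] := ord_widenP i.
  by rewrite pad_widen !mxE; apply: eq_bigr => l _; rewrite pad_widen.
by rewrite pad_out // mxE big1 // => l _; rewrite pad_out // mul0r.
Qed.

Lemma col_pad N (X : 'M[R]_(m, N)) j : col j (pad n X) = pad n (col j X).
Proof.
by apply/matrixP => i k; rewrite !mxE; case: insubP => // l _ _; rewrite mxE.
Qed.

Lemma col_take_rows N (X : 'M[R]_(n, N)) j : col j (take_rows X) = take_rows (col j X).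
Proof. by apply/matrixP => i k; rewrite !mxE. Qed.

Lemma take_rowsB N (X Y : 'M[R]_(n, N)) : take_rows (X - Y) = take_rows X - take_rows Y.
Proof. by apply/matrixP => i k; rewrite !mxE. Qed.

Lemma sum_pad (F : 'I_n -> R) : (forall i : 'I_n, (m <= i)%N -> F i = 0) ->
  \sum_i F i = \sum_i F (widen_ord m_le_n i).
Proof.
move=> F0; rewrite (@sum_codom _ _ _ (widen_ord m_le_n)) // => [i j|i ni].
  by move=> /(congr1 val) /= ?; exact: val_inj.
by have [[k ik]|/F0 //] := ord_widenP i; rewrite ik codom_f in ni.
Qed.

Lemma l2norm_pad (v : 'cV[R]_m) : l2norm (pad n v) = l2norm v.
Proof.
rewrite /l2norm sum_pad => [|i mi]; last by rewrite pad_out // expr0n.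
by congr Num.sqrt; apply: eq_bigr => i _; rewrite pad_widen.
Qed.

Lemma l2norm_take_rows (v : 'cV[R]_n) : l2norm (take_rows v) <= l2norm v.
Proof.
apply: l2norm_le; first exact: l2norm_ge0.
rewrite l2norm_sqr [X in _ <= X](bigID (fun i : 'I_n => (i < m)%N)) /=.
rewrite -[X in X <= _]addr0; apply: lerD; last by apply: sumr_ge0 => *; exact: sqr_ge0.
rewrite [X in _ <= X]big_mkcond sum_pad => [|i]; last by rewrite ltnNge => ->.
by apply: ler_sum => i _; rewrite mxE /= ltn_ord.
Qed.

Lemma norm12_take_rows N (X : 'M[R]_(n, N)) : norm12 (take_rows X) <= norm12 X.
Proof.
apply: norm12_le => [|j]; first exact: norm12_ge0.
by rewrite col_take_rows (le_trans (l2norm_take_rows _)) // col_le_norm12.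
Qed.

Lemma norm12_take_rows_dist N (Y : 'M[R]_(n, N)) (X : 'M[R]_(m, N)) :
  norm12 (take_rows Y - X) <= norm12 (Y - pad n X).
Proof. by rewrite -[X in take_rows Y - X]padK -take_rowsB norm12_take_rows. Qed.

Lemma clip_pad C (v : 'cV[R]_m) : clip C (pad n v) = pad n (clip C v).
Proof. by rewrite /clip l2norm_pad padZ. Qed.

(* Centering in the larger space fixes the padding of a centered vector, so the
   two LayerNorms agree up to the error of the attention output. *)
Lemma layer_norm_pad_dist C (a u : 'cV[R]_m) : 0 < C ->
  l2norm (take_rows (layer_norm_col C 1 (pad n u)) - layer_norm_col C 1 a) <=
  2 / C * l2norm (u - proj_perp m *m a).
Proof.
move=> C0; rewrite !layer_norm_colE -[X in _ - X]padK -take_rowsB -clip_pad.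
apply: (le_trans (l2norm_take_rows _)); apply: (le_trans (clip_dist C0 _ _)).
rewrite ler_wpM2l ?divr_ge0 ?(ltW C0) //.
rewrite -[pad n (proj_perp m *m a)]proj_perp_id; last first.
  rewrite sum_pad => [|i mi]; last by rewrite pad_out.
  by under eq_bigr do rewrite pad_widen; exact: sum_proj_perp.
rewrite -mulmxBr -padB; apply: (le_trans (@proj_perp_contractive _ _ _)).
by rewrite l2norm_pad.
Qed.

End padding.

Section matrix_norm_bounds.
Context {R : realType}.

Lemma l2norm_le_entries n (v : 'cV[R]_n) (c : R) :
  (forall i, `|v i 0| <= c) -> l2norm v <= n%:R * c.
Proof.
move=> H; apply: (le_trans (l2norm_le_sum v)).
apply: (@le_trans _ _ (\sum_(i < n) c)); first exact: ler_sum.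
by rewrite sumr_const card_ord mulr_natl.
Qed.

Lemma col_mulmx p q N (W : 'M[R]_(p, q)) (X : 'M[R]_(q, N)) j :
  col j (W *m X) = W *m col j X.
Proof. by rewrite !colE mulmxA. Qed.

Lemma norm12_contractive p q N (W : 'M[R]_(p, q)) (X : 'M[R]_(q, N)) :
  contractive W -> norm12 (W *m X) <= norm12 X.
Proof.
move=> cW; apply: norm12_le => [|j]; first exact: norm12_ge0.
by rewrite col_mulmx (le_trans (cW _)) // col_le_norm12.
Qed.

Lemma ler_norm12D m N (A B : 'M[R]_(m, N)) : norm12 (A + B) <= norm12 A + norm12 B.
Proof.
apply: norm12_le => [|j]; first by rewrite addr_ge0 // norm12_ge0.
by rewrite raddfD /= (le_trans (ler_l2normD _ _)) // lerD // col_le_norm12.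
Qed.

Lemma norm12_dist_add m N (B A D : 'M[R]_(m, N)) :
  norm12 (A - D) <= norm12 (A - B) + norm12 (B - D).
Proof. by have := ler_norm12D (A - B) (B - D); rewrite addrA subrK. Qed.

Lemma norm12_triangle m N (A B : 'M[R]_(m, N)) : norm12 A <= norm12 B + norm12 (A - B).
Proof. by have := ler_norm12D B (A - B); rewrite [B + _]addrC subrK. Qed.

(** The three error terms are at most xi rho, xi^2 and rho xi; xi <= rho absorbs the quadratic
    one. *)
Lemma dot_col_dist p N (A B A' B' : 'M[R]_(p, N)) (xi rho : R) i j :
  norm12 A <= rho -> norm12 B <= rho -> norm12 (A' - A) <= xi -> norm12 (B' - B) <= xi ->
  xi <= rho ->
  `|(A^T *m B) i j - (A'^T *m B') i j| <= 3 * rho * xi.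
Proof.
move=> A1 B1 A2 B2 xr.
have dotE (C D : 'M[R]_(p, N)) : (C^T *m D) i j = \sum_k col i C k 0 * col j D k 0.
  by rewrite mxE; apply: eq_bigr => k _; rewrite !mxE.
rewrite !dotE -sumrB.
have -> : \sum_k (col i A k 0 * col j B k 0 - col i A' k 0 * col j B' k 0) =
   - (\sum_k col i (A' - A) k 0 * col j B k 0) - (\sum_k col i (A' - A) k 0 * col j (B' -
       B) k 0)
   - \sum_k col i A k 0 * col j (B' - B) k 0.
  by rewrite -!sumrN -!big_split; apply: eq_bigr => k _; rewrite !mxE /=; ring.
have bnd (C D : 'M[R]_(p, N)) c d : norm12 C <= c -> norm12 D <= d ->
    `|\sum_k col i C k 0 * col j D k 0| <= c * d.
  move=> Cc Dd; apply: (le_trans (dot_le_l2norm _ _)).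
  by apply: ler_pM; rewrite ?l2norm_ge0 // ?(le_trans (col_le_norm12 _ _)).
have xi0 : 0 <= xi := le_trans (norm12_ge0 _) A2.
have e1 := bnd _ _ _ _ A2 B1; have e2 := bnd _ _ _ _ A2 B2; have e3 := bnd _ _ _ _ A1 B2.
have e4 : xi * xi <= rho * xi by rewrite ler_wpM2r.
move: e1 e2 e3; set a := \sum_k _; set b := \sum_k _; set c := \sum_k _.
have := ler_normB (- a - b) c; have := ler_normB (- a) b; rewrite normrN.
lra.
Qed.

End matrix_norm_bounds.

(** * Stability of the attention of a target layer *)

Section attention_layer.
Context {R : realType}.
Variables (C : R) (m ma w n r : nat).
Hypotheses (C_gt0 : 0 < C) (m_le_n : (m <= n)%N).
Variables (t : layer_params R m ma w 0) (Kt Qt : 'M[R]_(r, m)).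
Hypotheses (t_ln : ln_b t = 1) (Wv : contractive (W_V t)) (cK : contractive Kt)
  (cQ : contractive Qt) (KQ : Kt^T *m Qt = (W_K t)^T *m W_Q t).

(** Centering multiplies from the left and the softmax from the right, so the centering can be moved
    into the value matrix, a linear map that an MLP can apply in advance. *)
Definition centered_V : 'M[R]_m := proj_perp m *m W_V t.

Lemma centered_V_contractive : contractive centered_V.
Proof. by apply: contractiveM => //; exact: proj_perp_contractive. Qed.

Lemma col_layer_norm p N (b : R) (A : 'M[R]_(p, N)) j :
  col j (layer_norm C b A) = layer_norm_col C b (col j A).
Proof. by apply/matrixP => i k; rewrite ord1 !mxE. Qed.

Lemma proj_attention N (X : 'M[R]_(m, N)) : proj_perp m *m attention t X =
  centered_V *m X *m softmax (masked_scores ((Kt *m X)^T *m (Qt *m X))).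
Proof.
rewrite /attention /centered_V !mulmxA; congr (_ *m softmax (masked_scores _)).
by rewrite !trmx_mul -!mulmxA; congr (_ *m _); rewrite !mulmxA KQ.
Qed.

(** The scores are off by 3 rho xi, so the attention output by xi + 4 (3 rho xi) rho; the LayerNorm
    multiplies this by 2/C, and the residual stream adds xi. *)
Lemma attention_layer_dist N (X Xt Ut : 'M[R]_(m, N)) (Kh Qh : 'M[R]_(r, N)) (xi rho : R)
    j :
  norm12 X <= rho -> xi <= rho -> norm12 (Xt - X) <= xi ->
  norm12 (Ut - centered_V *m X) <= xi ->
  norm12 (Kh - Kt *m X) <= xi -> norm12 (Qh - Qt *m X) <= xi ->
  l2norm (take_rows m_le_n (layer_norm_col C 1
            (pad n (col j (Ut *m softmax (masked_scores (Kh^T *m Qh)))))) + col j Xt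
          - col j (layer_norm C 1 (attention t X) + X))
    <= (1 + 2 / C * (1 + 12 * rho ^+ 2)) * xi.
Proof.
move=> X1 xr X2 U2 K2 Q2; set u := col j (Ut *m _).
have xi0 : 0 <= xi := le_trans (norm12_ge0 _) X2.
have rho0 : 0 <= rho := le_trans (norm12_ge0 _) X1.
rewrite [col j (_ + X)]raddfD /= col_layer_norm.
have -> : take_rows m_le_n (layer_norm_col C 1 (pad n u)) + col j Xt -
    (layer_norm_col C 1 (col j (attention t X)) + col j X) =
    (take_rows m_le_n (layer_norm_col C 1 (pad n u)) -
     layer_norm_col C 1 (col j (attention t X))) + col j (Xt - X).
  by rewrite [col j (Xt - X)]raddfB /= opprD addrACA.
apply: (le_trans (ler_l2normD _ _)); rewrite mulrDl mul1r addrC; apply: lerD.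
  exact: le_trans (col_le_norm12 _ _) X2.
apply: (le_trans (layer_norm_pad_dist m_le_n _ _ C_gt0)).
rewrite -[X in _ <= X]mulrA ler_wpM2l ?divr_ge0 ?(ltW C_gt0) //.
rewrite -col_mulmx proj_attention /u -raddfB /=.
have UX : norm12 (centered_V *m X) <= rho.
  by apply: le_trans X1; apply: norm12_contractive; exact: centered_V_contractive.
apply: (le_trans (attention_dist (tau := 3 * rho * xi) _ _ _)).
  move=> i; apply: dot_col_dist => //; exact: le_trans (norm12_contractive _ _) X1.
have -> : (1 + 12 * rho ^+ 2) * xi = xi + 4 * (3 * rho * xi) * rho by ring.
by apply: lerD => //; apply: ler_wpM2l => //; rewrite !mulr_ge0.
Qed.

(** The additive bound controls the Lipschitz constants, which grow with the activations. The
    multiplicative one keeps the final error proportional to the norm of the input. *)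
Lemma norm12_target_state N (X : 'M[R]_(m, N)) :
  norm12 (layer_norm C 1 (attention t X) + X) <= norm12 X + 1 /\
  norm12 (layer_norm C 1 (attention t X) + X) <= (1 + 2 / C) * norm12 X.
Proof.
have X0 := norm12_ge0 X.
have H j : l2norm (layer_norm_col C 1 (col j (attention t X))) <= 2 / C * norm12 X.
  rewrite layer_norm_colE -col_mulmx proj_attention.
  have := clip_dist C_gt0 (col j (centered_V *m X *m softmax (masked_scores
     ((Kt *m X)^T *m (Qt *m X))))) 0.
  rewrite clip0 !subr0 => /le_trans -> //.
  rewrite ler_wpM2l ?divr_ge0 ?(ltW C_gt0) //.
  apply: (le_trans (l2norm_attention_le _ _ _)).
  exact: (norm12_contractive _ centered_V_contractive).
split; apply: norm12_le => [|j].
- by rewrite addr_ge0.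
- rewrite raddfD /= addrC; apply: (le_trans (ler_l2normD _ _)); apply: lerD.
    exact: col_le_norm12.
  by rewrite col_layer_norm layer_norm_colE clip_le1.
- by rewrite mulr_ge0 // addr_ge0 // divr_ge0 // ltW.
- rewrite raddfD /= addrC; apply: (le_trans (ler_l2normD _ _)); rewrite mulrDl mul1r.
  by apply: lerD; [exact: col_le_norm12 | rewrite col_layer_norm].
Qed.

End attention_layer.

(** * Four large layers for one target layer *)

Definition layer_pruning (R : realType) m ma w h (p p' : layer_params R m ma w h) : Prop
    :=
  [/\ mx_pruning (W_K p) (W_K p'),
      mx_pruning (W_Q p) (W_Q p') &
      mx_pruning (W_V p) (W_V p')] /\
  [/\ mx_pruning (W_in p) (W_in p'),
      (forall k, mx_pruning (W_hid p k) (W_hid p' k)),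
      mx_pruning (W_out p) (W_out p') &
      ln_b p' = ln_b p \/ ln_b p' = 0].

Section large_layers.
Context {R : realType}.
Variables (C : R) (m ma w r n na v jv jk : nat) (K : finType).
Hypotheses (C_gt0 : 0 < C) (m_le_n : (m <= n)%N).

Local Notation target := (layer_params R m ma w 0).
Local Notation large := (layer_params R n na v 2).

(* Hidden neurons: positive and negative parts of the m inputs, and the hidden
   layer of the target.  Output coordinates: the residual stream, jv candidate
   columns of W_V per value, and the keys and queries. *)
Definition hidden_unit : finType := ('I_m + 'I_m + 'I_w)%type.
Definition output_coord : finType := ('I_m + 'I_m * 'I_jv + ('I_r + 'I_r))%type.

Variables (e : 'I_m * K -> 'I_v) (h : hidden_unit -> 'I_v) (f : hidden_unit * K -> 'I_v)
  (o : output_coord -> 'I_n) (row : 'I_r * 'I_jk -> 'I_na).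
Hypotheses (e_inj : injective e) (h_inj : injective h) (f_inj : injective f)
  (o_inj : injective o) (row_inj : injective row)
  (o_widen : forall i, o (inl (inl i)) = widen_ord m_le_n i).

Variable eta : R.
Hypotheses (eta_ge0 : 0 <= eta) (eta_le1 : eta <= 1).

Let coordX (i : 'I_m) : output_coord := inl (inl i).
Let coordV (i : 'I_m) (t : 'I_jv) : output_coord := inl (inr (i, t)).
Let coordK (k : 'I_r) : output_coord := inr (inl k).
Let coordQ (k : 'I_r) : output_coord := inr (inr k).

Let x := widen_ord m_le_n.

Definition layer_dense (p : large) :=
  mlp_dense (W_in p) (W_hid p ord0) (W_hid p ord_max) (W_out p) x e h f o eta.

Definition selects_values (p : large) := forall i, exists t,
  1 / 2 <= W_V p (x i) (o (coordV i t)) <= 1.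

(** One [t] serves both matrices: scores are sums over the rows of products of keys and queries, so
    key k and query k have to be read into the same row. *)
Definition selects_scores (p : large) := forall k, exists t,
  1 / 2 <= W_K p (row (k, t)) (o (coordK k)) <= 1 /\
  1 / 2 <= W_Q p (row (k, t)) (o (coordQ k)) <= 1.

(* Relative error of a pruned MLP, each output coordinate being off by at most
   #|hidden_unit| * 5 * eta * m times the norm of the input. *)
Definition theta : R := #|output_coord|%:R * (#|hidden_unit|%:R * (5 * eta * m%:R)).

Let theta1 : R := #|hidden_unit|%:R * (5 * eta * m%:R).

Lemma theta_ge0 : 0 <= theta.
Proof. by rewrite /theta !mulr_ge0. Qed.

Let theta1_ge0 : 0 <= theta1.
Proof. by rewrite /theta1 !mulr_ge0. Qed.

Let x_inj : injective x.
Proof. by move=> i j /(congr1 val) /= ?; exact: val_inj. Qed.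

Lemma layer_no_value N (b : R) (p : large) (X : 'M[R]_(n, N)) : W_V p = 0 ->
  layer C p X = mlp p X.
Proof.
move=> V0; rewrite /layer /attention V0 !mul0mx; congr mlp.
rewrite -[RHS]add0r; congr (_ + _); apply/matrixP => i j;
    rewrite [LHS]mxE /layer_norm_col.
have -> : col j (0 : 'M[R]_(n, N)) = 0 by apply/matrixP => k c; rewrite !mxE.
by rewrite mulmx0 !scaler0 add0r !mxE.
Qed.

Lemma mlp_hid2E N (p : large) (X : 'M[R]_(n, N)) : mlp p X =
  W_out p *m relu (W_hid p ord_max *m relu (W_hid p ord0 *m relu (W_in p *m X))).
Proof.
rewrite /mlp !enum_ordSl /= (size0nil (size_enum_ord 0)) /=.
by congr (_ *m relu (W_hid p _ *m _)); exact: val_inj.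
Qed.

Let units_in (t : target) (i : hidden_unit) (j : 'I_m) : R :=
  match i with
  | inl (inl k) => (k == j)%:R
  | inl (inr k) => - (k == j)%:R
  | inr k => W_in t k j
  end.

Let units_in_le2 t i j : contractive (W_in t) -> `|units_in t i j| <= 2.
Proof.
move=> cW; case: i => [[k|k]|k] /=; rewrite ?normrN.
- by case: (_ == _); rewrite ?normr1 ?normr0 ?ler1n.
- by case: (_ == _); rewrite ?normr1 ?normr0 ?ler1n.
- by apply: (le_trans (contractive_entry _ _ cW)); rewrite ler1n.
Qed.

Let sum_delta (k : 'I_m) (F : 'I_m -> R) : \sum_j (k == j)%:R * F j = F k.
Proof.
rewrite (bigD1 k) //= eqxx mul1r big1 ?addr0 // => j kj.
by rewrite eq_sym (negbTE kj) mul0r.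
Qed.

Let entry_bound N (X : 'M[R]_(n, N)) c :
  #|hidden_unit|%:R * (5 * eta * \sum_j `|X (x j) c|) <=
  theta1 * l2norm (col c (take_rows m_le_n X)).
Proof.
rewrite /theta1 -[X in _ <= X]mulrA ler_wpM2l // -[X in _ <= X]mulrA ler_wpM2l ?mulr_ge0
    //.
have := sum_le_l2norm (col c (take_rows m_le_n X)).
by under eq_bigr do rewrite !mxE.
Qed.

(** A linear map passes the ReLU as F x = F relu(x) - F relu(-x). The units for the hidden layer of
    the target get outgoing coefficients 0. *)
Lemma linear_layer (t : target) (p : large) (F : output_coord -> 'I_m -> R) :
  contractive (W_in t) -> layer_dense p -> (forall l j, `|F l j| <= 2) ->
  exists p', layer_pruning p p' /\ forall N (X : 'M[R]_(n, N)) c,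
    (forall l, `|layer C p' X (o l) c - \sum_j F l j * X (x j) c| <=
               theta1 * l2norm (col c (take_rows m_le_n X))) /\
    (forall i, i \notin codom o -> layer C p' X i c = 0).
Proof.
move=> cW dense F2.
pose B l (i : hidden_unit) : R :=
  match i with inl (inl k) => F l k | inl (inr k) => - F l k | inr _ => 0 end.
have B2 l i : `|B l i| <= 2 by case: i => [[k|k]|k] /=; rewrite ?normrN ?normr0.
have [Win [W0 [W1 [Wo [[H1 H2 H3 H4] Happ]]]]] :=
  mlp_dense_approx x_inj e_inj h_inj f_inj o_inj eta_le1 dense
    (fun i j => units_in_le2 i j cW) B2.
pose p' : large := LayerParams (0 : 'M[R]_(na, n)) (0 : 'M[R]_(na, n)) 0 Win
  (fun k => if k == ord0 then W0 else W1) Wo (ln_b p).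
exists p'; split.
  split; first by split; exact: mx_pruning0.
  split => //=; last by left.
  move=> k; case: eqP => [->|/eqP k0] //.
  suff -> : k = ord_max by [].
  by apply: val_inj; case: k k0 => -[|[|]].
move=> N X c; rewrite layer_no_value // mlp_hid2E /=.
have [Hl H0] := Happ N X c; split => // l.
apply: le_trans (entry_bound X c); apply: le_trans (Hl l).
rewrite le_eqVlt; apply/orP; left; apply/eqP; congr (`|_ - _|).
rewrite big_sumType /= big_sumType /= [X in _ + X]big1 ?addr0; last by move=> *;
    rewrite mul0r.
rewrite -big_split /=; apply: eq_bigr => k _; rewrite sum_delta.
under [X in - F l k * Num.max 0 X]eq_bigr do rewrite mulNr.
rewrite sumrN sum_delta mulNr -mulrBr; congr (_ * _).
move: (X _ _) => y; have /orP[y0|y0] := le_total 0 y.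
  by rewrite (max_r y0) max_l ?oppr_le0 // subr0.
by rewrite (max_l y0) max_r ?oppr_ge0 // sub0r opprK.
Qed.

Let selection_inv (v0 : R) : 1 / 2 <= v0 <= 1 -> [/\ v0 != 0, `|v0| <= 1 & `|v0^-1| <= 2].
Proof.
move=> /andP[h1 h2]; have v1 : 0 < v0 by lra.
rewrite !gtr0_norm ?invr_gt0 //; split => //; first by rewrite gt_eqF.
by rewrite -[2]invrK lef_pV2 ?posrE //; lra.
Qed.

Let scaled_bound (v0 a : R) : 1 / 2 <= v0 <= 1 -> `|a| <= 1 -> `|a / v0| <= 2.
Proof.
move=> /selection_inv[_ _ v2] a1; rewrite normrM -[X in _ <= X]mul1r.
by rewrite ler_pM.
Qed.

Definition read_values N (p : large) (tv : 'I_m -> 'I_jv) (Z : 'M[R]_(n, N)) : 'M[R]_(m,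
    N) :=
  \matrix_(i, c) (W_V p (x i) (o (coordV i (tv i))) * Z (o (coordV i (tv i))) c).

Definition read_keys N (p : large) (tk : 'I_r -> 'I_jk) (Z : 'M[R]_(n, N)) : 'M[R]_(r, N)
    :=
  \matrix_(k, c) (W_K p (row (k, tk k)) (o (coordK k)) * Z (o (coordK k)) c).

Definition read_queries N (p : large) (tk : 'I_r -> 'I_jk) (Z : 'M[R]_(n, N)) : 'M[R]_(r,
    N) :=
  \matrix_(k, c) (W_Q p (row (k, tk k)) (o (coordQ k)) * Z (o (coordQ k)) c).

(** The state before the MLP, restricted to the residual coordinates. The pruned MLP reads no
    others, so the mean that the LayerNorm subtracts elsewhere and the stored values, keys and
    queries do not disturb it. *)
Definition attended N (p : large) tv tk (Z : 'M[R]_(n, N)) c : 'cV[R]_m :=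
  take_rows m_le_n (layer_norm_col C 1 (pad n (col c (read_values p tv Z *m
    softmax (masked_scores ((read_keys p tk Z)^T *m read_queries p tk Z))))))
  + col c (take_rows m_le_n Z).

Definition on_residual (F : 'I_m -> R) (l : output_coord) : R :=
  if l is inl (inl i) then F i else 0.

(** The prescribed output is 0 off the residual stream: the values, keys and queries are erased, up
    to the error, before the next block. *)
Lemma attention_layer (t : target) (p : large) tv tk :
  contractive (W_in t) -> contractive (W_out t) -> ln_b p = 1 ->
  layer_dense p ->
  exists p', layer_pruning p p' /\ forall N (Z : 'M[R]_(n, N)) c,
    (forall l, `|layer C p' Z (o l) c - on_residual
         (fun i => (W_out t *m relu (W_in t *m attended p tv tk Z c)) i 0) l| <=
       theta1 * l2norm (attended p tv tk Z c)) /\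
    (forall i, i \notin codom o -> layer C p' Z i c = 0).
Proof.
move=> cI cO pb dense.
pose B (l : output_coord) (i : hidden_unit) : R :=
  match l, i with inl (inl k), inr q => W_out t k q | _, _ => 0 end.
have B2 l i : `|B l i| <= 2.
  case: l i => [[k|k]|k] [[q|q]|q] /=; rewrite ?normr0 //.
  by apply: (le_trans (contractive_entry _ _ cO)); rewrite ler1n.
have [Win [W0 [W1 [Wo [[H1 H2 H3 H4] Happ]]]]] :=
  mlp_dense_approx x_inj e_inj h_inj f_inj o_inj eta_le1 dense
    (fun i j => @units_in_le2 t i j cI) B2.
pose rowk k := row (k, tk k); pose colv i := o (coordV i (tv i)).
have rowk_inj : injective rowk by move=> k k' /row_inj[].
have colv_inj : injective colv by move=> i i' /o_inj[].
have oK_inj : injective (o \o coordK) by move=> k k' /o_inj[].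
have oQ_inj : injective (o \o coordQ) by move=> k k' /o_inj[].
pose p' : large := LayerParams
  (select_mx rowk (o \o coordK) (fun k => pred1 k) (W_K p))
  (select_mx rowk (o \o coordQ) (fun k => pred1 k) (W_Q p))
  (select_mx x colv (fun i => pred1 i) (W_V p)) Win
  (fun k => if k == ord0 then W0 else W1) Wo (ln_b p).
exists p'; split.
  split; first by split; exact: select_mx_pruning.
  split => //=; last by left.
  move=> k; case: eqP => [->|/eqP k0] //.
  suff -> : k = ord_max by [].
  by apply: val_inj; case: k k0 => -[|[|]].
move=> N Z c; rewrite /layer pb.
have V_E : W_V p' *m Z = pad n (read_values p tv Z).
  apply/matrixP => i j; have [[k ->]|mi] := ord_widenP m_le_n i.
    by rewrite pad_widen select_mulmx // big_pred1_eq mxE.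
  rewrite pad_out // select_mulmx_out //; apply/codomP => -[k ik].
  by move: mi; rewrite ik /= leqNgt ltn_ord.
have S_E : (W_K p' *m Z)^T *m (W_Q p' *m Z) = (read_keys p tk Z)^T *m read_queries p tk Z.
  apply/matrixP => i j; rewrite !mxE (sum_codom rowk_inj) => [|k nk].
    apply: eq_bigr => k _; rewrite ![_^T _ _]mxE.
    by rewrite !select_mulmx // !big_pred1_eq !mxE.
  by rewrite [_^T _ _]mxE select_mulmx_out // mul0r.
have A_E : attention p' Z = pad n (read_values p tv Z *m
    softmax (masked_scores ((read_keys p tk Z)^T *m read_queries p tk Z))).
  by rewrite /attention V_E S_E pad_mulmx.
rewrite mlp_hid2E A_E; set V := layer_norm _ _ _ + Z.
have VE : col c (take_rows m_le_n V) = attended p tv tk Z c.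
  apply/matrixP => i k; rewrite ord1 /attended -col_pad !mxE.
  by congr (_ + _).
have [Hl H0] := Happ N V c; split => // l.
rewrite -VE; apply: le_trans (entry_bound V c); apply: le_trans (Hl l).
rewrite le_eqVlt; apply/orP; left; apply/eqP; congr (`|_ - _|).
case: l => [[l|l]|l] /=; try by rewrite big1 // => i _; rewrite mul0r.
rewrite mxE big_sumType /= [X in X + _]big1 ?add0r; last first.
  by move=> -[] *; rewrite mul0r.
apply: eq_bigr => q _; congr (_ * _); rewrite !mxE; congr Num.max.
by apply: eq_bigr => j _; rewrite !mxE.
Qed.

Lemma entries_norm12 N (Y : 'M[R]_(n, N)) (G : 'M[R]_(m, N)) (eps : R) : 0 <= eps ->
  (forall l c, `|Y (o l) c - on_residual (fun i => G i c) l| <= eps) ->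
  (forall i c, i \notin codom o -> Y i c = 0) ->
  norm12 (Y - pad n G) <= #|output_coord|%:R * eps.
Proof.
move=> eps0 Ho Hz; apply: norm12_le => [|c]; first by rewrite mulr_ge0.
have pad_o l : pad n G (o l) c = on_residual (fun i => G i c) l.
  have out l' : (forall i, l' <> coordX i) -> (m <= o l')%N.
    move=> nl; have [[k ok]|//] := ord_widenP m_le_n (o l').
    by case: (nl k); apply: o_inj; rewrite ok /coordX o_widen.
  by case: l => [[l|l]|l]; rewrite ?o_widen ?pad_widen // pad_out // out.
have colE i : col c (Y - pad n G) i 0 = Y i c - pad n G i c by rewrite !mxE.
apply: (le_trans (l2norm_le_sum _)); rewrite (sum_codom o_inj) => [|i ni].
  apply: (@le_trans _ _ (\sum_(l : output_coord) eps)); last first.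
    by rewrite sumr_const mulr_natl.
  by apply: ler_sum => l _; have := Ho l c; rewrite -pad_o -colE.
rewrite colE Hz // pad_out ?subr0 ?normr0 //.
have [[k ik]|//] := ord_widenP m_le_n i.
by rewrite ik -o_widen codom_f in ni.
Qed.

Lemma norm12_padB N (X Y : 'M[R]_(m, N)) : norm12 (pad n X - pad n Y) <= norm12 (X - Y).
Proof.
rewrite -(padB m_le_n); apply: norm12_le => [|c]; first exact: norm12_ge0.
by rewrite col_pad (l2norm_pad m_le_n) col_le_norm12.
Qed.

Lemma identity_layer (t : target) (p : large) : contractive (W_in t) -> layer_dense p ->
  exists p', layer_pruning p p' /\ forall N (Y : 'M[R]_(n, N)),
    norm12 (layer C p' Y - pad n (take_rows m_le_n Y)) <=
    theta * norm12 (take_rows m_le_n Y).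
Proof.
move=> cI dense; pose F l (j : 'I_m) := on_residual (fun i => (i == j)%:R) l.
have F2 l j : `|F l j| <= 2.
  rewrite /F /on_residual; case: l => [[i|i]|i]; rewrite ?normr0 //.
  by case: (_ == _); rewrite ?normr1 ?normr0 ?ler1n.
have [p' [pp Hp]] := linear_layer cI dense F2; exists p'; split => // N Y.
rewrite /theta -mulrA; apply: entries_norm12.
- by rewrite mulr_ge0 // norm12_ge0.
- move=> l c; have [Hl _] := Hp N Y c.
  have -> : on_residual (fun i => take_rows m_le_n Y i c) l = \sum_j F l j * Y (x j) c.
    rewrite /F /on_residual; case: l {Hl} => [[i|i]|i]; rewrite ?sum_delta ?mxE //.
      by rewrite big1 // => j _; rewrite mul0r.
    by rewrite big1 // => j _; rewrite mul0r.
  by apply: le_trans (Hl l) _; rewrite ler_wpM2l // col_le_norm12.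
- by move=> i c; have [_] := Hp N Y c; exact.
Qed.

Variables (t : target) (Kt Qt : 'M[R]_(r, m)).
Hypotheses (t_ln : ln_b t = 1) (cV : contractive (W_V t)) (cI : contractive (W_in t))
  (cO : contractive (W_out t)) (cK : contractive Kt) (cQ : contractive Qt)
  (KQ : Kt^T *m Qt = (W_K t)^T *m W_Q t).

Lemma layer_targetE N (X : 'M[R]_(m, N)) : layer C t X =
  W_out t *m relu (W_in t *m (layer_norm C 1 (attention t X) + X)).
Proof. by rewrite /layer t_ln /mlp (size0nil (size_enum_ord 0)). Qed.

Lemma col_layer_target N (X : 'M[R]_(m, N)) c : col c (layer C t X) =
  W_out t *m relu (W_in t *m col c (layer_norm C 1 (attention t X) + X)).
Proof. by rewrite layer_targetE col_mulmx col_relu col_mulmx. Qed.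

Lemma norm12_layer_target N (X : 'M[R]_(m, N)) :
  norm12 (layer C t X) <= norm12 X + 1 /\
  norm12 (layer C t X) <= (1 + 2 / C) * norm12 X.
Proof.
have [h1 h2] := norm12_target_state C_gt0 cV KQ X.
have le_state : norm12 (layer C t X) <= norm12 (layer_norm C 1 (attention t X) + X).
  apply: norm12_le => [|c]; first exact: norm12_ge0.
  rewrite col_layer_target; apply: (le_trans (cO _)).
  have := relu_dist (W_in t *m col c (layer_norm C 1 (attention t X) + X)) 0.
  rewrite relu0 !subr0 => /le_trans -> //.
  by apply: (le_trans (cI _)); exact: col_le_norm12.
by split; [exact: le_trans h1 | exact: le_trans h2].
Qed.

(* Amplification of the error by one target layer on activations of norm at most
   rho; 12 rho^2 stems from the Lipschitz constant of the attention. *)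
Definition block_factor (rho : R) : R := 16 * (1 + 2 / C * (1 + 12 * rho ^+ 2)).

Lemma block_approx (P0 P1 P2 P3 : large) : ln_b P1 = 1 ->
  layer_dense P0 -> layer_dense P1 -> layer_dense P2 -> layer_dense P3 ->
  selects_values P1 -> selects_scores P1 -> theta <= 1 ->
  exists p0 p1 p2 p3,
    [/\ layer_pruning P0 p0, layer_pruning P1 p1, layer_pruning P2 p2 &
        layer_pruning P3 p3] /\
    forall N (X : 'M[R]_(m, N)) (Y : 'M[R]_(n, N)) (delta s rho : R),
      norm12 X <= s -> norm12 (Y - pad n X) <= delta -> 2 * delta + s <= rho ->
      norm12 (layer C p3 (layer C p2 (layer C p1 (layer C p0 Y))) - pad n (layer C t X))
        <= block_factor rho * (delta + theta * s).
Proof.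
move=> ln1 d0 d1 d2 d3 /choice[tv Htv] /choice[tk Htk] th1.
pose U := centered_V t; have cU : contractive U := centered_V_contractive cV.
pose F (l : output_coord) (j : 'I_m) : R :=
  match l with
  | inl (inl i) => (i == j)%:R
  | inl (inr (i, t')) => if t' == tv i then
       U i j / W_V P1 (x i) (o (coordV i (tv i))) else 0
  | inr (inl k) => Kt k j / W_K P1 (row (k, tk k)) (o (coordK k))
  | inr (inr k) => Qt k j / W_Q P1 (row (k, tk k)) (o (coordQ k))
  end.
have F2 l j : `|F l j| <= 2.
  case: l => [[i|[i t']]|[k|k]] /=.
  - by case: (_ == _); rewrite ?normr1 ?normr0 ?ler1n.
  - case: ifP => _; last by rewrite normr0.
    by apply: scaled_bound => //; exact: contractive_entry.
  - by apply: scaled_bound; [have [] := Htk k | exact: contractive_entry].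
  - by apply: scaled_bound; [have [] := Htk k | exact: contractive_entry].
have [p0 [pp0 H0]] := linear_layer cI d0 F2.
have [p1 [pp1 H1]] := attention_layer tv tk cI cO ln1 d1.
have [p2 [pp2 H2]] := identity_layer cI d2.
have [p3 [pp3 H3]] := identity_layer cI d3.
exists p0, p1, p2, p3; split => // N X Y delta s rho Xs Yd rho_ge.
have s0 : 0 <= s := le_trans (norm12_ge0 _) Xs.
have delta0 : 0 <= delta := le_trans (norm12_ge0 _) Yd.
have th0 := theta_ge0.
set Xh := take_rows m_le_n Y.
have Xhd : norm12 (Xh - X) <= delta.
  exact: le_trans (norm12_take_rows_dist m_le_n _ _) Yd.
have Xhs : norm12 Xh <= s + delta.
  by apply: (le_trans (norm12_triangle _ X)); exact: lerD.
set Z := layer C p0 Y.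
have Zo l c : `|Z (o l) c - \sum_j F l j * Xh j c| <= theta1 * (s + delta).
  have [Hl _] := H0 N Y c.
  under eq_bigr do rewrite mxE.
  apply: (le_trans (Hl l)); rewrite ler_wpM2l //.
  exact: le_trans (col_le_norm12 _ _) Xhs.
have O0 : (0 : R) <= theta1 * (s + delta) by rewrite mulr_ge0 // addr_ge0.
(* The error of all that the attention reads: theta (s + delta) from the MLP of [p0] and delta from
   its input, with theta <= 1. *)
pose xi := 2 * delta + theta * s.
have xi_rho : xi <= rho.
  by apply: le_trans rho_ge; rewrite lerD2l ler_piMl.
have close q (A : 'M[R]_(q, N)) (W : 'M[R]_(q, m)) : (q <= #|output_coord|)%N ->
    contractive W -> (forall i c, `|A i c - (W *m Xh) i c| <= theta1 * (s + delta)) ->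
    norm12 (A - W *m X) <= xi.
  move=> qO cW HA; apply: (le_trans (norm12_dist_add (W *m Xh) _ _)).
  have -> : xi = (theta * s + delta) + delta by rewrite /xi; ring.
  apply: lerD; last first.
    by rewrite -mulmxBr; apply: le_trans Xhd; exact: norm12_contractive.
  apply: (@le_trans _ _ (theta * (s + delta))); last first.
    by rewrite mulrDr lerD2l ler_piMl.
  rewrite /theta -mulrA; apply: norm12_le => [|c]; first by rewrite mulr_ge0.
  apply: (@le_trans _ _ (q%:R * (theta1 * (s + delta)))).
    apply: l2norm_le_entries => i; apply: le_trans (HA i c).
    by rewrite (_ : col c _ i 0 = A i c - (W *m Xh) i c) // !mxE.
  by rewrite ler_wpM2r // ler_nat.
have card_O : #|output_coord| = (m + m * jv + (r + r))%N.
  by rewrite !card_sum card_prod !card_ord.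
have mO : (m <= #|output_coord|)%N by rewrite card_O -addnA leq_addr.
have rO : (r <= #|output_coord|)%N by rewrite card_O addnA leq_addl.
have HX : norm12 (take_rows m_le_n Z - X) <= xi.
  have := close m (take_rows m_le_n Z) 1%:M; rewrite !mul1mx; apply.
  - by [].
  - exact: contractive1.
  - move=> i c; have := Zo (coordX i) c.
    by rewrite o_widen /= sum_delta [X in `|X - _| <= _ -> _](_ : _ = take_rows m_le_n Z
        i c) ?mxE.
(* A selected weight is at most 1, so undoing the division by it does not enlarge the error. *)
have scaled l c (v0 y : R) : 1 / 2 <= v0 <= 1 -> \sum_j F l j * Xh j c = y / v0 ->
    `|v0 * Z (o l) c - y| <= theta1 * (s + delta).
  move=> /selection_inv[v1 v2 _] Fy; have := Zo l c; rewrite Fy.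
  have -> : v0 * Z (o l) c - y = v0 * (Z (o l) c - y / v0) by field.
  by move=> H; rewrite normrM (le_trans _ H) // ler_piMl.
have div_sum (G : 'I_m -> R) v0 c : \sum_j G j / v0 * Xh j c = (\sum_j G j * Xh j c) / v0.
  by rewrite mulr_suml; apply: eq_bigr => j _; rewrite mulrAC.
have HU : norm12 (read_values P1 tv Z - U *m X) <= xi.
  apply: (close _ (read_values P1 tv Z) U) => //.
  move=> i c; rewrite [X in `|X - _|](_ : _ = W_V P1 (x i) (o (coordV i (tv i))) * Z (o
      (coordV i (tv i))) c);
    last by rewrite mxE.
  apply: scaled => //.
  by rewrite /= eqxx div_sum mxE.
have HK : norm12 (read_keys P1 tk Z - Kt *m X) <= xi.
  apply: (close _ (read_keys P1 tk Z) Kt) => //.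
  move=> k c; rewrite [X in `|X - _|](_ : _ = W_K P1 (row (k, tk k)) (o (coordK k)) * Z
      (o (coordK k)) c);
    last by rewrite mxE.
  apply: scaled; first by have [] := Htk k.
  by rewrite /= div_sum mxE.
have HQ : norm12 (read_queries P1 tk Z - Qt *m X) <= xi.
  apply: (close _ (read_queries P1 tk Z) Qt) => //.
  move=> k c; rewrite [X in `|X - _|](_ : _ = W_Q P1 (row (k, tk k)) (o (coordQ k)) * Z
      (o (coordQ k)) c);
    last by rewrite mxE.
  apply: scaled; first by have [] := Htk k.
  by rewrite /= div_sum mxE.
have X_rho : norm12 X <= rho by apply: (le_trans Xs); lra.
set lam := 1 + 2 / C * (1 + 12 * rho ^+ 2).
have HV c := attention_layer_dist C_gt0 m_le_n cV cK cQ KQ c X_rho xi_rho HX HU HK HQ.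
rewrite -/lam in HV.
set b := 1 + 2 / C.
have C2 : 0 <= 2 / C by rewrite divr_ge0 // ltW.
have b_lam : b <= lam.
  by rewrite lerD2l ler_peMr // lerDl mulr_ge0 // sqr_ge0.
have b0 : 0 <= b by rewrite addr_ge0.
have lam0 : 0 <= lam := le_trans b0 b_lam.
have xi0 : 0 <= xi by rewrite addr_ge0 // mulr_ge0.
have Ht : norm12 (layer_norm C 1 (attention t X) + X) <= b * s.
  have [_ Hb] := norm12_target_state C_gt0 cV KQ X.
  by apply: (le_trans Hb); rewrite ler_wpM2l.
have Hout : norm12 (layer C t X) <= b * s.
  have [_ Hb] := norm12_layer_target X.
  by apply: (le_trans Hb); rewrite ler_wpM2l.
pose G : 'M[R]_(m, N) := \matrix_(i, c)
  (W_out t *m relu (W_in t *m attended P1 tv tk Z c)) i 0.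
set Y2 := layer C p1 Z.
have att_s c : l2norm (attended P1 tv tk Z c) <= b * s + lam * xi.
  apply: (le_trans (l2norm_triangle _ (col c (layer_norm C 1 (attention t X) + X)))).
  apply: lerD; last exact: HV.
  exact: le_trans (col_le_norm12 _ _) Ht.
have Y2G : norm12 (Y2 - pad n G) <= theta * (b * s + lam * xi).
  rewrite /theta -mulrA; apply: entries_norm12.
  - by rewrite mulr_ge0 // addr_ge0 // mulr_ge0.
  - move=> l c; have [Hl _] := H1 N Z c.
    apply: le_trans (_ : theta1 * l2norm (attended P1 tv tk Z c) <= _);
        last by rewrite ler_wpM2l.
    apply: le_trans (Hl l); rewrite le_eqVlt; apply/orP; left; apply/eqP.
    by congr (`|_ - _|); rewrite /on_residual; case: l {Hl} => [[i|i]|i] //; rewrite mxE.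
  - by move=> i c; have [_] := H1 N Z c; exact.
have Y2d : norm12 (Y2 - pad n (layer C t X)) <= theta * (b * s) + 2 * (lam * xi).
  apply: (le_trans (norm12_dist_add (pad n G) _ _)).
  apply: (@le_trans _ _ (theta * (b * s + lam * xi) + lam * xi)).
    apply: lerD => //; apply: (le_trans (norm12_padB _ _)).
    apply: norm12_le => [|c]; first by rewrite mulr_ge0.
    have -> : col c (G - layer C t X) = W_out t *m
       (relu (W_in t *m attended P1 tv tk Z c) -
        relu (W_in t *m col c (layer_norm C 1 (attention t X) + X))).
      rewrite mulmxBr -col_layer_target raddfB /=; congr (_ - _).
      by apply/matrixP => i k; rewrite ord1 [LHS]mxE [LHS]mxE.
    apply: (le_trans (cO _)); apply: (le_trans (relu_dist _ _)).
    by rewrite -mulmxBr; apply: (le_trans (cI _)); exact: HV.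
  have : theta * (lam * xi) <= lam * xi by rewrite ler_piMl // mulr_ge0.
  by rewrite mulrDr; lra.
(* As theta <= 1, an identity layer at most doubles the distance d and adds theta times the bound b
   s on the target output. *)
have id_step (p' : large) (Y' : 'M[R]_(n, N)) d :
   (norm12 (layer C p' Y' - pad n (take_rows m_le_n Y')) <=
     theta * norm12 (take_rows m_le_n Y')) ->
   norm12 (Y' - pad n (layer C t X)) <= d ->
   norm12 (layer C p' Y' - pad n (layer C t X)) <= 2 * d + theta * (b * s).
  move=> Hp Hd.
  have Hd' : norm12 (take_rows m_le_n Y' - layer C t X) <= d.
    exact: le_trans (norm12_take_rows_dist m_le_n _ _) Hd.
  have d_ge0 : 0 <= d := le_trans (norm12_ge0 _) Hd.
  have Hs : norm12 (take_rows m_le_n Y') <= b * s + d.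
    by apply: (le_trans (norm12_triangle _ (layer C t X))); exact: lerD.
  apply: (le_trans (norm12_dist_add (pad n (take_rows m_le_n Y')) _ _)).
  apply: (@le_trans _ _ (theta * (b * s + d) + d)).
    apply: lerD; last exact: le_trans (norm12_padB _ _) Hd'.
    by apply: (le_trans Hp); rewrite ler_wpM2l.
  have : theta * d <= d by rewrite ler_piMl.
  by rewrite mulrDr; lra.
have S2 := id_step p2 Y2 _ (H2 _ Y2) Y2d.
have S3 := id_step p3 _ _ (H3 _ (layer C p2 Y2)) S2.
(* Origin of the factor 16 in [block_factor]: two identity layers turn 2 lam xi into 8 lam xi, and
   xi contains 2 delta. The terms in theta s add up to at most 15 lam theta s, since b <= lam. *)
apply: (le_trans S3).
have h1 : theta * (b * s) <= lam * (theta * s).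
  by rewrite mulrCA ler_wpM2r // mulr_ge0.
have h2 : 0 <= lam * (theta * s) by rewrite !mulr_ge0.
rewrite /block_factor -/lam /xi.
have -> : 2 * (2 * (theta * (b * s) + 2 * (lam * (2 * delta + theta * s))) +
   theta * (b * s)) + theta * (b * s) =
   7 * (theta * (b * s)) + 16 * (lam * delta) + 8 * (lam * (theta * s)) by ring.
have -> : 16 * lam * (delta + theta * s) = 16 * (lam * delta) + 16 * (lam * (theta * s))
    by ring.
by lra.
Qed.

End large_layers.

(** * The whole network *)

Section ordinal_folds.

(** Extends the family by the identity to all naturals, so that a prefix of the fold is a fold over
    [iota]. *)
Let step (A : Type) n (g : 'I_n -> A -> A) (k : nat) (y : A) : A :=
  if insub k is Some l then g l y else y.

Let stepE (A : Type) n (g : 'I_n -> A -> A) (k : 'I_n) y : step g k y = g k y.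
Proof. by rewrite /step valK. Qed.

Let foldl_step (A : Type) n (g : 'I_n -> A -> A) x :
  foldl (fun y k => g k y) x (enum 'I_n) = foldl (fun y k => step g k y) x (iota 0 n).
Proof.
rewrite -val_enum_ord; elim: (enum 'I_n) x => //= k s IHs x.
by rewrite stepE IHs.
Qed.

Lemma foldl_ord_ind2 (A B : Type) n (g : 'I_n -> A -> A) (g' : 'I_n -> B -> B)
    (rel : nat -> A -> B -> Prop) x x' :
  rel 0 x x' ->
  (forall (k : 'I_n) y y', rel k y y' -> rel k.+1 (g k y) (g' k y')) ->
  rel n (foldl (fun y k => g k y) x (enum 'I_n)) (foldl (fun y k => g' k y) x' (enum
      'I_n)).
Proof.
move=> rel0 relS; rewrite !foldl_step.
suff H k : (k <= n)%N -> rel k (foldl (fun y k => step g k y) x (iota 0 k))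
    (foldl (fun y k => step g' k y) x' (iota 0 k)) by exact: H.
elim: k => [|k IHk] kn; first by [].
have -> : iota 0 k.+1 = iota 0 k ++ [:: k] by rewrite -[in LHS]addn1 iotaD.
rewrite !foldl_cat /=.
by rewrite -[k]/(val (Ordinal kn)) !stepE; apply: relS; exact: IHk (ltnW kn).
Qed.

Lemma eq_foldl (A B : Type) (g g' : A -> B -> A) x s :
  (forall y z, g y z = g' y z) -> foldl g x s = foldl g' x s.
Proof. by move=> gg'; elim: s x => //= z s IHs x; rewrite gg' IHs. Qed.

Lemma block_index_proof L (l : 'I_L) (i : 'I_4) : (4 * l + i < 4 * L)%N.
Proof. by have := ltn_ord l; have := ltn_ord i; lia. Qed.
Definition block_index L (l : 'I_L) (i : 'I_4) : 'I_(4 * L) :=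
  Ordinal (block_index_proof l i).

Lemma block_quo_proof L (k : 'I_(4 * L)) : (k %/ 4 < L)%N.
Proof. by have := ltn_ord k; lia. Qed.
Definition block_quo L (k : 'I_(4 * L)) : 'I_L := Ordinal (block_quo_proof k).

Definition block_rem L (k : 'I_(4 * L)) : 'I_4 := Ordinal (ltn_pmod k (isT : (0 < 4)%N)).

Lemma block_indexK L (k : 'I_(4 * L)) : block_index (block_quo k) (block_rem k) = k.
Proof. by apply: val_inj => /=; rewrite mulnC -divn_eq. Qed.

Lemma block_quoE L (l : 'I_L) i : block_quo (block_index l i) = l.
Proof. by apply: val_inj => /=; have := ltn_ord i; lia. Qed.

Lemma block_remE L (l : 'I_L) i : block_rem (block_index l i) = i.
Proof. by apply: val_inj => /=; have := ltn_ord i; lia. Qed.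

Lemma foldl_blocks (A : Type) L (g : 'I_(4 * L) -> A -> A) x :
  foldl (fun y k => g k y) x (enum 'I_(4 * L)) =
  foldl (fun y l => foldl (fun y i => g (block_index l i) y) y (enum 'I_4)) x (enum 'I_L).
Proof.
pose g' l y := foldl (fun y i => g (block_index l i) y) y (enum 'I_4).
rewrite foldl_step; transitivity (foldl (fun y k => step g' k y) x (iota 0 L));
    last by rewrite -foldl_step.
suff H k : (k <= L)%N -> foldl (fun y k => step g k y) x (iota 0 (4 * k)) =
    foldl (fun y k => step g' k y) x (iota 0 k) by exact: H.
elim: k => [|k IHk] kL; first by [].
have -> : iota 0 k.+1 = iota 0 k ++ [:: k] by rewrite -[in LHS]addn1 iotaD.
have -> : iota 0 (4 * k.+1) = iota 0 (4 * k) ++ iota (4 * k) 4 by rewrite mulnS addnC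
    iotaD.
rewrite !foldl_cat.
rewrite IHk ?(ltnW kL) // [RHS]/= -[k in step g' k]/(val (Ordinal kL)) stepE /g'.
rewrite foldl_step; set y := foldl _ _ (iota 0 k).
have stepE' (i : nat) z : (i < 4)%N ->
    step (fun i => g (block_index (Ordinal kL) i)) i z = step g (4 * k + i) z.
  move=> i4; have -> : (4 * k + i)%N = val (block_index (Ordinal kL) (Ordinal i4)) by [].
  by rewrite stepE -[i in LHS]/(val (Ordinal i4)) stepE.
by rewrite /= !stepE' // addn0 addn1 addn2 addn3.
Qed.

End ordinal_folds.

(** The scores depend only on the product W_K^T W_Q. For m <= ma it is factored as the identity
    times itself, so that keys and queries take at most 2m coordinates of the embedding, however
    large [ma] is. *)
Lemma score_factor (R : realType) ma m (WK WQ : 'M[R]_(ma, m)) :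
  contractive WK -> contractive WQ ->
  exists Kt Qt : 'M[R]_(minn m ma, m),
    [/\ contractive Kt, contractive Qt & Kt^T *m Qt = WK^T *m WQ].
Proof.
move=> cK cQ; have [mma|mma] := leqP m ma.
- exists 1%:M, (WK^T *m WQ); split; first exact: contractive1.
    by apply: contractiveM => //; exact: contractive_tr.
  by rewrite trmx1 mul1mx.
- by exists WK, WQ.
Qed.

Section network.
Context {R : realType}.
Variables (C : R) (L m ma w n na v jv jk : nat) (K : finType).
Hypotheses (C_gt0 : 0 < C) (m_le_n : (m <= n)%N).

Local Notation r := (minn m ma).
Local Notation H := (hidden_unit m w).
Local Notation O := (output_coord m r jv).

Variables (e : 'I_m * K -> 'I_v) (h : H -> 'I_v) (f : H * K -> 'I_v)
  (o : O -> 'I_n) (row : 'I_r * 'I_jk -> 'I_na).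
Hypotheses (e_inj : injective e) (h_inj : injective h) (f_inj : injective f)
  (o_inj : injective o) (row_inj : injective row)
  (o_widen : forall i, o (inl (inl i)) = widen_ord m_le_n i).

Variables (eta eps : R).
Hypotheses (eta_ge0 : 0 <= eta) (eta_le1 : eta <= 1) (eps_le1 : eps <= 1).

Local Notation th := (theta m w r jv eta).
Local Notation Lam := (block_factor C (L + 3)%:R).

Hypotheses (th_le1 : th <= 1) (th_eps : th * (2 * Lam) ^+ L <= eps).

Variables (T : params R L m ma w 0) (W : params R (4 * L) n na v 2).
Hypotheses (T_ln : original_LN T) (T_le1 : weights_le1 T) (W_ln : forall k, ln_b (W k) =
    1).
Hypotheses (W_dense : forall k, layer_dense m_le_n e h f o eta (W k))
  (W_val : forall k, selects_values m_le_n o (W k))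
  (W_sco : forall k, selects_scores o row (W k)).

Lemma network_approx : exists T', pruning W T' /\
  forall N (X : 'M[R]_(m, N)), norm12 X <= 1 ->
    norm12 (transformer C T' (pad n X) - pad n (transformer C T X)) <= eps * norm12 X.
Proof.
have cT l : [/\ contractive (W_V (T l)), contractive (W_in (T l)) & contractive (W_out (T
    l))].
  by have [[_ _ ?] [? _ ?]] := T_le1 l; split; exact: spectral_norm_contractive.
have block l : exists p : 'I_4 -> layer_params R n na v 2,
    (forall i, layer_pruning (W (block_index l i)) (p i)) /\
    forall N (X : 'M[R]_(m, N)) (Y : 'M[R]_(n, N)) (delta s rho : R),
      norm12 X <= s -> norm12 (Y - pad n X) <= delta -> 2 * delta + s <= rho ->
      norm12 (foldl (fun Y i => layer C (p i) Y) Y (enum 'I_4) - pad n (layer C (T l) X))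
        <= block_factor C rho * (delta + th * s).
  have [cV cI cO] := cT l.
  have [[cK cQ _] _] := T_le1 l.
  have [Kt [Qt [cKt cQt KQ]]] := score_factor (spectral_norm_contractive cK)
    (spectral_norm_contractive cQ).
  pose P i := W (block_index l i).
  have [p0 [p1 [p2 [p3 [[q0 q1 q2 q3] Hp]]]]] :=
    block_approx C_gt0 e_inj h_inj f_inj o_inj row_inj o_widen eta_ge0 eta_le1
      (T_ln l) cV cI cO cKt cQt KQ (W_ln (block_index l (@Ordinal 4 1 isT)))
      (W_dense (block_index l (@Ordinal 4 0 isT)))
      (W_dense _) (W_dense (block_index l (@Ordinal 4 2 isT)))
      (W_dense (block_index l (@Ordinal 4 3 isT))) (W_val _) (W_sco _) th_le1.
  pose p (i : 'I_4) := match val i with 0 => p0 | 1 => p1 | 2 => p2 | _ => p3 end.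
  exists p; split.
    by move=> [[|[|[|[|//]]]] i4]; rewrite /p /=;
      [move: q0|move: q1|move: q2|move: q3]; congr layer_pruning; congr W; exact: val_inj.
  move=> N X Y delta s rho Xs Yd rho_ge.
  by rewrite !enum_ordSl /= (size0nil (size_enum_ord 0)) /=; exact: Hp Xs Yd rho_ge.
have /choice[p Hp] := block.
exists (fun k => p (block_quo k) (block_rem k)); split.
  move=> k; have [+ _] := Hp (block_quo k).
  by move=> /(_ (block_rem k)); rewrite block_indexK.
move=> N X X1; set s := norm12 X; have s0 : 0 <= s := norm12_ge0 _.
pose b := 1 + 2 / C.
have C2 : 0 <= 2 / C by rewrite divr_ge0 // ltW.
have b1 : 1 <= b by rewrite lerDl.
have b0 : 0 <= b := le_trans ler01 b1.
have bLam : b <= 2 * Lam.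
  rewrite /block_factor; set q := _ ^+ 2.
  have q0 : 0 <= q by exact: sqr_ge0.
  have : 2 / C <= 2 / C * (1 + 12 * q) by rewrite ler_peMr // lerDl mulr_ge0.
  by move: C2; rewrite /b; move: (2 / C) => c c0; move: (c * _) => D; lra.
have Lam1 : 1 <= 2 * Lam by exact: le_trans bLam.
have th0 : 0 <= th := theta_ge0 _ _ _ _ eta_ge0.
(* Linear growth bounds the radius [rho], geometric growth compares the new MLP errors with s. The
   guard [l <= L] gives access to [th_eps], which keeps the accumulated error at most 1. *)
pose rel (l : nat) (Y : 'M[R]_(n, N)) (X' : 'M[R]_(m, N)) := (l <= L)%N -> 
  [/\ norm12 X' <= s + l%:R, norm12 X' <= b ^+ l * s &
      norm12 (Y - pad n X') <= th * (2 * Lam) ^+ l * s].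
suff : rel L (transformer C (fun k => p (block_quo k) (block_rem k)) (pad n X))
    (transformer C T X).
  by move=> /(_ (leqnn L))[_ _] /le_trans; apply; rewrite ler_wpM2r.
have -> : transformer C (fun k => p (block_quo k) (block_rem k)) (pad n X) =
    foldl (fun Y l => foldl (fun Y i => layer C (p l i) Y) Y (enum 'I_4)) (pad n X) (enum
        'I_L).
  rewrite /transformer foldl_blocks; apply: eq_foldl => Y l; apply: eq_foldl => Y' i.
  by rewrite block_quoE block_remE.
rewrite /transformer; apply: (foldl_ord_ind2 (g := fun l Y => foldl (fun Y i => layer C
    (p l i) Y) Y (enum 'I_4)) (g' := fun l Y => layer C (T l) Y)).
  by split; rewrite ?addr0 ?expr0 ?mul1r ?subrr ?mulr1 // norm12_le // => [|j];
      rewrite ?mulr_ge0 // raddf0 l2norm0 mulr_ge0.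
move=> l Y X' IH lL; have [h1 h2 h3] := IH (ltnW lL).
have [cV cI cO] := cT l.
have [[cK cQ _] _] := T_le1 l.
have [t1 t2] := norm12_layer_target C_gt0 (T_ln l) cV cI cO
  (erefl ((W_K (T l))^T *m W_Q (T l))) X'.
split.
- by apply: (le_trans t1); rewrite -natr1 addrA lerD2r.
- by apply: (le_trans t2); rewrite exprS -mulrA ler_wpM2l.
have pow_le : th * (2 * Lam) ^+ l <= 1.
  apply: le_trans eps_le1; apply: le_trans th_eps; rewrite ler_wpM2l //.
  by rewrite ler_weXn2l // ltnW.
(* The left side is at most 2 + 1 + (L - 1), within the radius L + 3 at which [Lam] is taken. *)
have rho_ge : 2 * (th * (2 * Lam) ^+ l * s) + norm12 X' <= (L + 3)%:R.
  have d1 : th * (2 * Lam) ^+ l * s <= 1.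
    by apply: mulr_ile1 => //; rewrite mulr_ge0 // exprn_ge0 // (le_trans ler01).
  have lL' : l%:R + 1 <= L%:R :> R by rewrite natr1 ler_nat.
  by rewrite [X in _ <= X]natrD; have : s <= 1 := X1; lra.
have [_ /(_ _ _ _ _ _ _ (lexx _) h3 rho_ge)] := Hp l.
move=> /le_trans; apply.
have Lam0 : 0 <= Lam by lra.
(* The inherited and the new error both fit under th (2 Lam)^l s, because b <= 2 Lam; hence the
   factor 2 in front of [Lam]. *)
have -> : th * (2 * Lam) ^+ l.+1 * s =
   Lam * (th * (2 * Lam) ^+ l * s + th * ((2 * Lam) ^+ l * s)) by rewrite exprS; ring.
rewrite ler_wpM2l // lerD2l ler_wpM2l //; apply: (le_trans h2).
by rewrite ler_wpM2r // lerXn2r // nnegrE (le_trans ler01).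
Qed.

End network.

(** * Goodness of the random weights *)

Section random_weights.
Local Open Scope classical_set_scope.
Context {R : realType} {d : measure_display} {Omega : measurableType d}.
Variable P : probability Omega R.
Variables (M m w r n na v jv jk q b : nat).
Hypotheses (m_le_n : (m <= n)%N) (q_gt0 : (0 < q)%N).

Local Notation K := ('I_16 * 'I_b)%type.
Local Notation H := (hidden_unit m w).
Local Notation O := (output_coord m r jv).

Variables (e : 'I_m * K -> 'I_v) (h : H -> 'I_v) (f : H * K -> 'I_v)
  (o : O -> 'I_n) (row : 'I_r * 'I_jk -> 'I_na).
Hypotheses (e_inj : injective e) (f_inj : injective f)
  (o_inj : injective o) (row_inj : injective row).

Variables (xi : weight_index M n na v 2 -> {RV P >-> R}) (eta : R).
Hypotheses (xi_uniform : forall k, uniform_RV (xi k)) (xi_indep : independent_RVs xi).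
Hypothesis eta_ge : 16 * ((3 * b + 1)%:R / (4 * q)%:R) <= eta.

Let W omega := params_of_entries (fun k => xi k omega).
Let pS : R := 16 * ((31 / 32) ^+ b * (2 * q)%:R ^+ 2).

Let dense_in k s i j : fails_at_most P
  [set omega | subset_sum_dense eta
     (fun c => if s then W_in (W omega k) (e (j, c)) (widen_ord m_le_n j)
               else - W_in (W omega k) (e (j, c)) (widen_ord m_le_n j))
     (fun c => W_hid (W omega k) ord0 (h i) (e (j, c)))] pS.
Proof.
pose g (c : K * bool) : weight_index M n na v 2 :=
  if c.2 then IdxHid k ord0 (h i) (e (j, c.1)) else IdxIn k (e (j, c.1)) (widen_ord
      m_le_n j).
have g_inj : injective g by move=> [c []] [c' []] // [] /e_inj[->].
apply: fails_at_mostW (subset_sum_fails_at_most q_gt0 xi_uniform xi_indep s g_inj eta_ge)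
    => //.
move=> omega /= dense z z2; have [S HS] := dense z z2; exists S.
by under eq_bigr do rewrite !mxE.
Qed.

Let dense_out k l i : fails_at_most P
  [set omega | subset_sum_dense eta
     (fun c => W_hid (W omega k) ord_max (f (i, c)) (h i))
     (fun c => W_out (W omega k) (o l) (f (i, c)))] pS.
Proof.
pose g (c : K * bool) : weight_index M n na v 2 :=
  if c.2 then IdxOut k (o l) (f (i, c.1)) else IdxHid k ord_max (f (i, c.1)) (h i).
have g_inj : injective g by move=> [c []] [c' []] // [] /f_inj[->].
apply: fails_at_mostW (subset_sum_fails_at_most q_gt0 xi_uniform xi_indep true g_inj
    eta_ge) => //.
move=> omega /= dense z z2; have [S HS] := dense z z2; exists S.
by under eq_bigr do rewrite !mxE.
Qed.

Let select_value k i : fails_at_most P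
  [set omega | exists t, 1 / 2 <= W_V (W omega k) (widen_ord m_le_n i)
     (o (inl (inr (i, t)))) <= 1] ((3 / 4) ^+ jv).
Proof.
pose g (c : 'I_jv * unit) : weight_index M n na v 2 :=
  IdxV k (widen_ord m_le_n i) (o (inl (inr (i, c.1)))).
have g_inj : injective g by move=> [c []] [c' []] [] /o_inj[->].
have := selection_fails_at_most q_gt0 xi_uniform xi_indep g_inj.
rewrite card_unit expr1 card_ord => H1.
apply: (fails_at_mostW _ _ H1); last by have -> : 1 - 1 / 4 = 3 / 4 :> R by field.
by move=> omega [t /(_ tt)] Ht; exists t; rewrite !mxE.
Qed.

(** 15/16 is 1 - (1/4)^2: a candidate row needs a large weight in both matrices. *)
Let select_score k i : fails_at_most P
  [set omega | exists t,
     1 / 2 <= W_K (W omega k) (row (i, t)) (o (inr (inl i))) <= 1 /\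
     1 / 2 <= W_Q (W omega k) (row (i, t)) (o (inr (inr i))) <= 1] ((15 / 16) ^+ jk).
Proof.
pose g (c : 'I_jk * bool) : weight_index M n na v 2 :=
  if c.2 then IdxQ k (row (i, c.1)) (o (inr (inr i)))
  else IdxK k (row (i, c.1)) (o (inr (inl i))).
have g_inj : injective g by move=> [c []] [c' []] // [] /row_inj[->].
have := selection_fails_at_most q_gt0 xi_uniform xi_indep g_inj.
rewrite card_bool card_ord => H1.
apply: (fails_at_mostW _ _ H1);
    last by have -> : 1 - (1 / 4) ^+ 2 = 15 / 16 :> R by field.
by move=> omega [t Ht]; exists t; have := Ht false; have := Ht true; rewrite !mxE.
Qed.

Lemma random_weights_fail_at_most : fails_at_most P
  [set omega | forall k, [/\ layer_dense m_le_n e h f o eta (W omega k),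
     selects_values m_le_n o (W omega k) & selects_scores o row (W omega k)]]
  (M%:R * ((2 * #|H|%:R * m%:R + #|O|%:R * #|H|%:R) * pS + m%:R * (3 / 4) ^+ jv
     + r%:R * (15 / 16) ^+ jk)).
Proof.
have Hk (k : 'I_M) : fails_at_most P
    [set omega | [/\ layer_dense m_le_n e h f o eta (W omega k),
       selects_values m_le_n o (W omega k) & selects_scores o row (W omega k)]]
    ((2 * #|H|%:R * m%:R + #|O|%:R * #|H|%:R) * pS + m%:R * (3 / 4) ^+ jv
     + r%:R * (15 / 16) ^+ jk).
  have E1 := fails_at_most_forall (fun c : bool * H * 'I_m => dense_in k c.1.1 c.1.2 c.2).
  have E2 := fails_at_most_forall (fun c : O * H => dense_out k c.1 c.2).
  have E3 := fails_at_most_forall (select_value k).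
  have E4 := fails_at_most_forall (select_score k).
  apply: fails_at_mostW (fails_at_mostI (fails_at_mostI (fails_at_mostI E1 E2) E3) E4).
    move=> omega /= [[[h1 h2] h3] h4]; split => //.
    by split=> [s i j|l i]; [exact: (h1 (s, i, j)) | exact: (h2 (l, i))].
  have sumc (S : finType) (y : R) : \sum_(c : S) y = #|S|%:R * y.
    by rewrite sumr_const mulr_natl.
  by rewrite !sumc !card_prod card_bool !card_ord !natrM [in X in _ <= X]mulrDl.
have := fails_at_most_forall Hk; rewrite sumr_const card_ord.
by apply: fails_at_mostW => //; rewrite [M%:R * _]mulr_natl.
Qed.

End random_weights.

(** * Choice of the sizes *)

Lemma card_hidden_unit m w : #|hidden_unit m w| = (m + m + w)%N.
Proof. by rewrite !card_sum !card_ord. Qed.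

Lemma card_output_coord m r jv : #|output_coord m r jv| = (m + m * jv + (r + r))%N.
Proof. by rewrite !card_sum card_prod !card_ord. Qed.

Section size_parameters.
Context {R : realType}.

Lemma expR1_ge2 : 2 <= expR 1 :> R.
Proof. exact: (expR_ge1Dx (1 : R)). Qed.

Lemma expR_Olog (y : R) : 0 < y -> y <= expR (Olog y).
Proof. by move=> y0; rewrite -[X in X <= _]lnK ?posrE // ler_expR le_max lexx orbT. Qed.

Lemma Olog_ge1 (y : R) : 1 <= Olog y.
Proof. by rewrite le_max lexx. Qed.

Lemma le_Olog (y z : R) : 0 < y -> y <= z -> Olog y <= Olog z.
Proof.
move=> y0 yz; rewrite ge_max; apply/andP; split; first exact: Olog_ge1.
by rewrite le_max ler_ln ?posrE ?yz ?orbT // (lt_le_trans y0).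
Qed.

Lemma exp_decay (a : R) (k n : nat) (x : R) : 0 <= a <= 1 -> k%:R * x <= a * n%:R ->
  (1 - a) ^+ n <= expR (- x) ^+ k.
Proof.
move=> /andP[a0 a1] kx; apply: (@le_trans _ _ (expR (- a) ^+ n)).
  by rewrite lerXn2r ?nnegrE ?subr_ge0 ?expR_ge0 //; have := expR_ge1Dx (- a).
by rewrite -!expRM_natl ler_expR !mulrN lerN2 [n%:R * a]mulrC.
Qed.

(* The factor 12 leaves a third of the failure probability to each of three
   families of events. *)
Lemma selection_rate (a : R) (n : nat) (X x delta : R) :
  0 <= a <= 1 -> 5 * x <= a * n%:R -> 1 <= x -> 0 < delta -> X / delta <= expR x -> 0 <=
      X ->
  12 * X * (1 - a) ^+ n <= delta.
Proof.
move=> a01 ax x1 d0 HX X0; have := @exp_decay a 5 n x a01 ax.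
rewrite expRN; set E := expR x; rewrite -/E in HX *; move=> H.
have E2 : 2 <= E by apply: (le_trans expR1_ge2); rewrite ler_expR.
have E0 : 0 < E by lra.
apply: (@le_trans _ _ (12 * X * (E^-1) ^+ 5)); first by rewrite ler_wpM2l // mulr_ge0.
(* One of the five factors E pays for X / delta, the other four for 12 <= 2^4. *)
rewrite exprVn ler_pdivrMr ?exprn_gt0 // exprS.
rewrite ler_pdivrMr // in HX.
have E4 : 12 <= E ^+ 4.
  have : 2 ^+ 4 <= E ^+ 4 by rewrite lerXn2r ?nnegrE ?(ltW E0).
  by rewrite -natrX; apply: le_trans; rewrite ler_nat.
apply: (@le_trans _ _ (12 * (E * delta))); first by rewrite ler_wpM2l.
have -> : 12 * (E * delta) = E * delta * 12 by ring.
have -> : delta * (E * E ^+ 4) = E * delta * E ^+ 4 by ring.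
by rewrite ler_wpM2l // mulr_ge0 // ltW.
Qed.

Lemma nat_le_pow (E : R) (n k : nat) : 2 <= E -> (n <= 2 ^ k)%N -> n%:R <= E ^+ k.
Proof.
move=> E2 nk; apply: (@le_trans _ _ (2 ^+ k)); first by rewrite -natrX ler_nat.
by rewrite lerXn2r ?nnegrE //; lra.
Qed.

Lemma ceil_nat (x : R) : 0 <= x -> exists n : nat, x <= n%:R <= x + 1.
Proof.
move=> x0; have /andP[h1 h2] := truncn_itv x0; exists (Num.truncn x).+1.
by rewrite (ltW h2) /= -natr1 lerD2r.
Qed.

Lemma card_hidden_unit_le (E : R) m w : 2 <= E -> m%:R <= E -> w%:R <= E ->
  #|hidden_unit m w|%:R <= E ^+ 3.
Proof.
move=> E2 mE wE; have E0 : 0 < E by lra.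
rewrite card_hidden_unit !natrD; apply: (@le_trans _ _ (4 * E)); first by lra.
by rewrite [E ^+ 3]exprSr ler_pM2r //; apply: (@nat_le_pow _ 4).
Qed.

Lemma card_output_coord_le (E : R) m r jv :
  2 <= E -> m%:R <= E -> (r <= m)%N -> jv%:R <= 81 * E ->
  #|output_coord m r jv|%:R <= E ^+ 9.
Proof.
move=> E2 mE rm jvE; have E0 : 0 < E by lra.
rewrite card_output_coord !natrD natrM.
have rm' : r%:R <= m%:R :> R by rewrite ler_nat.
apply: (@le_trans _ _ (m%:R * (84 * E))).
  have : m%:R * 3 <= m%:R * (3 * E) by rewrite ler_wpM2l //; lra.
  have : m%:R * jv%:R <= m%:R * (81 * E) by rewrite ler_wpM2l.
  lra.
rewrite exprS ler_pM ?mulr_ge0 ?(ltW E0) // exprSr ler_pM2r //.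
exact: (@nat_le_pow _ 84).
Qed.

(** All quantities are measured in powers of E. Outputs, hidden units, the constant 5, m, the
    amplification and the scaled eta take the exponents 9, 3, 3, 1, k2 + 2 and j + 3; one more for
    1/eps gives 22 + k2 + j. *)
Lemma accuracy_bound (C_LN E eps : R) (L m w r b jv q k2 j : nat) :
  2 <= E -> m%:R <= E -> w%:R <= E -> (r <= m)%N -> jv%:R <= 81 * E -> eps^-1 <= E ->
  0 < eps -> (3 * b + 1)%:R <= E ^+ j.+1 -> E ^+ (22 + k2 + j) <= q%:R ->
  0 <= block_factor C_LN (L + 3)%:R ->
  (2 * block_factor C_LN (L + 3)%:R) ^+ L <= E ^+ (k2 + 2) ->
  theta m w r jv (16 * ((3 * b + 1)%:R / (4 * q)%:R)) *
    (2 * block_factor C_LN (L + 3)%:R) ^+ L <= eps.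
Proof.
move=> E2 mE wE rm jvE epsE eps0 bE qE Lam0 LamE.
have E0 : 0 < E by lra.
have q0 : 0 < q%:R :> R by apply: lt_le_trans qE; rewrite exprn_gt0.
have H_E := card_hidden_unit_le E2 mE wE.
have O_E := card_output_coord_le E2 mE rm jvE.
set eta := 16 * _.
have eta0 : 0 <= eta by rewrite mulr_ge0 // divr_ge0.
have eta_E : eta * E ^+ (22 + k2 + j) <= E ^+ (j + 3).
  apply: (@le_trans _ _ (eta * q%:R)); first by rewrite ler_wpM2l.
  have -> : eta * q%:R = 4 * (3 * b + 1)%:R by rewrite /eta !natrM; field; rewrite gt_eqF.
  rewrite addn3 -[j.+3]/(2 + j.+1)%N exprD ler_pM //.
  exact: (@nat_le_pow _ 4).
have E5 : 5 <= E ^+ 3 by exact: (@nat_le_pow _ 5).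
rewrite /theta; set Lam := (2 * _) ^+ L in LamE *.
have Lam_ge0 : 0 <= Lam by rewrite exprn_ge0 // mulr_ge0.
set nO : R := #|output_coord m r jv|%:R in O_E *.
set nH : R := #|hidden_unit m w|%:R in H_E *.
have pos k : 0 <= E ^+ k by rewrite exprn_ge0 // ltW.
have X_E : E ^+ (22 + k2 + j) =
    E * (E ^+ 9 * (E ^+ 3 * (E ^+ 3 * (E * (E ^+ (k2 + 2) * E ^+ (j + 3)))))).
  by rewrite -exprD -exprS -!exprD -exprS; congr (_ ^+ _); clear; lia.
have X0 : 0 < E ^+ (22 + k2 + j) by rewrite exprn_gt0.
move: (E ^+ (22 + k2 + j)) (E ^+ (k2 + 2)) (E ^+ (j + 3)) X_E X0 eta_E LamE (pos (j +
    3)%N)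
  => X Y Z X_E X0 eta_E LamE Z0.
have main : nO * (nH * (5 * eta * m%:R)) * Lam * X <=
    E ^+ 9 * (E ^+ 3 * (E ^+ 3 * (E * (Y * Z)))).
  have -> : nO * (nH * (5 * eta * m%:R)) * Lam * X =
    nO * (nH * (5 * (m%:R * (Lam * (eta * X))))) by ring.
  have eX : 0 <= eta * X by rewrite mulr_ge0 // ltW.
  have e1 := ler_pM Lam_ge0 eX LamE eta_E.
  have e1' := mulr_ge0 Lam_ge0 eX.
  have e2 := ler_pM (ler0n R m) e1' mE e1.
  have e2' := mulr_ge0 (ler0n R m) e1'.
  have e3 := ler_pM (ler0n R 5) e2' E5 e2.
  have e3' := mulr_ge0 (ler0n R 5) e2'.
  have e4 := ler_pM (ler0n R #|hidden_unit m w|) e3' H_E e3.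
  have e4' := mulr_ge0 (ler0n R #|hidden_unit m w|) e3'.
  exact: (ler_pM (ler0n R #|output_coord m r jv|) e4' O_E e4).
rewrite -(ler_pM2r X0); apply: (le_trans main).
have epsE1 : 1 <= eps * E by rewrite -ler_pdivrMl // mulr1.
rewrite X_E [eps * _]mulrA ler_peMl //.
by rewrite !mulr_ge0 ?pos ?(ltW E0) // (le_trans Lam_ge0).
Qed.

(** 12 L, the number of events, 16 (2q)^2 and 1/delta take the exponents 5, 13, 2 k0 + 8 and 1; the
    sum 2 k0 + 27 stays below the exponent 2 k0 + 30 of the decay. *)
Lemma failure_bound (E delta : R) (L m w r b jv q k0 : nat) :
  2 <= E -> m%:R <= E -> w%:R <= E -> L%:R <= E -> (r <= m)%N -> jv%:R <= 81 * E ->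
  delta^-1 <= E -> 0 < delta -> q%:R <= E ^+ k0.+1 ->
  (31 / 32) ^+ b <= (E ^+ (2 * k0 + 30))^-1 ->
  12 * L%:R * ((2 * #|hidden_unit m w|%:R * m%:R +
     #|output_coord m r jv|%:R * #|hidden_unit m w|%:R) *
     (16 * ((31 / 32) ^+ b * (2 * q)%:R ^+ 2))) <= delta.
Proof.
move=> E2 mE wE LE rm jvE dE d0 qE bE.
have E0 : 0 < E by lra.
have H_E := card_hidden_unit_le E2 mE wE.
have O_E := card_output_coord_le E2 mE rm jvE.
set nO : R := #|output_coord m r jv|%:R in O_E *.
set nH : R := #|hidden_unit m w|%:R in H_E *.
have cnt : 2 * nH * m%:R + nO * nH <= E ^+ 13.
  have h1 : nO * nH <= E ^+ 12 by rewrite -[12%N]/(9 + 3)%N exprD ler_pM.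
  have h2 : 2 * nH * m%:R <= E ^+ 5.
    by rewrite -[5%N]/(1 + 3 + 1)%N !exprD !expr1 ler_pM // ?mulr_ge0 // ler_pM.
  have h3 : E ^+ 5 <= E ^+ 12 by rewrite ler_weXn2l //; lra.
  have h4 : 2 * E ^+ 12 <= E ^+ 13 by rewrite [E ^+ 13]exprS ler_pM2r ?exprn_gt0.
  lra.
have L12 : 12 * L%:R <= E ^+ 5.
  by rewrite exprSr ler_pM //; apply: (@nat_le_pow _ 12).
have q2 : 16 * (2 * q)%:R ^+ 2 <= E ^+ (2 * k0 + 8).
  have -> : 16 * (2 * q)%:R ^+ 2 = 64 * (q%:R * q%:R) :> R by rewrite natrM; ring.
  have -> : (2 * k0 + 8 = 6 + (k0.+1 + k0.+1))%N by clear; lia.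
  rewrite exprD ler_pM ?mulr_ge0 //; first exact: (@nat_le_pow _ 64).
  by rewrite exprD ler_pM.
rewrite -(ler_pM2r (_ : 0 < E)) //; apply: (@le_trans _ _ 1); last first.
  by rewrite -ler_pdivrMl // mulr1.
have -> : 12 * L%:R * ((2 * nH * m%:R + nO * nH) *
     (16 * ((31 / 32) ^+ b * (2 * q)%:R ^+ 2))) * E =
  (31 / 32) ^+ b * (12 * L%:R * ((2 * nH * m%:R + nO * nH) *
     (16 * (2 * q)%:R ^+ 2 * E))) by ring.
apply: (@le_trans _ _ ((E ^+ (2 * k0 + 30))^-1 *
   (E ^+ 5 * (E ^+ 13 * (E ^+ (2 * k0 + 8) * E))))).
  have p0 : 0 <= (31 / 32 : R) ^+ b by rewrite exprn_ge0.
  apply: ler_pM => //; first by rewrite !(mulr_ge0, addr_ge0) ?exprn_ge0 ?(ltW E0).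
  apply: ler_pM; rewrite ?mulr_ge0 ?addr_ge0 ?mulr_ge0 ?exprn_ge0 ?(ltW E0) //.
  apply: ler_pM; rewrite ?mulr_ge0 ?addr_ge0 ?mulr_ge0 ?exprn_ge0 ?(ltW E0) //.
  by rewrite ler_pM2r.
have -> : E ^+ 5 * (E ^+ 13 * (E ^+ (2 * k0 + 8) * E)) = E ^+ (2 * k0 + 27).
  by rewrite -exprSr -!exprD; congr (_ ^+ _); clear; lia.
rewrite ler_pdivrMl ?exprn_gt0 // mulr1 ler_weXn2l ?leq_add2l //.
by apply: le_trans E2; rewrite ler1n.
Qed.

End size_parameters.

(** * Existence of admissible sizes *)

Section parameter_choice.
Context {R : realType}.

(** Both 2^L and L^L are at most exp (L lam): this is how the factor L log of the widths pays for an
    L-fold amplification. 193 = 1 + 12 * 16 comes from (L + 3)^2 <= 16 L^2, and 32 is twice the 16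
    of [block_factor]. *)
Lemma block_factor_pow (C_LN lam : R) (L k2 : nat) : 0 < C_LN -> (0 < L)%N ->
  32 * (1 + 2 / C_LN * 193) <= 2 ^+ k2 -> 1 <= lam -> L%:R <= expR lam ->
  0 <= block_factor C_LN (L + 3)%:R /\
  (2 * block_factor C_LN (L + 3)%:R) ^+ L <= expR (L%:R * lam) ^+ (k2 + 2).
Proof.
move=> C0 L0 kE lam1 Le; rewrite /block_factor natrD.
have L1 : 1 <= L%:R :> R by rewrite ler1n.
have c0 : 0 <= 2 / C_LN by rewrite divr_ge0 // ltW.
set c := 2 / C_LN in kE c0 *; set l : R := L%:R in L1 Le *.
have F0 : 0 <= 1 + c * (1 + 12 * (l + 3) ^+ 2).
  by rewrite addr_ge0 // mulr_ge0 // addr_ge0 // mulr_ge0 // sqr_ge0.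
split; first by rewrite mulr_ge0.
have l2 : 1 <= l ^+ 2 by rewrite exprn_ege1.
have Fle : 2 * (16 * (1 + c * (1 + 12 * (l + 3) ^+ 2))) <= 2 ^+ k2 * l ^+ 2.
  apply: (@le_trans _ _ (32 * (1 + c * 193) * l ^+ 2)); last first.
    by rewrite ler_wpM2r // sqr_ge0.
  have h1 : 1 + 12 * (l + 3) ^+ 2 <= 193 * l ^+ 2.
    have : (l + 3) ^+ 2 <= 16 * l ^+ 2.
      have -> : 16 * l ^+ 2 = (4 * l) ^+ 2 by ring.
      by rewrite lerXn2r ?nnegrE //; lra.
    lra.
  have := ler_wpM2l c0 h1; set d := c * (1 + _) => h2.
  have -> : 32 * (1 + c * 193) * l ^+ 2 = 32 * (l ^+ 2 + c * (193 * l ^+ 2)) by ring.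
  lra.
have F0' : 0 <= 2 * (16 * (1 + c * (1 + 12 * (l + 3) ^+ 2))) by rewrite !mulr_ge0.
apply: (@le_trans _ _ ((2 ^+ k2 * l ^+ 2) ^+ L));
    first by rewrite lerXn2r ?nnegrE // mulr_ge0 ?exprn_ge0 //; lra.
have E2 : 2 ^+ L <= expR (l * lam).
  apply: (@le_trans _ _ (expR 1 ^+ L)).
    by rewrite lerXn2r ?nnegrE ?expR_ge0 // expR1_ge2.
  by rewrite -expRM_natl mulr1 ler_expR ler_peMr //; lra.
have El : l ^+ L <= expR (l * lam).
  by rewrite expRM_natl lerXn2r ?nnegrE ?expR_ge0 //; lra.
rewrite exprMn -!exprM [(k2 * L)%N]mulnC [(2 * L)%N]mulnC !exprM exprD.
have l0 : 0 <= l by lra.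
by apply: ler_pM; rewrite ?exprn_ge0 // lerXn2r ?nnegrE ?expR_ge0 ?exprn_ge0.
Qed.

Lemma le_natr_div (k n : nat) (c e : R) : (k <= n)%N -> 0 < e -> e <= c ->
  k%:R / c <= n%:R / e.
Proof.
move=> kn e0 ec; apply: ler_pM => //; first by rewrite invr_ge0; lra.
  by rewrite ler_nat.
by rewrite lef_pV2 ?posrE //; lra.
Qed.

Lemma embedding_size (c l : R) (m r jv n : nat) : (r <= m)%N -> 0 <= c -> 1 <= l ->
  jv%:R <= 80 * l + 1 -> (48 * (c + 1) + 100) * (m%:R * l) <= n%:R ->
  (m + m * jv + (r + r) <= n)%N.
Proof.
move=> rm c0 l1 jvl; rewrite -(ler_nat R); apply: le_trans; rewrite !natrD natrM.
have rm' : r%:R <= m%:R :> R by rewrite ler_nat.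
have h1 : m%:R * jv%:R <= m%:R * (81 * l) by rewrite ler_wpM2l //; lra.
have h2 : m%:R <= m%:R * l by rewrite ler_peMr.
have h3 : 0 <= c * (m%:R * l) by rewrite !mulr_ge0 //; lra.
have h4 : 0 <= m%:R :> R by [].
lra.
Qed.

Lemma attention_size (c l : R) (ma L r jk n : nat) : (r <= ma)%N -> (0 < L)%N -> 0 <= c ->
  1 <= l -> jk%:R <= 80 * l + 1 -> (48 * (c + 1) + 100) * ((ma * L)%:R * l) <= n%:R ->
  (r * jk <= n)%N.
Proof.
move=> rm L0 c0 l1 jkl; rewrite -(ler_nat R); apply: le_trans; rewrite !natrM.
have L1 : 1 <= L%:R :> R by rewrite ler1n.
have h1 : r%:R * jk%:R <= ma%:R * (81 * l) by rewrite ler_pM ?ler_nat //; lra.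
have h2 : ma%:R * l <= ma%:R * L%:R * l by rewrite ler_wpM2r ?ler_peMr //; lra.
have h3 : 0 <= c * (ma%:R * L%:R * l) by rewrite !mulr_ge0 //; lra.
have h4 : 0 <= ma%:R * L%:R * l by rewrite !mulr_ge0 //; lra.
lra.
Qed.

Lemma hidden_size (c l : R) (m w L b n : nat) : 0 <= c -> 1 <= l ->
  b%:R <= (c + 1) * (L%:R * l) ->
  (48 * (c + 1) + 100) * ((maxn m w * L)%:R * l) <= n%:R ->
  ((m + m + w) * (16 * b) <= n)%N.
Proof.
move=> c0 l1 bl; rewrite -(ler_nat R); apply: le_trans.
rewrite natrM [(16 * b)%:R]natrM [(maxn _ _ * L)%:R]natrM.
have h1 : (m + m + w)%:R <= 3 * (maxn m w)%:R :> R by rewrite -natrM ler_nat; lia.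
apply: (@le_trans _ _ (3 * (maxn m w)%:R * (16 * ((c + 1) * (L%:R * l))))).
  by rewrite ler_pM // ?mulr_ge0 // ler_wpM2l.
have h3 : 0 <= (maxn m w)%:R * L%:R * l by rewrite !mulr_ge0 //; lra.
have -> : 3 * (maxn m w)%:R * (16 * ((c + 1) * (L%:R * l))) =
  48 * (c + 1) * ((maxn m w)%:R * L%:R * l) by ring.
by rewrite ler_wpM2r //; lra.
Qed.

Lemma parameters_exist (C_LN : R) : 0 < C_LN -> exists2 C : R, 0 < C &
  forall (L m ma w N : nat) (delta eps : R),
    (0 < L)%N -> (0 < m)%N -> (0 < ma)%N -> (0 < w)%N -> (0 < N)%N ->
    0 < delta < 1 -> 0 < eps <= 1 ->
  forall mL maL wL : nat,
    C * (m%:R * Olog ((L * m)%:R / delta)) <= mL%:R ->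
    C * ((ma * L)%:R * Olog ((ma * m * L * N)%:R / (eps * delta))) <= maL%:R ->
    C * ((maxn m w * L)%:R * Olog ((w * m * L * N)%:R / (eps * delta))) <= wL%:R ->
  exists jv jk b q : nat,
    [/\ (0 < q)%N, (0 < b)%N, (m + m * jv + (minn m ma + minn m ma) <= mL)%N,
        (minn m ma * jk <= maL)%N & ((m + m + w) * (16 * b) <= wL)%N] /\
    [/\ theta m w (minn m ma) jv (16 * ((3 * b + 1)%:R / (4 * q)%:R)) *
          (2 * block_factor C_LN (L + 3)%:R) ^+ L <= eps,
        0 <= block_factor C_LN (L + 3)%:R &
        (4 * L)%:R * ((2 * #|hidden_unit m w|%:R * m%:R +
           #|output_coord m (minn m ma) jv|%:R * #|hidden_unit m w|%:R) *
           (16 * ((31 / 32) ^+ b * (2 * q)%:R ^+ 2))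
         + m%:R * (3 / 4) ^+ jv + (minn m ma)%:R * (15 / 16) ^+ jk) <= delta].
Proof.
move=> C0.
have [k2 Hk2] : exists k2, 32 * (1 + 2 / C_LN * 193) <= 2 ^+ k2 :> R.
  have c0 : 0 <= 32 * (1 + 2 / C_LN * 193) :> R.
    apply: mulr_ge0 => //; apply: addr_ge0 => //; apply: mulr_ge0; last exact: ler0n.
    by rewrite divr_ge0 // ltW.
  have [k /andP[Hk _]] := ceil_nat c0; exists k; apply: (le_trans Hk).
  by rewrite -natrX ler_nat ltnW // ltn_expl.
(* [k0] is the exponent of the grid size [q], and [E ^+ j.+1] bounds 3b + 1. The failure bound
   requires b of order 32 n1 log E, where 1/32 is the decay rate and n1 is linear in j. The circle
   closes because 3 c2 + 4 is linear in j while 2^j is exponential. *)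
pose j := (15 + k2)%N; pose k0 := (22 + k2 + j)%N; pose n1 := (2 * k0 + 30)%N.
pose c2 := (32 * n1)%N.
have c2j : (3 * c2 + 4 <= 2 ^ j)%N.
  have n1_le : (n1 <= 2 ^ 7 * 2 ^ k2)%N.
    have : (k2 < 2 ^ k2)%N by exact: ltn_expl.
    have -> : (2 ^ 7 = 128)%N by [].
    by rewrite /n1 /k0 /j; lia.
  have -> : (2 ^ j = 2 ^ 7 * (2 * (2 ^ 7 * 2 ^ k2)))%N by rewrite -expnD -expnS -expnD.
  have E7 : (2 ^ 7 = 128)%N by []. rewrite E7 in n1_le *.
  have n1_ge : (30 <= n1)%N by rewrite /n1 leq_addl.
  by rewrite /c2; clear c2; move: n1 (2 ^ k2)%N n1_le n1_ge; clear; move=> a x; lia.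
have c2E : c2 = (32 * n1)%N by [].
have c2_pos : (0 < c2)%N by rewrite c2E muln_gt0 /n1 addn_gt0 orbT.
clearbody c2.
(* 48 = 3 * 16 since there are at most 3 max(m, w) hidden units with 16 b neurons each; 100 covers
   the 84 needed by the embedding and the 81 needed by the attention. *)
exists (48 * (c2%:R + 1) + 100); first by have : 0 <= c2%:R :> R by []; lra.
move=> L m ma w N delta eps L0 m0 ma0 w0 N0 /andP[d0 d1] /andP[e0 e1] mL maL wL.
set r := minn m ma; set mx := maxn m w.
set l1 := Olog ((L * m)%:R / delta); set l2 := Olog ((ma * m * L * N)%:R / (eps * delta)).
set l3 := Olog ((w * m * L * N)%:R / (eps * delta)).
move=> HmL HmaL HwL.
have ed0 : 0 < eps * delta by rewrite mulr_gt0.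
have ed_d : eps * delta <= delta by rewrite ler_piMl // ltW.
have ed_e : eps * delta <= eps by rewrite ler_piMr // ltW.
have ed1 : eps * delta <= 1 by apply: (le_trans ed_d); exact: ltW.
have l1_1 : 1 <= l1 := Olog_ge1 _.
have l2_1 : 1 <= l2 := Olog_ge1 _.
have l3_1 : 1 <= l3 := Olog_ge1 _.
have Lr : 1 <= L%:R :> R by rewrite ler1n.
pose x3 := L%:R * l3; have x3_l3 : l3 <= x3 by rewrite ler_peMl //; lra.
have x3_1 : 1 <= x3 by exact: le_trans x3_l3.
have c2_0 : 0 <= c2%:R :> R by [].
have [b /andP[b1 b2]] : exists n : nat, c2%:R * x3 <= n%:R <= c2%:R * x3 + 1.
  by apply: ceil_nat; rewrite mulr_ge0 //; lra.
(* 80 = 5 * 16 meets the requirement of [selection_rate] at rate 1/16, that of the scores, and with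
   room to spare at rate 1/4, that of the values. *)
have [jv /andP[jv1 jv2]] : exists n : nat, 80 * l1 <= n%:R <= 80 * l1 + 1.
  by apply: ceil_nat; lra.
have [jk /andP[jk1 jk2]] : exists n : nat, 80 * l2 <= n%:R <= 80 * l2 + 1.
  by apply: ceil_nat; lra.
pose E := expR x3.
have E2 : 2 <= E by apply: (le_trans expR1_ge2); rewrite ler_expR.
have E0 : 0 < E by lra.
have [q /andP[q1 q2]] : exists n : nat, E ^+ k0 <= n%:R <= E ^+ k0 + 1.
  by apply: ceil_nat; rewrite exprn_ge0 // ltW.
have Ek0 : 1 <= E ^+ k0 by rewrite exprn_ege1 //; lra.
have q_gt0 : (0 < q)%N by rewrite -(ltr_nat R); lra.
have b_gt0 : (0 < b)%N.
  have c2_gt0 : 0 < c2%:R :> R by rewrite ltr0n.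
  by rewrite -(ltr_nat R); apply: lt_le_trans b1; apply: mulr_gt0 => //; lra.
have qE : q%:R <= E ^+ k0.+1.
  apply: (le_trans q2); rewrite exprS; apply: (@le_trans _ _ (2 * E ^+ k0)); first by lra.
  by rewrite ler_wpM2r //; lra.
have y_E : (w * m * L * N)%:R / (eps * delta) <= expR l3.
  apply: expR_Olog; rewrite divr_gt0 // ltr0n !muln_gt0 w0 m0 L0 N0 //.
have eE : expR l3 <= E by rewrite ler_expR.
have prod_ge (k : nat) : (k <= w * m * L * N)%N -> k%:R <= expR l3.
  move=> kn; apply: le_trans y_E; rewrite -[k%:R]divr1.
  exact: le_natr_div.
have mE : m%:R <= E.
  apply: le_trans eE; apply: prod_ge; rewrite -!mulnA mulnCA leq_pmulr //.
  by rewrite !muln_gt0 w0 L0 N0.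
have wE : w%:R <= E.
  by apply: le_trans eE; apply: prod_ge; rewrite -!mulnA leq_pmulr // !muln_gt0 m0 L0 N0.
have LE : L%:R <= expR l3.
  by apply: prod_ge; rewrite -mulnA mulnCA leq_pmulr // !muln_gt0 w0 m0 N0.
have n0 : (1 <= w * m * L * N)%N by rewrite !muln_gt0 w0 m0 L0 N0.
have epsE : eps^-1 <= E.
  apply: le_trans eE; apply: le_trans y_E; rewrite -[eps^-1]mul1r.
  exact: (@le_natr_div 1).
have dE : delta^-1 <= E.
  apply: le_trans eE; apply: le_trans y_E; rewrite -[delta^-1]mul1r.
  exact: (@le_natr_div 1).
have l1_l3 : l1 <= l3.
  apply: le_Olog; first by rewrite divr_gt0 // ltr0n muln_gt0 L0 m0.
  apply: le_natr_div => //; rewrite -[(w * m * L)%N]mulnA [(m * L)%N]mulnC mulnAC.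
  by rewrite leq_pmull // muln_gt0 w0 N0.
have l3_E : l3 <= E.
  by have := expR_ge1Dx x3; rewrite -/E; lra.
have x3_E : x3 <= E by have := expR_ge1Dx x3; rewrite -/E; lra.
have jvE : jv%:R <= 81 * E by lra.
have rm : (r <= m)%N by exact: geq_minl.
have rma : (r <= ma)%N by exact: geq_minr.
have b3 : b%:R <= (c2%:R + 1) * x3 by lra.
exists jv, jk, b, q; split.
  split => //.
  - exact: embedding_size HmL.
  - exact: attention_size HmaL.
  - exact: hidden_size HwL.
have [Lam0 LamE] := block_factor_pow C0 L0 Hk2 l3_1 LE.
split => //.
- apply: (accuracy_bound (E := E) (k2 := k2) (j := j)) => //.
  rewrite exprSr; apply: (@le_trans _ _ ((3 * c2 + 4)%:R * x3)).
    by rewrite (natrD _ (3 * b)) (natrD _ (3 * c2)) !natrM; move: b3 x3_1; clear; lra.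
  by apply: ler_pM => //; [lra | exact: nat_le_pow].
- have LE' : L%:R <= E by exact: le_trans eE.
  have decay : (31 / 32) ^+ b <= (E ^+ (2 * k0 + 30))^-1.
    have -> : 31 / 32 = 1 - 1 / 32 :> R by field.
    have := @exp_decay R (1 / 32) (2 * k0 + 30) b x3.
    rewrite expRN -/E exprVn; apply; first by lra.
    by move: b1; rewrite c2E natrM -/n1; lra.
  have f1 := failure_bound E2 mE wE LE' rm jvE dE d0 qE decay.
  have f2 : 12 * (L * m)%:R * (1 - 1 / 4) ^+ jv <= delta.
    apply: (selection_rate (x := l1)) => //; [by clear; lra | by move: jv1 l1_1; clear;
        lra |].
    by apply: expR_Olog; rewrite divr_gt0 // ltr0n muln_gt0 L0 m0.
  have f3 : 12 * (L * r)%:R * (1 - 1 / 16) ^+ jk <= delta.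
    apply: (selection_rate (x := l2)) => //; [by clear; lra | by move: jk1 l2_1; clear;
        lra |].
    apply: (@le_trans _ _ ((ma * m * L * N)%:R / (eps * delta))).
      apply: le_natr_div => //; apply: (@leq_trans (L * m));
          first by rewrite leq_mul2l rm orbT.
      rewrite -[(ma * m * L)%N]mulnA [(m * L)%N]mulnC mulnAC.
      by rewrite leq_pmull // muln_gt0 ma0 N0.
    by apply: expR_Olog; rewrite divr_gt0 // ltr0n !muln_gt0 ma0 m0 L0 N0.
  move: f1 f2 f3.
  have -> : 1 - 1 / 4 = 3 / 4 :> R by field.
  have -> : 1 - 1 / 16 = 15 / 16 :> R by field.
  rewrite !natrM; set A := (_ + _) * _; set u := _ ^+ jv; set v := _ ^+ jk.
  move=> f1 f2 f3.
  have -> : 4 * L%:R * (A + m%:R * u + r%:R * v) =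
    (12 * L%:R * A + 12 * (L%:R * m%:R) * u + 12 * (L%:R * r%:R) * v) / 3 by field.
  by move: f1 f2 f3; clear; lra.
Qed.

End parameter_choice.

(** * Placement of the units and assembly of the theorem *)

Lemma ord_embedding (T : finType) n : (#|T| <= n)%N -> exists f : T -> 'I_n, injective f.
Proof.
move=> Tn; exists (fun t => widen_ord Tn (enum_rank t)).
by move=> t u /(congr1 val) /= /val_inj /enum_rank_inj.
Qed.

(** Zero padding dictates the position of the residual coordinates; all others are placed after the
    first m. *)
Lemma output_embedding m r jv n (m_le_n : (m <= n)%N) :
  (m + m * jv + (r + r) <= n)%N ->
  exists o : output_coord m r jv -> 'I_n, injective o /\
    forall i, o (inl (inl i)) = widen_ord m_le_n i.
Proof.
move=> size_n; pose S : finType := ('I_m * 'I_jv + ('I_r + 'I_r))%type.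
have [f f_inj] : exists f : S -> 'I_(n - m), injective f.
  by apply: ord_embedding; rewrite !card_sum card_prod !card_ord; lia.
have fP s : (m + f s < n)%N by have := ltn_ord (f s); lia.
pose g s : 'I_n := Ordinal (fP s).
have g_inj : injective g by move=> s s' [] /addnI /val_inj /f_inj.
have gm s i : g s <> widen_ord m_le_n i.
  by move=> /(congr1 val) /= H; have := ltn_ord i; lia.
exists (fun l => match l with
  | inl (inl i) => widen_ord m_le_n i | inl (inr p) => g (inl p) | inr k => g (inr k)
      end).
split=> // -[[i|p]|k] [[i'|p']|k'] //.
- by move=> /(congr1 val) /= /val_inj ->.
- by move=> /esym /gm.
- by move=> /esym /gm.
- by move=> /gm.
- by move=> /g_inj [->].
- by move=> /g_inj.
- by move=> /gm.
- by move=> /g_inj.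
- by move=> /g_inj [->].
Qed.

Lemma block_factor_ge1 (R : realType) (C rho : R) : 0 < C -> 1 <= block_factor C rho.
Proof.
move=> C0; rewrite /block_factor; set D := 2 / C * _.
have D0 : 0 <= D.
  by apply: mulr_ge0; [rewrite divr_ge0 // ltW | rewrite addr_ge0 // mulr_ge0 // sqr_ge0].
by lra.
Qed.

Local Open Scope classical_set_scope.
Local Open Scope ring_scope.

Theorem theorem3 (R : realType) (C_LN : R) (hC_LN : 0 < C_LN) :
  exists2 C : R, 0 < C &
  forall (L m ma w N : nat) (delta eps : R),
    (0 < L)%N -> (0 < m)%N -> (0 < ma)%N -> (0 < w)%N -> (0 < N)%N ->
    0 < delta < 1 -> 0 < eps ->
  (* epsilon is capped at 1 in the size bounds only: for large epsilon the
     argument of the logarithm would drop below 1 *)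
  let eps1 := Num.min eps 1 in
  forall mL maL wL : nat,
    C * (m%:R * Olog ((L * m)%:R / delta)) <= mL%:R ->
    C * ((ma * L)%:R * Olog ((ma * m * L * N)%:R / (eps1 * delta))) <= maL%:R ->
    C * ((maxn m w * L)%:R * Olog ((w * m * L * N)%:R / (eps1 * delta)))
      <= wL%:R ->
  forall T : params R L m ma w 0,
    original_LN T -> weights_le1 T ->
  forall (d : measure_display) (Omega : measurableType d)
    (P : probability Omega R)
    (xi : weight_index (4 * L) mL maL wL 2 -> {RV P >-> R}),
    (forall k, uniform_RV (xi k)) -> independent_RVs xi ->
  with_prob_ge P
    [set omega | exists T' : params R (4 * L) mL maL wL 2,
       pruning (params_of_entries (fun k => xi k omega)) T' /\
       forall X : 'M[R]_(m, N), norm12 X <= 1 ->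
         norm12 (transformer C_LN T' (pad mL X) - pad mL (transformer C_LN T X))
           <= eps * norm12 X]
    (1 - delta).
Proof.
have [C C0 HC] := parameters_exist hC_LN; exists C => //.
move=> L m ma w N delta eps L0 m0 ma0 w0 N0 d01 e0 eps1 mL maL wL HmL HmaL HwL.
move=> T T_ln T_le1 d Omega P xi xi_unif xi_indep.
have eps1_01 : 0 < eps1 <= 1 by rewrite lt_min e0 ltr01 /= ge_min lexx orbT.
have [jv [jk [b [q [[q0 b0 smL smaL swL] [acc _ fail]]]]]] :=
  HC L m ma w N delta eps1 L0 m0 ma0 w0 N0 d01 eps1_01 mL maL wL HmL HmaL HwL.
set eta := 16 * _ in acc.
have eta_ge0 : 0 <= eta by rewrite mulr_ge0 // divr_ge0.
have Lam1 : 1 <= 2 * block_factor C_LN (L + 3)%:R.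
  by have := block_factor_ge1 (L + 3)%:R hC_LN; lra.
have th_ge0 : 0 <= theta m w (minn m ma) jv eta by exact: theta_ge0.
have th_le1 : theta m w (minn m ma) jv eta <= 1.
  have /andP[_ e1] := eps1_01; apply: le_trans e1; apply: le_trans acc.
  by rewrite ler_peMr // exprn_ege1.
have eta_le1 : eta <= 1.
  apply: le_trans th_le1; rewrite /theta.
  have O1 : 1 <= #|output_coord m (minn m ma) jv|%:R :> R.
    by rewrite ler1n card_output_coord -addnA (leq_trans m0) // leq_addr.
  have H1 : 1 <= #|hidden_unit m w|%:R :> R by rewrite ler1n card_hidden_unit -addnA
      (leq_trans m0) // leq_addr.
  have m1 : 1 <= m%:R :> R by rewrite ler1n.
  apply: (@le_trans _ _ (5 * eta * m%:R)).
    by apply: (@le_trans _ _ (5 * eta)); [lra | rewrite ler_peMr // mulr_ge0].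
  have h1 : 0 <= 5 * eta * m%:R by rewrite !mulr_ge0.
  by rewrite mulrA ler_peMl // mulr_ege1.
have m_le_n : (m <= mL)%N by apply: leq_trans smL; rewrite -addnA leq_addr.
have [pos [pos_inj pos_widen]] := output_embedding m_le_n smL.
have [row row_inj] : exists f : 'I_(minn m ma) * 'I_jk -> 'I_maL, injective f.
  by apply: ord_embedding; rewrite card_prod !card_ord.
have [f f_inj] : exists f : hidden_unit m w * ('I_16 * 'I_b) -> 'I_wL, injective f.
  by apply: ord_embedding; rewrite !card_prod card_hidden_unit !card_ord.
(* The three labellings may share neurons' indices: [e], [h] and [f] address the first, second and
   third hidden layer, so each has to be injective only on its own. *)
pose e (p : 'I_m * ('I_16 * 'I_b)) := f (inl (inl p.1), p.2).
have e_inj : injective e by move=> [i c] [i' c'] /f_inj[-> ->].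
pose h i := f (i, (ord0, Ordinal b0)).
have h_inj : injective h by move=> i i' /f_inj[].
have good := random_weights_fail_at_most m_le_n q0 h e_inj f_inj pos_inj row_inj
  xi_unif xi_indep (lexx eta).
apply: fails_at_most_with_prob_ge; apply: (fails_at_mostW _ fail good) => omega /= Hgood.
pose W := params_of_entries (fun k => xi k omega).
have dense k : layer_dense m_le_n e h f pos eta (W k) by have [] := Hgood k.
have values k : selects_values m_le_n pos (W k) by have [] := Hgood k.
have scores k : selects_scores pos row (W k) by have [] := Hgood k.
have /andP[_ e1] := eps1_01.
have [T' [prT' Happ]] := network_approx (W := W) hC_LN e_inj h_inj f_inj pos_inj row_inj
    pos_widen
  eta_ge0 eta_le1 e1 th_le1 acc T_ln T_le1 (fun k => erefl 1) dense values scores.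
exists T'; split => // X X1; apply: (le_trans (Happ N X X1)).
by rewrite ler_wpM2r ?norm12_ge0 // ge_min lexx.
Qed.
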